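(* The topology of $\dot{\mathcal B}_c$ is generated by the seminorms $p_{m,\varphi}$, $(m,\varphi)\in\mathbb N_0\times\dot{\mathcal B}$, defined by $$\dot{\mathcal B}\ni f\mapsto p_{m,\varphi}(f)=\|\varphi\,(L_{-2m}*f)\|_\infty.$$
   Context: All spaces are on $\mathbb R^n$. $\dot{\mathcal B}$ is the space of smooth functions all of whose derivatives vanish at infinity, with the topology generated by $\sup_{|\alpha|\le m}\|\partial^\alpha f\|_\infty$, $m\in\mathbb N_0$. $\mathcal D'_{L^1}$ is the strong dual of $\dot{\mathcal B}$. $\dot{\mathcal B}_c$ is $\dot{\mathcal B}$ with the topology $\kappa(\dot{\mathcal B},\mathcal D'_{L^1})$ of uniform convergence on absolutely convex compact subsets of $\mathcal D'_{L^1}$. $L_{-2m}=(1-\Delta_n)^m\delta$, so $L_{-2m}*f=(1-\Delta_n)^mf$. *)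

(* Defs.v *)
From HB Require Import structures.
From mathcomp Require Import all_boot all_order all_algebra.
From mathcomp Require Import complex.
From mathcomp Require Import all_classical all_reals all_analysis.

Set Implicit Arguments.
Unset Strict Implicit.
Unset Printing Implicit Defensive.

Import Order.TTheory GRing.Theory Num.Theory.
Import numFieldNormedType.Exports.
Import ComplexField.Normc.

Local Open Scope classical_set_scope.
Local Open Scope ring_scope.
Local Open Scope complex_scope.

Lemma normc_ge0 (R : realType) (a : R[i]) : 0 <= normc a.
Proof. by case: a => x y; exact: sqrtr_ge0. Qed.

Section seminorm.
Context (R : realType) (V : lmodType R[i]).

Record seminorm := Seminorm {
  seminorm_fun :> V -> R ;
  seminormD : forall x y, seminorm_fun (x + y) <= seminorm_fun x + seminorm_fun y ;
  seminormZ : forall (a : R[i]) x, seminorm_fun (a *: x) = normc a * seminorm_fun x }.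

Lemma seminorm0 (p : seminorm) : p 0 = 0.
Proof. by rewrite -(scale0r 0) seminormZ normc0 mul0r. Qed.

Lemma seminormN (p : seminorm) x : p (- x) = p x.
Proof. by rewrite -scaleN1r seminormZ normcN normc1 mul1r. Qed.

Lemma seminorm_ge0 (p : seminorm) x : 0 <= p x.
Proof.
have := seminormD p x (- x); rewrite subrr seminorm0 seminormN -mulr2n.
by rewrite pmulrn_lge0.
Qed.

End seminorm.

(* V with the locally convex topology generated by the family of seminorms p;
   the finite subfamilies of p are given by sequences of indices. *)
Definition seminormed (R : realType) (V : lmodType R[i]) (I : Type)
  (p : I -> seminorm V) : Type := V.

Section seminormed.
Context (R : realType) (V : lmodType R[i]) (I : Type) (p : I -> seminorm V).
Local Notation W := (seminormed p).

HB.instance Definition _ := GRing.Lmodule.on W.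

Definition seminorm_ball (x : W) (s : seq I) (e : R) : set W :=
  [set y | all (fun i => p i (y - x) < e) s].

Definition seminormed_nbhs (x : W) : set_system W :=
  [set A | exists s : seq I, exists2 e : R, 0 < e & seminorm_ball x s e `<=` A].

HB.instance Definition _ := hasNbhs.Build W seminormed_nbhs.

Let ballxx x s e : 0 < e -> seminorm_ball x s e x.
Proof.
by move=> e0; rewrite /seminorm_ball/=; elim: s => //= i s ->; rewrite subrr seminorm0 e0.
Qed.

Let ball_cat x s1 s2 e1 e2 : seminorm_ball x (s1 ++ s2) (Num.min e1 e2) `<=`
  seminorm_ball x s1 e1 `&` seminorm_ball x s2 e2.
Proof.
move=> y; rewrite /seminorm_ball/= all_cat => /andP[y1 y2].
by split; [apply: sub_all y1|apply: sub_all y2] => i /=; rewrite lt_min => /andP[].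
Qed.

Let ball_split x s e y : 0 < e -> seminorm_ball x s e y ->
  exists2 d, 0 < d & seminorm_ball y s d `<=` seminorm_ball x s e.
Proof.
move=> e0; rewrite /seminorm_ball; elim: s => [_|i s ih /=]; first by exists 1.
case/andP=> yi /ih[d d0 yd]; exists (Num.min d (e - p i (y - x))).
  by rewrite lt_min d0 subr_gt0.
move=> z /=/andP[]; rewrite lt_min => /andP[_ zi] zs; apply/andP; split.
  rewrite (_ : z - x = (z - y) + (y - x)); last by rewrite addrA subrK.
  by rewrite (le_lt_trans (seminormD _ _ _))// -ltrBrDr.
by apply: yd; apply: sub_all zs => j /=; rewrite lt_min => /andP[].
Qed.

Let nbhs_pfilter (x : W) : ProperFilter (nbhs x).
Proof.
split; first by move=> [s [e e0]] /(_ x (ballxx _ _ e0)).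
split.
- by exists [::], 1.
- move=> A B [s1 [e1 e10 A1]] [s2 [e2 e20 B2]].
  exists (s1 ++ s2), (Num.min e1 e2); first by rewrite lt_min e10.
  by move=> y /ball_cat[/A1 ? /B2].
- by move=> A B AB [s [e e0 sA]]; exists s, e => // y /sA/AB.
Qed.

Let nbhs_singl (x : W) (A : set W) : nbhs x A -> A x.
Proof. by move=> [s [e e0]]; apply; exact: ballxx. Qed.

Let nbhs_nbhsx (x : W) (A : set W) : nbhs x A -> nbhs x (nbhs^~ A).
Proof.
move=> [s [e e0 sA]]; exists s, e => // y /(ball_split e0)[d d0 yd].
by exists s, d => // z /yd/sA.
Qed.

HB.instance Definition _ :=
  Nbhs_isNbhsTopological.Build W nbhs_pfilter nbhs_singl nbhs_nbhsx.

Let add_cont : continuous (fun z : W * W => z.1 + z.2).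
Proof.
move=> [x y] A [s [e e0 sA]].
exists (seminorm_ball x s (e / 2), seminorm_ball y s (e / 2)).
  by split; exists s, (e / 2) => //; rewrite divr_gt0.
move=> [x' y'] /= [x'x y'y]; apply: sA; move: x'x y'y; rewrite /seminorm_ball/=.
elim: s => //= i s ih /andP[xi xs] /andP[yi ys]; rewrite ih// andbT.
rewrite opprD addrACA (le_lt_trans (seminormD _ _ _))//.
by rewrite [ltRHS](splitr e) ltrD.
Qed.

Let scale_cont : continuous (fun z : R[i]^o * W => z.1 *: z.2).
Proof.
move=> [a x] A [s [e e0 sA]].
pose M := 1 + \sum_(i <- s) p i x.
have M0 : 0 < M.
  by rewrite ltr_pwDl// sumr_ge0// => i _; exact: seminorm_ge0.
have Na := normc_ge0 a.
pose d := Num.min 1 (e / 2 / M).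
have d0 : 0 < d by rewrite lt_min ltr01/= !divr_gt0.
pose d' := e / 2 / (normc a + 1).
have d'0 : 0 < d' by rewrite !divr_gt0// ltr_wpDl.
exists (ball (a : R[i]^o) d%:C, seminorm_ball x s d').
  split; last by exists s, d'.
  by apply: nbhsx_ballx; rewrite ltcR.
move=> [b y] /= [ab xy]; apply: sA.
have {}ab : normc (b - a) < d.
  by move: ab; rewrite -ball_normE/= distrC -ltcR.
have nb : normc b < normc a + 1.
  have -> : b = a + (b - a) by rewrite addrC subrK.
  rewrite (le_lt_trans (le_normcD _ _))// ltrD2l (lt_le_trans ab)//.
  by rewrite ge_min lexx.
have sM : all (fun i => p i x < M) s.
  rewrite /M; elim: s {M M0 d d0 ab xy} => //= i s ih.
  rewrite big_cons; apply/andP; split.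
    rewrite addrCA ltrDl ltr_pwDl// sumr_ge0// => j _; exact: seminorm_ge0.
  by apply: sub_all ih => j /lt_le_trans; apply; rewrite lerD2l lerDr seminorm_ge0.
have key i : p i (y - x) < d' -> p i x < M -> p i (b *: y - a *: x) < e.
  move=> yx xM.
  have -> : b *: y - a *: x = b *: (y - x) + (b - a) *: x.
    by rewrite scalerBr scalerBl addrA subrK.
  rewrite (le_lt_trans (seminormD _ _ _))// !seminormZ [ltRHS](splitr e) ltr_leD//.
    have := normc_ge0 b; rewrite le_eqVlt => /predU1P[<-|b0].
      by rewrite mul0r divr_gt0.
    rewrite (@lt_trans _ _ (normc b * d'))// ?ltr_pM2l//.
    by rewrite /d' mulrCA gtr_pMr ?divr_gt0// ltr_pdivrMr ?mul1r// ltr_wpDl.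
  rewrite [leRHS](_ : _ = e / 2 / M * M); last by rewrite divfK// gt_eqF.
  rewrite ler_pM ?normc_ge0 ?seminorm_ge0 ?(ltW xM)//.
  by rewrite (le_trans (ltW ab))// ge_min lexx orbT.
move: xy sM; rewrite /seminorm_ball/=; elim: (s) => //= i t ih.
by move=> /andP[xi xt] /andP[iM tM]; rewrite ih// key.
Qed.

Let locally_conv : exists2 B : set_system W,
  (forall b, b \in B -> convex_set b) & basis B.
Proof.
exists [set U | open U /\ convex_set U]; first by move=> b; rewrite inE => -[].
split=> [U []//|x A [s [e e0 sA]]].
exists (seminorm_ball x s e) => //; split; last exact: ballxx.
split.
  rewrite openE => y /(ball_split e0)[d d0 yd].
  by exists s, d.
apply/convex_setW => y z; rewrite !inE => yx zx l l0 l1; rewrite inE.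
move: yx zx; rewrite /seminorm_ball/=; elim: (s) => //= i t ih.
move=> /andP[yi yt] /andP[zi zt]; rewrite ih// andbT.
have lr : (l%:num : R[i]) = (complex.Re l%:num)%:C.
  by rewrite RRe_real// ger0_real.
have {l0} l0' : 0 < complex.Re l%:num by move: l0; rewrite lr ltcR.
have {l1} l1' : complex.Re l%:num < 1 by move: l1; rewrite lr ltcR.
set r := complex.Re _ in lr l0' l1'.
rewrite (_ : _ - x = (r%:C *: (y - x) + (1 - r)%:C *: (z - x) : V)); last first.
  rewrite !scalerBr addrACA -opprD -scalerDl -rmorphD/= (addrC r) subrK scale1r.
  by congr (_ - _); rewrite /conv/= lr rmorphB.
rewrite (le_lt_trans (seminormD _ _ _))// !seminormZ.
have nr c : 0 <= c -> normc c%:C = c :> R.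
  by move=> c0; rewrite /normc/= expr0n addr0 sqrtr_sqr ger0_norm.
rewrite !nr ?subr_ge0 ?(ltW l0') ?(ltW l1')//.
rewrite [ltRHS](_ : _ = r * e + (1 - r) * e); last by rewrite -mulrDl addrC subrK mul1r.
by rewrite ltrD// ltr_pM2l// subr_gt0.
Qed.

HB.instance Definition _ :=
  PreTopologicalLmod_isTvs.Build R[i] W add_cont scale_cont locally_conv.
HB.instance Definition _ :=
  PreTopologicalNmodule_isTopologicalNmodule.Build W add_cont.
HB.instance Definition _ :=
  TopologicalNmodule_isTopologicalLmodule.Build R[i] W scale_cont.
HB.instance Definition _ := Uniform_isTvs.Build R[i] W locally_conv.

End seminormed.

Section dual.
Context (K : numFieldType) (V : tvsType K).

Definition dual_pred : {pred (V -> K^o)} :=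
  fun f => `[< linear f /\ continuous f >].

Lemma dual_pred_submod : submod_closed dual_pred.
Proof.
split.
  apply/asboolP; split=> [a u v|]; first by rewrite scaler0 addr0.
  exact: cst_continuous.
move=> a f g /asboolP[fl fc] /asboolP[gl gc]; apply/asboolP; split=> [b u v|x].
  rewrite !fctE fl gl !scalerDr !scalerA [a * b]mulrC.
  exact: addrACA.
by apply: cvgD (gc x); apply: cvgZr; exact: fc.
Qed.

HB.instance Definition _ :=
  GRing.isSubmodClosed.Build K (V -> K^o) dual_pred dual_pred_submod.

(* The topological dual of V. Below it carries the strong topology. *)
Record strong_dual := StrongDual {
  dual_fun :> V -> K^o ;
  dual_funP : dual_fun \in dual_pred }.

HB.instance Definition _ := [isSub for dual_fun].
HB.instance Definition _ := [Choice of strong_dual by <:].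
HB.instance Definition _ := [SubChoice_isSubLmodule of strong_dual by <:].

(* B is absorbed by every neighbourhood of 0. *)
Definition tvs_bounded (B : set V) : Prop :=
  forall U : set V, nbhs 0 U ->
  exists2 r : K, 0 < r & forall a : K, r <= `|a| -> B `<=` [set a *: x | x in U].

HB.instance Definition _ := Uniform.copy strong_dual
  (initial_topology
     (fun T : strong_dual => (T : V -> K^o) : {family tvs_bounded, V -> K^o})).

End dual.

Definition absolutely_convex (K : numFieldType) (V : lmodType K) (A : set V) :=
  forall x y, A x -> A y -> forall a b : K, `|a| + `|b| <= 1 -> A (a *: x + b *: y).

Section kappa.
Context (K : numFieldType) (V : tvsType K).

Definition abs_convex_compact : set (set (strong_dual V)) :=
  [set A | absolutely_convex A /\ compact A].

(* V with the topology of uniform convergence on the absolutely convex compact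
   subsets of its strong dual. *)
Definition kappa : Type := initial_topology
  (fun v : V => (fun T : strong_dual V => T v)
     : {family abs_convex_compact, strong_dual V -> K^o}).

HB.instance Definition _ := GRing.Lmodule.copy kappa V.
HB.instance Definition _ := Uniform.on kappa.

End kappa.

Lemma is_derive_lin (R : realType) (V : normedModType R) (u v w : V -> R)
    (a b : R) x z :
  derivable u x z -> derivable v x z -> derivable w x z ->
  is_derive x z (fun y => a * u y + b * v y + w y)
    (a * 'D_z u x + b * 'D_z v x + 'D_z w x).
Proof.
move=> /derivableP du /derivableP dv /derivableP dw.
exact: (is_deriveD (is_deriveD (is_deriveZ a du) (is_deriveZ b dv)) dw).
Qed.

Lemma derivable_lin (R : realType) (V : normedModType R) (u v w : V -> R)
    (a b : R) x z :
  derivable u x z -> derivable v x z -> derivable w x z ->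
  derivable (fun y => a * u y + b * v y + w y) x z.
Proof. by move=> du dv dw; have [] := is_derive_lin a b du dv dw. Qed.

Section functions.
Context (R : realType) (n : nat).
Local Notation E := 'rV[R]_n.
Local Notation C := R[i]^o.
Implicit Types (f g : E -> C) (w : seq 'I_n) (m : nat).

(* R[i] has no normed module structure over R in the libraries, so real
   derivatives of complex-valued functions are taken componentwise. *)
Definition partial (i : 'I_n) f : E -> C := fun x =>
  ('D_(delta_mx 0 i) (fun y => complex.Re (f y)) x +i*
   'D_(delta_mx 0 i) (fun y => complex.Im (f y)) x)%C.

Definition partially_derivable (i : 'I_n) f := forall x : E,
  derivable (fun y => complex.Re (f y)) x (delta_mx 0 i) /\
  derivable (fun y => complex.Im (f y)) x (delta_mx 0 i).

(* w is a word of directions: no symmetry of iterated derivatives is assumed. *)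
Definition pderiv w f : E -> C := foldr partial f w.

Definition smooth f := forall w, continuous (pderiv w f) /\
  forall i, partially_derivable i (pderiv w f).

Definition vanishes_at_infinity f := forall e : R, 0 < e ->
  exists r : R, forall x : E, r < `|x| -> normc (f x) < e.

(* The derivative of multi-index alpha. *)
Definition multi_pderiv (alpha : 'I_n -> nat) f : E -> C :=
  pderiv (flatten [seq nseq (alpha i) i | i <- enum 'I_n]) f.

Definition supnorm f : R := sup (range (fun x => normc (f x))).

Definition laplacian f : E -> C := \sum_(i < n) partial i (partial i f).

(* (1 - Delta)^m f, that is, L_{-2m} * f. *)
Definition one_sub_laplacian m f : E -> C :=
  iter m (fun g => g - laplacian g) f.

Definition bounded_fun f := exists M : R, forall x, normc (f x) <= M.

Lemma bounded_funD f g : bounded_fun f -> bounded_fun g -> bounded_fun (f + g).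
Proof.
move=> [M fM] [N gN]; exists (M + N) => x.
by rewrite (le_trans (le_normcD _ _))// lerD.
Qed.

Lemma bounded_funZ (a : R[i]) f : bounded_fun f -> bounded_fun (a *: f).
Proof.
move=> [M fM]; exists (normc a * M) => x.
by rewrite [_ x]/(a * f x) normcM ler_wpM2l// normc_ge0.
Qed.

Lemma bounded_funM f g :
  bounded_fun f -> bounded_fun g -> bounded_fun (fun x => f x * g x).
Proof.
move=> [M fM] [N gN]; exists (M * N) => x.
by rewrite normcM ler_pM ?normc_ge0.
Qed.

Lemma supnorm_ge f x : bounded_fun f -> normc (f x) <= supnorm f.
Proof.
by move=> [M fM]; apply: ub_le_sup; [exists M => _ [y _ <-]|exists x].
Qed.

Lemma supnorm_le f M : (forall x, normc (f x) <= M) -> supnorm f <= M.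
Proof.
by move=> fM; apply: ge_sup => [|_ [x _ <-]//]; exists (normc (f 0)), 0.
Qed.

Lemma supnorm_ge0 f : bounded_fun f -> 0 <= supnorm f.
Proof. by move=> fb; rewrite (le_trans (normc_ge0 (f 0)))// supnorm_ge. Qed.

Lemma supnormD f g : bounded_fun f -> bounded_fun g ->
  supnorm (f + g) <= supnorm f + supnorm g.
Proof.
move=> fb gb; apply: supnorm_le => x.
by rewrite (le_trans (le_normcD _ _))// lerD// supnorm_ge.
Qed.

Lemma supnormZ (a : R[i]) f : bounded_fun f ->
  supnorm (a *: f) = normc a * supnorm f.
Proof.
move=> fb.
have le b g : bounded_fun g -> supnorm (b *: g) <= normc b * supnorm g.
  move=> gb; apply: supnorm_le => x.
  by rewrite [_ x]/(b * g x) normcM ler_wpM2l ?normc_ge0// supnorm_ge.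
apply/eqP; rewrite eq_le le//=.
have [->|a0] := eqVneq a 0.
  by rewrite normc0 mul0r supnorm_ge0//; exact: bounded_funZ.
have na0 : normc a != 0 by apply: contra a0 => /eqP/eq0_normc ->.
rewrite -ler_pdivlMl ?lt_def ?na0 ?normc_ge0// -normcV.
by rewrite -[in leLHS](scale1r f) -(mulVf a0) -scalerA le//; exact: bounded_funZ.
Qed.

Let ReE (a : R[i]) f g : (fun y => complex.Re ((a *: f + g) y)) =
  (fun y => complex.Re a * complex.Re (f y) + (- complex.Im a) * complex.Im (f y) +
     complex.Re (g y)).
Proof.
have E (b c d : R[i]) : complex.Re (b * c + d) =
    complex.Re b * complex.Re c + - complex.Im b * complex.Im c + complex.Re d.
  by case: b c d => [? ?] [? ?] [? ?]; rewrite mulNr.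
by apply/funext => y; exact: E.
Qed.

Let ImE (a : R[i]) f g : (fun y => complex.Im ((a *: f + g) y)) =
  (fun y => complex.Re a * complex.Im (f y) + complex.Im a * complex.Re (f y) +
     complex.Im (g y)).
Proof.
have E (b c d : R[i]) : complex.Im (b * c + d) =
    complex.Re b * complex.Im c + complex.Im b * complex.Re c + complex.Im d.
  by case: b c d => [? ?] [? ?] [? ?].
by apply/funext => y; exact: E.
Qed.

Let partially_derivable_lin i (a : R[i]) f g :
  partially_derivable i f -> partially_derivable i g ->
  partially_derivable i (a *: f + g).
Proof.
move=> df dg x; have [f1 f2] := df x; have [g1 g2] := dg x.
rewrite ReE ImE; split.
  exact: (@derivable_lin R 'rV[R]_n _ _ _ _ _ _ _ f1 f2 g1).
exact: (@derivable_lin R 'rV[R]_n _ _ _ _ _ _ _ f2 f1 g2).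
Qed.

Let partial_lin i (a : R[i]) f g :
  partially_derivable i f -> partially_derivable i g ->
  partial i (a *: f + g) = a *: partial i f + partial i g.
Proof.
move=> df dg; apply/funext => x; have [f1 f2] := df x; have [g1 g2] := dg x.
rewrite /partial ReE ImE.
rewrite (@derive_val _ _ _ _ _ _ _ (is_derive_lin _ _ f1 f2 g1)).
rewrite (@derive_val _ _ _ _ _ _ _ (is_derive_lin _ _ f2 f1 g2)).
by case: (a) => a1 a2; rewrite mulNr.
Qed.

Lemma pderiv_lin w (a : R[i]) f g : smooth f -> smooth g ->
  pderiv w (a *: f + g) = a *: pderiv w f + pderiv w g.
Proof.
move=> sf sg; elim: w => //= i w ->.
by apply: partial_lin; [exact: (sf w).2|exact: (sg w).2].
Qed.

Lemma smooth_lin (a : R[i]) f g : smooth f -> smooth g -> smooth (a *: f + g).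
Proof.
move=> sf sg w; rewrite pderiv_lin//; split=> [x|i].
  by apply: cvgD ((sg w).1 x); apply: cvgZr; exact: (sf w).1.
by apply: partially_derivable_lin; [exact: (sf w).2|exact: (sg w).2].
Qed.

Lemma vanishes_lin (a : R[i]) f g : vanishes_at_infinity f ->
  vanishes_at_infinity g -> vanishes_at_infinity (a *: f + g).
Proof.
move=> fv gv e e0; have na := normc_ge0 a.
have e'0 : 0 < e / 2 / (normc a + 1) by rewrite !divr_gt0// ltr_wpDl.
have [r fr] := fv _ e'0; have [t gt] := gv (e / 2) (divr_gt0 e0 (ltr0Sn _ 1)).
exists (Num.max r t) => x; rewrite gt_max => /andP[/fr fx /gt gx].
rewrite (le_lt_trans (le_normcD _ _))// [ltRHS]splitr ler_ltD//.
rewrite [(a *: f) x]/(a * f x) normcM.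
rewrite (le_trans (ler_wpM2l na (ltW fx)))//.
by rewrite mulrCA ger_pMr ?divr_gt0// ler_pdivrMr ?mul1r ?ltr_wpDl// lerDl.
Qed.

Definition Bdot_pred : {pred (E -> C)} :=
  fun f => `[< smooth f /\ forall w, vanishes_at_infinity (pderiv w f) >].

Lemma Bdot_pred_submod : submod_closed Bdot_pred.
Proof.
have z w : pderiv w 0 = 0.
  elim: w => //= i w ->; apply/funext => x; rewrite /partial.
  by rewrite [X in X +i* _](derive_cst 0) [X in _ +i* X](derive_cst 0).
split; last first.
  move=> a f g /asboolP[fs fv] /asboolP[gs gv]; apply/asboolP; split.
    exact: smooth_lin.
  by move=> w; rewrite pderiv_lin//; exact: vanishes_lin.
apply/asboolP; split => w; rewrite z; last first.
  by move=> e e0; exists 0 => x _; rewrite normc0.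
split; first exact: cst_continuous.
by move=> i x; split; exact: derivable_cst.
Qed.

HB.instance Definition _ :=
  GRing.isSubmodClosed.Build R[i] (E -> C) Bdot_pred Bdot_pred_submod.

Lemma Bdot_pred_pderiv w f : f \in Bdot_pred -> pderiv w f \in Bdot_pred.
Proof.
move=> /asboolP[fs fv]; apply/asboolP; split=> w'.
  by rewrite /pderiv -foldr_cat; exact: fs.
by rewrite /pderiv -foldr_cat; exact: fv.
Qed.

Lemma Bdot_pred_laplacian f : f \in Bdot_pred -> laplacian f \in Bdot_pred.
Proof.
by move=> fB; apply: rpred_sum => i _; exact: (@Bdot_pred_pderiv [:: i; i]).
Qed.

Lemma Bdot_pred_one_sub_laplacian m f :
  f \in Bdot_pred -> one_sub_laplacian m f \in Bdot_pred.
Proof.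
by move=> fB; elim: m => //= m ih; rewrite rpredB// Bdot_pred_laplacian.
Qed.

Lemma laplacian_lin (a : R[i]) f g : smooth f -> smooth g ->
  laplacian (a *: f + g) = a *: laplacian f + laplacian g.
Proof.
move=> fs gs; rewrite /laplacian scaler_sumr -big_split.
by apply: eq_bigr => i _; exact: (@pderiv_lin [:: i; i]).
Qed.

Lemma one_sub_laplacian_lin m (a : R[i]) f g : f \in Bdot_pred ->
  g \in Bdot_pred -> one_sub_laplacian m (a *: f + g) =
    a *: one_sub_laplacian m f + one_sub_laplacian m g.
Proof.
move=> fB gB; elim: m => //= m ->; rewrite laplacian_lin.
- by rewrite scalerBr opprD addrACA.
- by have /asboolP[] := Bdot_pred_one_sub_laplacian m fB.
- by have /asboolP[] := Bdot_pred_one_sub_laplacian m gB.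
Qed.

Lemma ler_distc (a b : R[i]) : `|normc a - normc b| <= normc (a - b).
Proof.
have key (c d : R[i]) : normc c - normc d <= normc (c - d).
  by rewrite lerBlDr -[in leLHS](subrK d c) le_normcD.
by rewrite ler_norml key andbT lerNl opprB (le_trans (key b a))// -normcN opprB.
Qed.

Lemma Bdot_bounded f : f \in Bdot_pred -> bounded_fun f.
Proof.
move=> /asboolP[fs /(_ [::])/(_ 1 ltr01)[r fr]].
have fc : continuous (fun x : E => normc (f x) : R).
  move=> x; apply: (@cvgrPdist_lt R R _ (nbhs x) (nbhs_filter x) _ _).2 => e e0.
  have := (@cvgrPdist_lt R[i] R[i]^o _ (nbhs x) (nbhs_filter x) f (f x)).1
    ((fs [::]).1 x) e%:C.
  rewrite ltcR => /(_ e0); apply: (@filterS _ _ (nbhs_filter x)) => y.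
  rewrite -[`|_|]/((normc _)%:C) ltcR; apply: le_lt_trans.
  exact: ler_distc.
have kc : compact [set x : E | `|x| <= r].
  apply: bounded_closed_compact.
    by exists r; split=> [|M rM x /= /le_trans]; [exact: num_real|apply; exact: ltW].
  rewrite (_ : [set x | _] = (@Num.norm R E) @^-1` [set y | y <= r])//.
  by apply: closed_comp => [x _|]; [exact: (@norm_continuous R E)|exact: closed_le].
have [M [_ Mf]] := compact_bounded (continuous_compact (continuous_subspaceT fc) kc).
exists (Num.max 1 (M + 1)) => x; rewrite le_max.
have [xr|/fr/ltW->//] := leP `|x| r; apply/orP; right.
rewrite (le_trans (ler_norm _))//; apply: (Mf (M + 1)); first by rewrite ltrDl.
by exists x.
Qed.

End functions.

Section Bdot.
Context (R : realType) (n : nat).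
Local Notation E := 'rV[R]_n.
Local Notation C := R[i]^o.

Record Bdot := BuildBdot {
  Bdot_fun :> E -> C ;
  Bdot_funP : Bdot_fun \in @Bdot_pred R n }.

HB.instance Definition _ := [isSub for Bdot_fun].
HB.instance Definition _ := [Choice of Bdot by <:].
HB.instance Definition _ := [SubChoice_isSubLmodule of Bdot by <:].

Let smoothB (f : Bdot) : smooth f.
Proof. by have /asboolP[] := Bdot_funP f. Qed.

Section seminorm_of_linear_operator.
Context (D : (E -> C) -> E -> C)
  (Dlin : forall (a : R[i]) (f g : Bdot),
    D (a *: Bdot_fun f + Bdot_fun g) = a *: D f + D g)
  (Dbounded : forall f : Bdot, bounded_fun (D f)).

Lemma supnorm_linD (f g : Bdot) :
  supnorm (D (f + g : Bdot)) <= supnorm (D f) + supnorm (D g).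
Proof.
have -> : D (f + g : Bdot) = D f + D g by have := Dlin 1 f g; rewrite !scale1r.
exact: supnormD.
Qed.

Lemma supnorm_linZ (a : R[i]) (f : Bdot) :
  supnorm (D (a *: f : Bdot)) = normc a * supnorm (D f).
Proof.
have D0 : D (0 : Bdot) = 0.
  by have := Dlin (-1) 0 0; rewrite !scaleN1r !addNr.
have -> : D (a *: f : Bdot) = a *: D f.
  by have := Dlin a f 0; rewrite D0 !addr0.
exact: supnormZ.
Qed.

End seminorm_of_linear_operator.

Let pderiv_linB w (a : R[i]) (f g : Bdot) :
  pderiv w (a *: Bdot_fun f + Bdot_fun g) = a *: pderiv w f + pderiv w g.
Proof. exact: pderiv_lin. Qed.

Let pderiv_boundedB w (f : Bdot) : bounded_fun (pderiv w f).
Proof. exact/Bdot_bounded/Bdot_pred_pderiv/Bdot_funP. Qed.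

(* The multi-indices of order at most m all have entries at most m. *)
Definition Bdot_norm (m : nat) (f : Bdot) : R :=
  \big[Num.max/0]_(alpha : {ffun 'I_n -> 'I_m.+1} | (\sum_i alpha i <= m)%N)
    supnorm (multi_pderiv (fun i => alpha i) f).

Let Bdot_normD m f g : Bdot_norm m (f + g) <= Bdot_norm m f + Bdot_norm m g.
Proof.
have ge0 h : 0 <= Bdot_norm m h by exact: bigmax_ge_id.
apply/bigmax_leP; split=> [|alpha am]; first by rewrite addr_ge0.
rewrite (le_trans (supnorm_linD (@pderiv_linB _) (@pderiv_boundedB _) f g))//.
by apply: lerD; apply: le_bigmax_cond.
Qed.

Let Bdot_normZ m a f : Bdot_norm m (a *: f) = normc a * Bdot_norm m f.
Proof.
rewrite /Bdot_norm; elim/big_ind2: _ => [|? x ? y -> ->|alpha _].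
- by rewrite mulr0.
- by rewrite maxr_pMr// normc_ge0.
- exact: (supnorm_linZ (@pderiv_linB _) (@pderiv_boundedB _)).
Qed.

Definition Bdot_seminorm (m : nat) : seminorm Bdot :=
  Seminorm (@Bdot_normD m) (@Bdot_normZ m).

HB.instance Definition _ := Tvs.copy Bdot (seminormed Bdot_seminorm).

Let weighted_lin m (phi : Bdot) (a : R[i]) (f g : Bdot) :
  (fun x => phi x * one_sub_laplacian m (a *: Bdot_fun f + Bdot_fun g) x) =
  a *: (fun x => phi x * one_sub_laplacian m f x : C) +
  (fun x => phi x * one_sub_laplacian m g x).
Proof.
apply/funext => x; rewrite one_sub_laplacian_lin ?Bdot_funP//.
by rewrite !fctE mulrDr; congr (_ + _); rewrite /GRing.scale/= mulrCA.
Qed.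

Let weighted_bounded m (phi f : Bdot) :
  bounded_fun (fun x => phi x * one_sub_laplacian m f x).
Proof.
apply: bounded_funM; apply: Bdot_bounded; first exact: Bdot_funP.
exact/Bdot_pred_one_sub_laplacian/Bdot_funP.
Qed.

Definition weighted_norm (m : nat) (phi f : Bdot) : R :=
  supnorm (fun x => phi x * one_sub_laplacian m f x).

Let weighted_normD m phi f g :
  weighted_norm m phi (f + g) <= weighted_norm m phi f + weighted_norm m phi g.
Proof. exact: (@supnorm_linD (fun f x => phi x * one_sub_laplacian m f x)
  (weighted_lin m phi) (weighted_bounded m phi)). Qed.

Let weighted_normZ m phi a f :
  weighted_norm m phi (a *: f) = normc a * weighted_norm m phi f.
Proof. exact: (@supnorm_linZ (fun f x => phi x * one_sub_laplacian m f x)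
  (weighted_lin m phi) (weighted_bounded m phi)). Qed.

Definition weighted_seminorm (mphi : nat * Bdot) : seminorm Bdot :=
  Seminorm (@weighted_normD mphi.1 mphi.2) (@weighted_normZ mphi.1 mphi.2).

End Bdot.

(* Main.v *)
Require Import Defs.
From mathcomp Require Import all_boot all_order all_algebra.
From mathcomp Require Import complex.
From mathcomp Require Import all_classical all_reals all_analysis.
From mathcomp Require Import ring lra.

(** Write p_{m,phi}(f) for the supremum of |phi (1 - Laplacian)^m f|.

   Each p_{m,phi} is continuous on kappa because its polar, the set of functionals T
   with |T f| <= p_{m,phi}(f) for all f, is absolutely convex and compact in the
   strong dual ([polar_compact]), and p_{m,phi}(f) is the supremum of |T f| over it
   ([polar_bound]). Compactness combines Alaoglu and Arzela-Ascoli: bounded sets of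
   test functions are totally bounded for p_{m,phi}, since (1 - Laplacian)^m maps them
   to equi-Lipschitz functions and the factor phi makes these small at infinity.

   Conversely, let K be a compact set of functionals. One weighted seminorm dominates
   all of K ([compact_dual_weighted]), for the following reasons.

   K is equicontinuous: |T f| <= c |f|_m for some order m. It is also tight
   ([compact_dual_tight]): |T f| is uniformly small when |f|_(m+1) <= 1 and f vanishes
   on a large ball. For a single T this holds because values of T on functions with
   disjoint supports add up while the norms do not ([dual_tight]). Compactness in the
   strong dual makes this uniform in T only on bounded sets of test functions;
   mollification bridges the gap, as it approximates in the norm of order m the unit
   ball of the norm of order m + 1 by a bounded set ([regularize_approx],
   [regularize_bounded_set]).

   Let r_k be radii beyond which K is small by the factor 4 ^- k. There is a test
   function psi which is at least of order 2 ^- k on the ball of radius r_k and whose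
   logarithmic derivatives are as small as desired ([weight_exists]). Decomposing f
   along the radii r_k bounds |T f|, for T in K, by a constant times the suprema of
   psi |D f| over the derivatives D of order at most m ([compact_dual_dominated]).

   It remains to bound psi |D f| by psi |(1 - Laplacian)^m f|. For a real test function
   u the maximum principle bounds |u| and its first partial derivatives by the supremum
   of |u - Laplacian u| ([resolvent_bound]); for the derivatives, u is compared with
   its reflection in a hyperplane, an explicit barrier being available on the half
   space. Applied to psi u this gives the weighted bound, the commutators being absorbed
   because the logarithmic derivatives of psi are small ([weighted_resolvent_bound]);
   iteration reaches all orders ([weighted_chain]). *)

Set Implicit Arguments.
Unset Strict Implicit.
Unset Printing Implicit Defensive.

Import Order.TTheory GRing.Theory Num.Theory.
Import numFieldNormedType.Exports.
Import ComplexField.Normc.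

Local Open Scope classical_set_scope.
Local Open Scope ring_scope.

(** * Continuity and differentiation along lines *)

Section continuity.
Context (R : realType) (T : topologicalType) (V : normedModType R).

Lemma continuous_fun_add (f g : T -> V) :
  continuous f -> continuous g -> continuous (fun x => f x + g x).
Proof. by move=> cf cg x; apply: cvgD; [exact: cf|exact: cg]. Qed.

Lemma continuous_fun_sub (f g : T -> V) :
  continuous f -> continuous g -> continuous (fun x => f x - g x).
Proof. by move=> cf cg x; apply: cvgB; [exact: cf|exact: cg]. Qed.

Lemma continuous_fun_scale (f : T -> R) (g : T -> V) :
  continuous f -> continuous g -> continuous (fun x => f x *: g x).
Proof. by move=> cf cg x; apply: cvgZ; [exact: cf|exact: cg]. Qed.

Lemma continuous_fun_mul (f g : T -> R) :
  continuous f -> continuous g -> continuous (fun x => f x * g x).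
Proof. by move=> cf cg x; apply: cvgM; [exact: cf|exact: cg]. Qed.

Lemma continuous_fun_cst (a : V) : continuous (fun _ : T => a).
Proof. by move=> x; exact: cvg_cst. Qed.

Lemma continuous_fun_comp (U : topologicalType) (f : T -> V) (g : V -> U) :
  continuous f -> continuous g -> continuous (fun x => g (f x)).
Proof. by move=> cf cg x; apply: continuous_comp; [exact: cf|exact: cg]. Qed.

End continuity.

Lemma continuous_epsP (R : realType) (T : topologicalType) (u : T -> R) (x : T) :
  {for x, continuous u} <->
  forall e : R, 0 < e -> \forall y \near x, `|u x - u y| <= e.
Proof.
split; first by move=> /cvgrPdist_le.
by move=> H; apply/cvgrPdist_le.
Qed.

Lemma continuous_ballP (R : realType) (V : normedModType R) (u : V -> R) (x : V) :
  {for x, continuous u} <->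
  forall e : R, 0 < e -> exists2 r : R, 0 < r &
    forall y, `|x - y| < r -> `|u x - u y| <= e.
Proof.
split=> [/continuous_epsP H e /H /nbhs_ballP[r /= r0 rP]|H].
  by exists r => // y xy; apply: rP; rewrite -ball_normE.
apply/continuous_epsP => e /H[r r0 rP]; apply/nbhs_ballP; exists r => // y.
by rewrite -ball_normE; exact: rP.
Qed.

Section is_derive_eps.
Context (R : realType) (V : normedModType R).
Implicit Types (u : V -> R) (x v : V).

(** Directional derivatives are handled through this quantitative form: it passes
   to lines, shifts, dilations and averages without any appeal to filters. *)
Lemma is_derive_epsP u x v (d : R) : is_derive x v u d <->
  forall e : R, 0 < e -> exists2 r : R, 0 < r & forall h : R, `|h| < r ->
    `|u (x + h *: v) - u x - h * d| <= e * `|h|.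
Proof.
split=> [[du <-] e e0|H].
  have /cvgrPdist_le/(_ e e0) := du.
  move=> [r /= r0 rP]; exists r => // h hr.
  have [->|h0] := eqVneq h 0; first by rewrite scale0r addr0 mul0r !subrr normr0 mulr0.
  have := rP h; rewrite /= sub0r normrN => /(_ hr h0).
  rewrite -/('D_v u x); set q := 'D_v u x; rewrite distrC (addrC _ x).
  rewrite [X in _ -> `|X| <= _](_ : _ = h * (h^-1 *: (u (x + h *: v) - u x) - q)); last first.
    by rewrite mulrBr /GRing.scale/= mulVKf.
  by rewrite normrM mulrC ler_pM2r ?normr_gt0.
have cv : (fun h => h^-1 *: (u (h *: v + x) - u x)) @ 0^' --> d.
  apply/cvgrPdist_le => e e0; have [r r0 rP] := H _ e0.
  exists r => //= h /=; rewrite sub0r normrN => hr h0.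
  have := rP _ hr; rewrite (_ : _ - _ = h * (h^-1 *: (u (h *: v + x) - u x) - d)); last first.
    by rewrite mulrBr /GRing.scale/= mulVKf// (addrC x).
  by rewrite normrM mulrC ler_pM2r ?normr_gt0// distrC.
apply: DeriveDef; first by apply/cvg_ex; exists d.
by apply: (@cvg_lim R) => //.
Qed.

End is_derive_eps.

Section line_calculus.
Context (R : realType) (V : normedModType R).
Implicit Types (u : V -> R) (x v : V).

Lemma is_derive_line u x v (s d : R) : is_derive (x + s *: v) v u d ->
  is_derive s 1 (fun t => u (x + t *: v)) d.
Proof.
move=> /is_derive_epsP H; apply/is_derive_epsP => e /H[r r0 rP].
by exists r => // h /rP; rewrite scalerDl addrA [_%:A]mulr1.
Qed.

(** The endpoints may come in either order, so that increments of both signs along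
   a line need no case distinction. *)
Lemma mvt_real (f df : R -> R) (a b : R) :
  (forall t : R, is_derive t 1 f (df t)) ->
  exists2 c : R, `|c - a| <= `|b - a| & f b - f a = df c * (b - a).
Proof.
move=> D.
have fc : continuous f.
  by move=> t; apply/differentiable_continuous/derivable1_diffP; have [] := D t.
have [ab|ba] := leP a b.
  have [c cab E] := MVT_segment ab (fun t _ => D t) (continuous_subspaceT fc).
  exists c => //; move: cab; rewrite in_itv/= => /andP[ac cb].
  by rewrite !ger0_norm ?subr_ge0// lerD2r.
have [c cab E] := MVT_segment (ltW ba) (fun t _ => D t) (continuous_subspaceT fc).
exists c; last by rewrite -opprB E -mulrN opprB.
move: cab; rewrite in_itv/= => /andP[ac cb].
by rewrite distrC [leRHS]distrC !ger0_norm ?subr_ge0 ?(ltW ba)// lerD2l lerN2.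
Qed.

Lemma mvt_line u (du : V -> R) x v (h : R) : (forall y, is_derive y v u (du y)) ->
  exists2 t : R, `|t| <= `|h| & u (x + h *: v) - u x = h * du (x + t *: v).
Proof.
move=> D.
have [|c] := @mvt_real (fun t => u (x + t *: v)) (fun t => du (x + t *: v)) 0 h.
  by move=> t; exact/is_derive_line.
by rewrite !subr0 scale0r addr0 => ch ->; exists c => //; rewrite mulrC.
Qed.

(** The error in the difference quotient is uniform as soon as second derivatives
   are bounded; this is what allows differentiating under an average. *)
Lemma taylor2_line u (du ddu : V -> R) x v (h M : R) :
  (forall y, is_derive y v u (du y)) -> (forall y, is_derive y v du (ddu y)) ->
  (forall y, `|ddu y| <= M) ->
  `|u (x + h *: v) - u x - h * du x| <= M * `|h| ^+ 2.
Proof.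
move=> D1 D2 ddM; have [t th ->] := mvt_line x h D1.
rewrite -mulrBr; have [s sh ->] := mvt_line x t D2.
rewrite !normrM mulrA mulrC ler_pM// ?mulr_ge0//.
by rewrite expr2 ler_wpM2l.
Qed.

End line_calculus.

Section second_derivative_test.
Context (R : realType).

Lemma is_derive_real_epsP (f : R -> R) (a d : R) : is_derive a 1 f d <->
  forall e : R, 0 < e -> exists2 r : R, 0 < r & forall h : R, `|h| < r ->
    `|f (a + h) - f a - h * d| <= e * `|h|.
Proof.
split=> [/is_derive_epsP H e /H[r r0 rP]|H].
  by exists r => // h /rP; rewrite [_%:A]mulr1.
apply/is_derive_epsP => e /H[r r0 rP].
by exists r => // h /rP; rewrite [_%:A]mulr1.
Qed.

Lemma right_max_derive_le0 (g : R -> R) (c r : R) : 0 < r -> is_derive (0 : R) 1 g c ->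
  (forall s : R, 0 <= s < r -> g s <= g 0) -> c <= 0.
Proof.
move=> r0 /is_derive_real_epsP D gs; rewrite leNgt; apply/negP => c0.
have [d d0 dP] := D (c / 2) (divr_gt0 c0 (ltr0Sn _ 1)).
pose h := Num.min (r / 2) (d / 2).
have h0 : 0 < h by rewrite lt_min !divr_gt0.
have hr : h < r by rewrite (@le_lt_trans _ _ (r / 2)) ?ge_min ?lexx//; lra.
have hd : h < d by rewrite (@le_lt_trans _ _ (d / 2)) ?ge_min ?lexx ?orbT//; lra.
have := dP h; rewrite ger0_norm ?(ltW h0)// => /(_ hd).
rewrite add0r ler_norml => /andP[+ _].
have := gs h; rewrite (ltW h0) hr => /(_ isT).
have : 0 < c * h by rewrite mulr_gt0.
lra.
Qed.

Lemma second_derivative_test (g g1 : R -> R) (c r : R) : 0 < r ->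
  (forall s : R, is_derive s 1 g (g1 s)) -> is_derive (0 : R) 1 g1 c ->
  (forall s : R, `|s| < r -> g s <= g 0) -> c <= 0.
Proof.
move=> r0 D1 D2 gmax.
have g10 : g1 0 = 0.
  have : is_derive (0 : R) 1 g 0.
    apply: (@derive1_at_max R g (- r) r 0).
    - lra.
    - by move=> t _; have [] := D1 t.
    - by rewrite in_itv/= oppr_lt0 r0.
    - by move=> t; rewrite in_itv/= -ltr_norml => /gmax.
  by move=> D0; rewrite -(@derive_val _ _ _ _ _ _ _ (D1 0)) (@derive_val _ _ _ _ _ _ _ D0).
rewrite leNgt; apply/negP => c0.
move/is_derive_real_epsP: D2 => /(_ (c / 2) (divr_gt0 c0 (ltr0Sn _ 1)))[d d0 dP].
pose h := Num.min (r / 2) (d / 2).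
have h0 : 0 < h by rewrite lt_min !divr_gt0.
have hr : h < r by rewrite (@le_lt_trans _ _ (r / 2)) ?ge_min ?lexx//; lra.
have hd : h < d by rewrite (@le_lt_trans _ _ (d / 2)) ?ge_min ?lexx ?orbT//; lra.
have gc : continuous g.
  by move=> t; apply/differentiable_continuous/derivable1_diffP; have [] := D1 t.
have [t] := MVT h0 (fun t _ => D1 t) (continuous_subspaceT gc).
rewrite in_itv/= => /andP[t0 th]; rewrite subr0 => E.
have := gmax h; rewrite ger0_norm ?(ltW h0)// => /(_ hr) gh.
have : g1 t * h <= 0 by rewrite -E subr_le0.
rewrite pmulr_lle0// => g1t.
have := dP t; rewrite ger0_norm ?(ltW t0)// => /(_ (lt_trans th hd)).
rewrite add0r g10 subr0 ler_norml => /andP[+ _].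
have : 0 < c * t by rewrite mulr_gt0.
lra.
Qed.

End second_derivative_test.

(** * Iterated partial derivatives of real functions *)

Lemma ler_dist_half (R : realType) (a b c d : R) :
  `|a - c| <= d / 2 -> `|b - c| <= d / 2 -> `|a - b| <= d.
Proof.
move=> A B; rewrite (_ : a - b = (a - c) - (b - c)); last by ring.
by rewrite (le_trans (ler_normB _ _))// (splitr d) lerD.
Qed.

Lemma subr_subrACA (R : realType) (a b c d : R) : a - b - (c - d) = a - c - (b - d).
Proof. by ring. Qed.

Section partials.
Context (R : realType) (V : normedModType R) (I : eqType) (e : I -> V).
Implicit Types (u v : V -> R) (i j : I) (w : seq I) (x y : V).

Definition rpart i u : V -> R := fun x => 'D_(e i) u x.

Definition rpd w u : V -> R := foldr rpart u w.

(** A record rather than a bare quantification, so that unification does not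
   unfold it. Words of directions index the iterated derivatives. *)
Record rsmooth u : Prop := RSmooth { rsmoothP : forall w,
  continuous (rpd w u) /\ forall i x, derivable (rpd w u) x (e i) }.

Lemma rpd_cat w1 w2 u : rpd (w1 ++ w2) u = rpd w1 (rpd w2 u).
Proof. exact: foldr_cat. Qed.

Lemma rsmooth_rpd w u : rsmooth u -> rsmooth (rpd w u).
Proof. by move=> su; split=> w'; rewrite -rpd_cat; exact: rsmoothP. Qed.

Lemma rsmooth_is_derive u i x : rsmooth u -> is_derive x (e i) u (rpart i u x).
Proof. by move=> /rsmoothP/(_ [::])[_ /(_ i x)] /derivableP. Qed.

Lemma rsmooth_continuous u : rsmooth u -> continuous u.
Proof. by move=> /rsmoothP/(_ [::])[]. Qed.

Lemma is_derive_rpart i u v : (forall x, is_derive x (e i) u (v x)) ->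
  rpart i u = v.
Proof. by move=> D; apply/funext => x; rewrite /rpart derive_val. Qed.

(** The unit is left out, so that decay at infinity, like boundedness, passes from
   the generators to the whole algebra. *)
Inductive ralg (G : set (V -> R)) : (V -> R) -> Prop :=
| ralg_gen u : G u -> ralg G u
| ralg_add u v : ralg G u -> ralg G v -> ralg G (fun x => u x + v x)
| ralg_mul u v : ralg G u -> ralg G v -> ralg G (fun x => u x * v x)
| ralg_scale (a : R) u : ralg G u -> ralg G (fun x => a * u x).

Definition differential_in (P : (V -> R) -> Prop) u := continuous u /\
  forall i, exists2 v, P v & forall x, is_derive x (e i) u (v x).

Lemma ralg_differential G : (forall u, G u -> differential_in (ralg G) u) ->
  forall u, ralg G u -> differential_in (ralg G) u.
Proof.
move=> GP u; elim=> {u} [//|u v Gu [cu du] Gv [cv dv]|u v Gu [cu du] Gv [cv dv]|a u Gu [cu du]].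
- split=> [x|i]; first by apply: cvgD; [exact: cu|exact: cv].
  have [u' Gu' Du] := du i; have [v' Gv' Dv] := dv i.
  exists (fun x => u' x + v' x); first exact: ralg_add.
  by move=> x; exact: (is_deriveD (Du x) (Dv x)).
- split=> [x|i]; first by apply: cvgM; [exact: cu|exact: cv].
  have [u' Gu' Du] := du i; have [v' Gv' Dv] := dv i.
  exists (fun x => u x * v' x + v x * u' x); last first.
    by move=> x; exact: (is_deriveM (Du x) (Dv x)).
  by apply: ralg_add; exact: ralg_mul.
- split=> [x|i]; first by apply: cvgM; [exact: cvg_cst|exact: cu].
  have [u' Gu' Du] := du i; exists (fun x => a * u' x); first exact: ralg_scale.
  by move=> x; exact: (is_deriveZ a (Du x)).
Qed.

(** Smoothness by coinduction: an explicit function is smooth as soon as it lies in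
   a class stable under partial derivatives. Taking for the class a generated
   algebra, only the generators have to be differentiated, and every derivative
   inherits the bounds of the algebra. *)
Lemma differential_in_rsmooth (P : (V -> R) -> Prop) :
  (forall u, P u -> differential_in P u) ->
  forall u, P u -> rsmooth u /\ forall w, P (rpd w u).
Proof.
move=> PP u Pu.
have Pw w : P (rpd w u).
  elim: w => //= i w /PP[_ /(_ i)[v Pv Dv]].
  by rewrite (is_derive_rpart Dv).
split=> //; split=> w; have [cw dw] := PP _ (Pw w); split=> // i x.
by have [v _ Dv] := dw i; have [] := Dv x.
Qed.

Lemma ralg_rsmooth G : (forall u, G u -> differential_in (ralg G) u) ->
  forall u, ralg G u -> rsmooth u /\ forall w, ralg G (rpd w u).
Proof. by move=> GP; exact/differential_in_rsmooth/ralg_differential. Qed.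

Lemma rsmooth_differential u : rsmooth u -> differential_in (ralg rsmooth) u.
Proof.
move=> su; split; first exact: rsmooth_continuous.
move=> i; exists (rpart i u); first exact/ralg_gen/(rsmooth_rpd [:: i]).
by move=> x; exact: rsmooth_is_derive.
Qed.

Lemma rsmooth_ralg u : ralg rsmooth u -> rsmooth u.
Proof. by move=> /(ralg_rsmooth rsmooth_differential)[]. Qed.

Lemma rsmoothD u v : rsmooth u -> rsmooth v -> rsmooth (fun x => u x + v x).
Proof. by move=> su sv; apply/rsmooth_ralg/ralg_add; exact: ralg_gen. Qed.

Lemma rsmoothM u v : rsmooth u -> rsmooth v -> rsmooth (fun x => u x * v x).
Proof. by move=> su sv; apply/rsmooth_ralg/ralg_mul; exact: ralg_gen. Qed.

Lemma rsmoothZ (a : R) u : rsmooth u -> rsmooth (fun x => a * u x).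
Proof. by move=> su; apply/rsmooth_ralg/ralg_scale; exact: ralg_gen. Qed.

Lemma rpd_cst w (a : R) : rpd w (cst a) = cst (if w is [::] then a else 0).
Proof.
by elim: w => //= i w ->; exact: is_derive_rpart.
Qed.

Lemma rsmooth_cst (a : R) : rsmooth (cst a).
Proof.
split=> w; rewrite rpd_cst; split=> [x|i x]; first exact: cvg_cst.
exact: derivable_cst.
Qed.

Lemma rpartD i u v : rsmooth u -> rsmooth v ->
  rpart i (fun x => u x + v x) = (fun x => rpart i u x + rpart i v x).
Proof.
move=> su sv; apply: is_derive_rpart => x.
exact: (is_deriveD (rsmooth_is_derive i x su) (rsmooth_is_derive i x sv)).
Qed.

Lemma rpartM i u v : rsmooth u -> rsmooth v ->
  rpart i (fun x => u x * v x) = (fun x => u x * rpart i v x + v x * rpart i u x).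
Proof.
move=> su sv; apply: is_derive_rpart => x.
exact: (is_deriveM (rsmooth_is_derive i x su) (rsmooth_is_derive i x sv)).
Qed.

Lemma rpartZ i (a : R) u : rsmooth u ->
  rpart i (fun x => a * u x) = (fun x => a * rpart i u x).
Proof.
move=> su; apply: is_derive_rpart => x.
exact: (is_deriveZ a (rsmooth_is_derive i x su)).
Qed.

Lemma rpdD w u v : rsmooth u -> rsmooth v ->
  rpd w (fun x => u x + v x) = (fun x => rpd w u x + rpd w v x).
Proof.
by move=> su sv; elim: w => //= i w ->; rewrite rpartD//; exact: rsmooth_rpd.
Qed.

Lemma rpdZ w (a : R) u : rsmooth u ->
  rpd w (fun x => a * u x) = (fun x => a * rpd w u x).
Proof. by move=> su; elim: w => //= i w ->; rewrite rpartZ//; exact: rsmooth_rpd. Qed.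

Lemma near_rpd_eq w u v x : (\forall y \near x, u y = v y) ->
  \forall y \near x, rpd w u y = rpd w v y.
Proof.
move=> uv; elim: w => //= i w /near_join; apply: filterS => y.
exact: near_eq_derive.
Qed.

(** Leibniz rule: the word w is distributed between the two factors in 2 ^ |w| ways. *)
Lemma rpdM_bound w u v (A B : R) x : rsmooth u -> rsmooth v -> 0 <= A ->
  (forall w', (size w' <= size w)%N -> `|rpd w' u x| <= A) ->
  (forall w', (size w' <= size w)%N -> `|rpd w' v x| <= B) ->
  `|rpd w (fun y => u y * v y) x| <= 2 ^+ size w * A * B.
Proof.
elim/last_ind: w u v => [|w i ih] u v su sv A0 uA vB.
  by rewrite expr0 mul1r normrM ler_pM//; [exact: (uA [::])|exact: (vB [::])].
have su' := rsmooth_rpd [:: i] su; have sv' := rsmooth_rpd [:: i] sv.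
rewrite -cats1 rpd_cat /= rpartM// rpdD; [|exact: rsmoothM..].
rewrite (le_trans (ler_normD _ _))// size_cat addn1 exprS.
rewrite -!mulrA mulrDl !mul1r !mulrA lerD//; last first.
  rewrite (_ : (fun _ => _) = (fun y => rpart i u y * v y)); last first.
    by apply/funext => y; rewrite mulrC.
  apply: ih => // w' w's; [|by apply: vB; rewrite size_rcons ltnW].
  by rewrite -(rpd_cat w' [:: i]); apply: uA; rewrite size_cat size_rcons addn1.
apply: ih => // w' w's; first by apply: uA; rewrite size_rcons ltnW.
by rewrite -(rpd_cat w' [:: i]); apply: vB; rewrite size_cat size_rcons addn1.
Qed.

Lemma is_derive_shiftl u x d (a b : V) : is_derive (x + a) b u d ->
  is_derive x b (fun y => u (y + a)) d.
Proof.
move=> /is_derive_epsP H; apply/is_derive_epsP => c /H[r r0 rP].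
by exists r => // h /rP; rewrite (addrAC x a).
Qed.

(** The left-hand side is symmetric in i and j, the right-hand side is not: this is
   the source of the equality of mixed derivatives. *)
Lemma second_difference u i j x (h : R) : rsmooth u ->
  exists2 st : R * R, `|st.1| <= `|h| /\ `|st.2| <= `|h| &
    u (x + h *: e j + h *: e i) - u (x + h *: e i) - (u (x + h *: e j) - u x) =
    h * (h * rpart j (rpart i u) (x + st.1 *: e i + st.2 *: e j)).
Proof.
move=> su; have su' := rsmooth_rpd [:: i] su.
pose g y := u (y + h *: e j) - u y.
have Dg y : is_derive y (e i) g (rpart i u (y + h *: e j) - rpart i u y).
  apply: is_deriveB; last exact: rsmooth_is_derive.
  exact/is_derive_shiftl/rsmooth_is_derive.
have [s sh Es] := mvt_line x h Dg.
have [t th Et] := mvt_line (x + s *: e i) h (fun y => rsmooth_is_derive j y su').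
exists (s, t) => //=; rewrite -Et -Es /g.
by rewrite (addrAC x (h *: e i)).
Qed.

(** Clairaut: both mixed derivatives take a common value at points close to x, and
   they are continuous at x. *)
Lemma rpartC i j u : rsmooth u -> rpart i (rpart j u) = rpart j (rpart i u).
Proof.
move=> su; apply/funext => x; apply/eqP; rewrite -subr_eq0 -normr_le0.
apply/ler_addgt0Pl => d d0; rewrite addr0.
have near_pd w : exists2 r : R, 0 < r & forall s t : R, `|s| < r -> `|t| < r ->
    `|rpd w u x - rpd w u (x + s *: e i + t *: e j)| <= d / 2.
  have /cvgrPdist_le/(_ (d / 2)) : rpd w u y @[y --> x] --> rpd w u x by exact: (rsmoothP su w).1.
  rewrite divr_gt0// => /(_ isT) /nbhs_ballP[r /= r0 rP].
  pose M := `|e i| + `|e j| + 1.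
  have M0 : 0 < M by rewrite ltr_wpDl// addr_ge0.
  exists (r / M); first by rewrite divr_gt0.
  move=> s t sr tr; apply: rP; rewrite -ball_normE/= -addrA opprD addrA subrr sub0r normrN.
  rewrite (le_lt_trans (ler_normD _ _))// !normrZ.
  have rM : r = r / M * M by rewrite divfK// gt_eqF.
  have := ler_wpM2r (normr_ge0 (e i)) (ltW sr).
  have := ler_wpM2r (normr_ge0 (e j)) (ltW tr).
  have : 0 < r / M by rewrite divr_gt0.
  move: rM; rewrite {2}/M; move: (r / M) => q rM ? ? ?; rewrite rM !mulrDr; lra.
have [r1 r10 H1] := near_pd [:: i; j]; have [r2 r20 H2] := near_pd [:: j; i].
pose h := Num.min r1 r2 / 2.
have h0 : 0 < h by rewrite divr_gt0// lt_min r10.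
have hr1 : `|h| < r1.
  rewrite gtr0_norm// /h; have : Num.min r1 r2 <= r1 by rewrite ge_min lexx.
  lra.
have hr2 : `|h| < r2.
  rewrite gtr0_norm// /h; have : Num.min r1 r2 <= r2 by rewrite ge_min lexx orbT.
  lra.
have [[s t] /= [sh th] E1] := second_difference i j x h su.
have [[t' s'] /= [th' sh'] E2] := second_difference j i x h su.
rewrite (addrAC x (h *: e i)) (addrAC x (t' *: e j)) in E2.
have EE : rpart j (rpart i u) (x + s *: e i + t *: e j) =
    rpart i (rpart j u) (x + s' *: e i + t' *: e j).
  apply: (@mulfI _ h); first by rewrite gt_eqF.
  apply: (@mulfI _ h); first by rewrite gt_eqF.
  exact: etrans (esym E1) (etrans (subr_subrACA _ _ _ _) E2).
have A := H1 s' t' (le_lt_trans sh' hr1) (le_lt_trans th' hr1).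
have B := H2 s t (le_lt_trans sh hr2) (le_lt_trans th hr2).
move: A B; rewrite /= EE; exact: ler_dist_half.
Qed.

Lemma rpd_rpartC w i u : rsmooth u -> rpd w (rpart i u) = rpart i (rpd w u).
Proof.
move=> su; elim: w => //= j w ->; rewrite rpartC//.
exact: rsmooth_rpd.
Qed.

Lemma rpd_rpdC w1 w2 u : rsmooth u -> rpd w1 (rpd w2 u) = rpd w2 (rpd w1 u).
Proof.
by move=> su; elim: w2 => //= i w ih; rewrite rpd_rpartC ?ih//; exact: rsmooth_rpd.
Qed.

Lemma perm_rpd w1 w2 u : rsmooth u -> perm_eq w1 w2 -> rpd w1 u = rpd w2 u.
Proof.
move=> su w12; apply/esym; move: (erefl (rpd w1 u)).
apply: (@catCA_perm_ind _ (fun w => rpd w u = rpd w1 u)) w12 => s1 s2 s3.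
rewrite !rpd_cat => <-; rewrite rpd_rpdC//.
exact: rsmooth_rpd.
Qed.

End partials.

(** * Resolvent bounds from the maximum principle *)

Lemma half_space_arith (R : realType) (ux uy lx ly N E : R) :
  `|ux - lx| <= N -> `|uy - ly| <= N -> lx - ly + 2 * N * E <= 0 ->
  ux - uy - 2 * N * (1 - E) <= 0.
Proof. by rewrite !ler_norml => /andP[? ?] /andP[? ?] ?; lra. Qed.

Section row_space.
Context (R : realType) (n : nat).
Local Notation E := 'rV[R]_n.
Implicit Types (u v : E -> R) (x y : E) (i j : 'I_n).

Definition dir i : E := delta_mx 0 i.

Definition rvanishes u := forall e : R, 0 < e ->
  exists r : R, forall x : E, r < `|x| -> `|u x| < e.

Definition rlaplacian u : E -> R := fun x => \sum_(i < n) rpart dir i (rpart dir i u) x.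

Lemma coord_le_norm x i : `|x 0 i| <= `|x|.
Proof.
rewrite {2}/Num.norm/= mx_normrE.
exact: (le_bigmax _ (fun ij : 'I_1 * 'I_n => `|x ij.1 ij.2|) (0, i)).
Qed.

Lemma norm_le_coord x (c : R) : 0 <= c -> (forall i, `|x 0 i| <= c) -> `|x| <= c.
Proof.
move=> c0 xc; rewrite /Num.norm/= mx_normrE; apply: bigmax_le => // -[i j] _ /=.
by rewrite ord1.
Qed.

Lemma norm_dir_le1 i : `|dir i| <= 1.
Proof.
apply: norm_le_coord => // j; rewrite /dir mxE eqxx /=.
by case: (_ == _); rewrite ?normr1 ?normr0.
Qed.

Lemma lipschitz_of_partials u (du : 'I_n -> E -> R) (M : R) :
  (forall i x, is_derive x (dir i) u (du i x)) -> (forall i x, `|du i x| <= M) ->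
  forall x y, `|u x - u y| <= n%:R * M * `|x - y|.
Proof.
move=> D dM x y.
have step (s : seq 'I_n) :
    `|u (y + \sum_(i <- s) (x - y) 0 i *: dir i) - u y| <= (size s)%:R * M * `|x - y|.
  elim: s => [|i s ih]; first by rewrite big_nil addr0 subrr normr0 !mul0r.
  rewrite big_cons (addrC (_ *: _)) addrA /=.
  set z := y + \sum_(j <- s) _.
  have [t _ E] := mvt_line z ((x - y) 0 i) (D i).
  rewrite (_ : _ - u y = (u (z + (x - y) 0 i *: dir i) - u z) + (u z - u y)); last first.
    by rewrite addrA subrK.
  rewrite (le_trans (ler_normD _ _))// mulrS !mulrDl lerD//.
  rewrite E normrM mul1r mulrC ler_pM//; exact: coord_le_norm.
have := step (enum 'I_n).
by rewrite big_enum -(row_sum_delta (x - y)) size_enum_ord (addrC y) subrK.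
Qed.

Lemma continuous_of_lipschitz u (L : R) :
  (forall x y, `|u x - u y| <= L * `|x - y|) -> continuous u.
Proof.
move=> H x; apply/(@continuous_ballP R E) => e e0.
have L0 : 0 < `|L| + 1 by rewrite ltr_wpDl.
exists (e / (`|L| + 1)); first by rewrite divr_gt0.
move=> y; rewrite ltr_pdivlMr// => xy; rewrite (le_trans (H x y))//.
rewrite (le_trans _ (ltW xy))// mulrC ler_wpM2l//.
by rewrite (le_trans (ler_norm _))// lerDl.
Qed.

Lemma compact_cball (r : R) : compact [set x : E | `|x| <= r].
Proof.
apply: bounded_closed_compact.
  by exists r; split=> [|M rM x /= /le_trans]; [exact: num_real|apply; exact: ltW].
rewrite (_ : [set x | _] = (@Num.norm R E) @^-1` [set y | y <= r])//.
by apply: preimage_closed => [x _|]; [exact: (@norm_continuous R E)|exact: closed_le].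
Qed.

(** If v were positive somewhere it would attain a positive maximum on Om, as v is
   eventually below any positive level; so excluding such maxima suffices. *)
Lemma nonpos_of_no_positive_max v (Om : set E) : closed Om -> continuous v ->
  (forall e : R, 0 < e -> exists r : R, forall x, Om x -> r < `|x| -> v x < e) ->
  (forall x, Om x -> 0 < v x -> (forall y, Om y -> v y <= v x) -> False) ->
  forall x, Om x -> v x <= 0.
Proof.
move=> cOm cv vinf nomax x0 Ox0; rewrite leNgt; apply/negP => v0.
have [r rP] := vinf _ v0.
pose A := [set x : E | `|x| <= Num.max r `|x0|] `&` Om.
have cA : compact A by apply: compact_closedI => //; exact: compact_cball.
have Ax0 : A x0 by split => //=; rewrite le_max lexx orbT.
have [||c cA' cmax] := @compact_EVT_max E R v A _ cA; [by exists x0| |].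
  exact: continuous_subspaceT.
have vc : 0 < v c by rewrite (lt_le_trans v0)// cmax// inE.
move: cA'; rewrite inE => -[_ Oc]; apply: (nomax c) => // y Oy.
have [yr|yr] := leP `|y| (Num.max r `|x0|); first by apply: cmax; rewrite inE.
rewrite ltW// (@lt_le_trans _ _ (v x0))//; last by apply: cmax; rewrite inE.
by apply: rP => //; rewrite (le_lt_trans _ yr)// le_max lexx.
Qed.

Lemma is_derive_lineN u x (w : E) (s d : R) : is_derive (x - s *: w) w u d ->
  is_derive s 1 (fun t => u (x - t *: w)) (- d).
Proof.
move=> /is_derive_epsP H; apply/is_derive_real_epsP => e /H[r r0 rP].
exists r => // h hr; have := rP (- h); rewrite normrN => /(_ hr).
by rewrite scalerDl opprD addrA scaleNr mulrN mulNr.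
Qed.

Lemma is_derive_barrier (c b s : R) :
  is_derive s 1 (fun t => c * (1 - expR (b - t))) (c * expR (b - s)).
Proof.
have D : is_derive s 1 (fun t : R => b - t) (0 - 1).
  exact: (is_deriveB (is_derive_cst b s 1) (is_derive_id s 1)).
have D2 := @is_derive1_comp R expR (fun t => b - t) s _ _ (is_derive_expR _) D.
have D3 := is_deriveZ c (is_deriveB (is_derive_cst (1 : R) s 1) D2).
apply: is_derive_eq D3 _.
by rewrite /GRing.scale/= !sub0r mulrN1 opprK.
Qed.

Lemma second_difference_test u i (p q : E) (b c r : R) : rsmooth dir u -> 0 < r ->
  (forall s, `|s| < r ->
    u (p + s *: dir i) - u (q - s *: dir i) - c * (1 - expR (b - s)) <=
    u p - u q - c * (1 - expR b)) ->
  rpart dir i (rpart dir i u) p - rpart dir i (rpart dir i u) q + c * expR b <= 0.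
Proof.
move=> su r0 H; have su' := rsmooth_rpd [:: i] su.
pose g s := u (p + s *: dir i) - u (q - s *: dir i) - c * (1 - expR (b - s)).
pose g1 s := rpart dir i u (p + s *: dir i) - - rpart dir i u (q - s *: dir i) - c * expR (b - s).
apply: (@second_derivative_test R g g1 _ r) => //.
- move=> s; apply: is_deriveB (is_derive_barrier c b s); apply: is_deriveB.
    exact/is_derive_line/rsmooth_is_derive.
  exact/is_derive_lineN/rsmooth_is_derive.
- have -> : g1 = (fun s => (rpart dir i u (p + s *: dir i) + rpart dir i u (q - s *: dir i)
      + c * (1 - expR (b - s))) - c).
    by apply/funext => s; rewrite /g1; ring.
  have -> : c * expR b = c * expR (b - 0) - 0 by rewrite !subr0.
  rewrite addrA; apply: is_deriveB (is_derive_cst c _ _).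
  apply: is_deriveD (is_derive_barrier c b 0); apply: is_deriveD.
    apply: is_derive_line; rewrite scale0r addr0; exact: (rsmooth_is_derive i p su').
  apply: is_derive_lineN; rewrite scale0r subr0; exact: (rsmooth_is_derive i q su').
- by move=> s sr; rewrite /g scale0r addr0 !subr0; exact: H.
Qed.

Lemma second_difference_test_same u j (p q : E) : rsmooth dir u ->
  (forall s : R, u (p + s *: dir j) - u (q + s *: dir j) <= u p - u q) ->
  rpart dir j (rpart dir j u) p - rpart dir j (rpart dir j u) q <= 0.
Proof.
move=> su H; have su' := rsmooth_rpd [:: j] su.
apply: (@second_derivative_test R (fun s => u (p + s *: dir j) - u (q + s *: dir j))
  (fun s => rpart dir j u (p + s *: dir j) - rpart dir j u (q + s *: dir j)) _ 1) => //.
- by move=> s; apply: is_deriveB; exact/is_derive_line/rsmooth_is_derive.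
- apply: is_deriveB; apply: is_derive_line; rewrite scale0r addr0.
    exact: (rsmooth_is_derive j p su').
  exact: (rsmooth_is_derive j q su').
- by move=> s _; rewrite scale0r !addr0.
Qed.

Lemma second_test_line u j (p : E) : rsmooth dir u ->
  (forall s : R, u (p + s *: dir j) <= u p) ->
  rpart dir j (rpart dir j u) p <= 0.
Proof.
move=> su H; have su' := rsmooth_rpd [:: j] su.
pose g s := u (p + s *: dir j); pose g1 s := rpart dir j u (p + s *: dir j).
apply: (@second_derivative_test R g g1 _ 1 ltr01).
- by move=> s; exact/is_derive_line/rsmooth_is_derive.
- by apply: is_derive_line; rewrite scale0r addr0; exact: (rsmooth_is_derive j p su').
- by move=> s _; rewrite /g scale0r !addr0.
Qed.

Lemma resolvent_upper u (N : R) : rsmooth dir u -> rvanishes u -> 0 <= N ->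
  (forall x, u x - rlaplacian u x <= N) -> forall x, u x <= N.
Proof.
move=> su vu N0 H x; rewrite -subr_le0.
apply: (@nonpos_of_no_positive_max (fun x => u x - N) setT) => //.
- exact: (@continuous_fun_sub R E R u (fun=> N) (rsmooth_continuous su) (@continuous_fun_cst R E R N)).
- move=> e /vu[r rP]; exists r => y _ /rP; rewrite ltr_norml => /andP[_]; lra.
- move=> y _; rewrite subr_gt0 => uy ymax.
  have : rlaplacian u y <= 0.
    apply: sumr_le0 => i _; apply: second_test_line => // s.
    by have := ymax (y + s *: dir i) I; rewrite lerD2r.
  have := H y; lra.
Qed.

Lemma rlaplacianN u : rsmooth dir u -> forall x, rlaplacian (fun x => -1 * u x) x = - rlaplacian u x.
Proof.
move=> su x; rewrite /rlaplacian -sumrN; apply: eq_bigr => i _.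
by rewrite -[LHS]/(rpd dir [:: i; i] _ x) rpdZ// mulN1r.
Qed.

Lemma rvanishesN u : rvanishes u -> rvanishes (fun x => -1 * u x).
Proof. by move=> vu e /vu[r rP]; exists r => x /rP; rewrite mulN1r normrN. Qed.

(** Reflection in the hyperplane of points with i-th coordinate a. *)
Let refl i (a : R) y := y - (2 * (y 0 i - a)) *: dir i.

Let refl_coord i a y : refl i a y 0 i - a = - (y 0 i - a).
Proof. by rewrite /refl !mxE !eqxx/= mulr1; ring. Qed.

Let reflK i a y : refl i a (refl i a y) = y.
Proof. by rewrite {1}/refl refl_coord {1}/refl mulrN scaleNr opprK subrK. Qed.

Let refl_norm i a y : `|refl i a y| <= 3 * `|y| + 2 * `|a|.
Proof.
rewrite (le_trans (ler_normB _ _))// normrZ normrM.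
have := norm_dir_le1 i; have := coord_le_norm y i; have := ler_normB (y 0 i) a.
rewrite (ger0_norm (ler0n _ 2)) => h1 h2 h3.
have : `|y 0 i - a| * `|dir i| <= `|y 0 i - a| by rewrite ler_piMr.
rewrite -mulrA; lra.
Qed.

Let refl_line i a y (s : R) : refl i a (y + s *: dir i) = refl i a y - s *: dir i.
Proof.
rewrite /refl !mxE !eqxx/= mulr1.
rewrite (_ : 2 * (y 0 i + s - a) = 2 * (y 0 i - a) + s + s); last by ring.
by rewrite !scalerDl !opprD !addrA (addrAC y (s *: _)) [X in X - s *: _](addrAC) addrK.
Qed.

Let refl_line_other i j a y (s : R) : i != j ->
  refl i a (y + s *: dir j) = refl i a y + s *: dir j.
Proof.
move=> ij; rewrite /refl !mxE eqxx/= (negbTE ij) mulr0 addr0.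
by rewrite addrAC.
Qed.

(** The difference of u and its reflection vanishes on the hyperplane, and the
   barrier 2N(1 - exp(-t)), t the distance to the hyperplane, satisfies the resolvent
   equation with right-hand side 2N. Comparison holds at a maximum because second
   differences of the two are then nonpositive in every direction. *)
Lemma resolvent_half_space u (N : R) i (a : R) : rsmooth dir u -> rvanishes u -> 0 <= N ->
  (forall x, `|u x - rlaplacian u x| <= N) ->
  forall y, a <= y 0 i ->
  u y - u (refl i a y) <= 2 * N * (1 - expR (a - y 0 i)).
Proof.
move=> su vu N0 H y ay; rewrite -subr_le0.
pose v y := u y - u (refl i a y) - 2 * N * (1 - expR (a - y 0 i)).
pose Om := [set y : E | a <= y 0 i].
have cu := rsmooth_continuous su.
have ci : continuous (fun y : E => y 0 i) by exact: coord_continuous.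
apply: (@nonpos_of_no_positive_max v Om) => //.
- rewrite (_ : Om = (fun y : E => y 0 i) @^-1` [set z | a <= z])//.
  by apply: preimage_closed => [z _|]; [exact: ci|exact: closed_ge].
- have cr : continuous (refl i a).
    apply: (@continuous_fun_sub R E E); first by move=> z; exact: cvg_id.
    apply: (@continuous_fun_scale R E E); last exact: (@continuous_fun_cst R E E).
    apply: (@continuous_fun_mul R E); first exact: (@continuous_fun_cst R E R).
    apply: (@continuous_fun_sub R E R); first exact: ci.
    exact: (@continuous_fun_cst R E R).
  apply: (@continuous_fun_sub R E R).
    apply: (@continuous_fun_sub R E R); first exact: cu.
    exact: (@continuous_fun_comp R E E _ _ _ cr cu).
  apply: (@continuous_fun_mul R E); first exact: (@continuous_fun_cst R E R).
  apply: (@continuous_fun_sub R E R); first exact: (@continuous_fun_cst R E R).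
  apply: (@continuous_fun_comp R E R R (fun z : E => a - z 0 i) expR); last exact: continuous_expR.
  by apply: (@continuous_fun_sub R E R); [exact: (@continuous_fun_cst R E R)|exact: ci].
- move=> e e0; have [r rP] := vu (e / 2) (divr_gt0 e0 (ltr0Sn _ 1)).
  exists (Num.max r (3 * r + 2 * `|a|)) => z Oz; rewrite gt_max => /andP[rz rz'].
  have h1 := rP _ rz.
  have h2 : `|u (refl i a z)| < e / 2.
    by apply: rP; have := refl_norm i a (refl i a z); rewrite reflK; lra.
  have h3 : 0 <= 2 * N * (1 - expR (a - z 0 i)).
    by rewrite mulr_ge0 ?mulr_ge0// subr_ge0 expR_le1 subr_le0.
  rewrite /v; move: h1 h2; rewrite !ltr_norml => /andP[_ ?] /andP[? _]; lra.
- move=> x Ox vx xmax; have xi : a < x 0 i.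
    rewrite lt_neqAle [_ <= _]Ox andbT; apply/eqP => ax; move: vx.
    by rewrite /v -ax subrr expR0 subrr mulr0 subr0 /refl -ax subrr mulr0 scale0r subr0 subrr ltxx.
  have tj j : j != i -> rpart dir j (rpart dir j u) x - rpart dir j (rpart dir j u) (refl i a x) <= 0.
    move=> ji; apply: second_difference_test_same => // s.
    have := xmax (x + s *: dir j); rewrite /Om/v/= refl_line_other 1?eq_sym// !mxE eqxx/=.
    by rewrite eq_sym (negbTE ji) mulr0 addr0 => /(_ Ox); rewrite lerD2r.
  have ti : rpart dir i (rpart dir i u) x - rpart dir i (rpart dir i u) (refl i a x)
      + 2 * N * expR (a - x 0 i) <= 0.
    apply: (@second_difference_test u i x (refl i a x) (a - x 0 i) (2 * N) (x 0 i - a)) => //.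
      by rewrite subr_gt0.
    move=> s; rewrite ltr_norml => /andP[sa _].
    have := xmax (x + s *: dir i); rewrite /Om/v/= refl_line !mxE !eqxx/= mulr1.
    rewrite opprD addrA; apply; lra.
  have : rlaplacian u x - rlaplacian u (refl i a x) + 2 * N * expR (a - x 0 i) <= 0.
    rewrite /rlaplacian -sumrB (bigD1 i)//= addrAC.
    rewrite -[leRHS](addr0 0); apply: lerD => //.
    exact: sumr_le0.
  move=> lap; move: vx; rewrite ltNge; apply/negP/negPn.
  exact: (half_space_arith (H x) (H (refl i a x)) lap).
Qed.

(** The half-space comparison becomes an equality on the hyperplane through x, so it
   can be differentiated there: the normal derivative is bounded without any
   knowledge of the Bessel kernel. *)
Lemma resolvent_partial_upper u (N : R) i x : rsmooth dir u -> rvanishes u -> 0 <= N ->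
  (forall x, `|u x - rlaplacian u x| <= N) -> rpart dir i u x <= N.
Proof.
move=> su vu N0 H.
have D : is_derive (0 : R) 1 (fun s => (u (x + s *: dir i) - u (x - s *: dir i)) - (2 * N) * s)
    ((rpart dir i u x - - rpart dir i u x) - 2 * N * 1).
  apply: (is_deriveB _ (@is_deriveZ R R R id (2 * N) 0 1 1 (is_derive_id (0 : R) 1))).
  apply: is_deriveB.
    by apply: is_derive_line; rewrite scale0r addr0; exact: rsmooth_is_derive.
  by apply: is_derive_lineN; rewrite scale0r subr0; exact: rsmooth_is_derive.
have := right_max_derive_le0 ltr01 D; rewrite mulr1 opprK => D'.
suff : rpart dir i u x + rpart dir i u x - 2 * N <= 0 by lra.
apply: D' => s /andP[s0 _]; rewrite scale0r addr0 !subr0 subrr mulr0 subr0.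
have := @resolvent_half_space u N i (x 0 i) su vu N0 H (x + s *: dir i).
rewrite !mxE !eqxx/= mulr1 lerDl s0 => /(_ isT).
rewrite refl_line {1}/refl subrr mulr0 scale0r subr0.
have : 2 * N * (1 - expR (x 0 i - (x 0 i + s))) <= 2 * N * s.
  rewrite ler_wpM2l ?mulr_ge0// opprD addrA subrr sub0r.
  have := expR_ge1Dx (- s); lra.
lra.
Qed.

Lemma resolvent_bound u (N : R) : rsmooth dir u -> rvanishes u ->
  (forall x, `|u x - rlaplacian u x| <= N) ->
  forall x, `|u x| <= N /\ forall i, `|rpart dir i u x| <= N.
Proof.
move=> su vu H x; have N0 : 0 <= N by exact: le_trans (normr_ge0 _) (H x).
have su' := rsmoothZ (-1) su; have vu' := rvanishesN vu.
have H' y : `|-1 * u y - rlaplacian (fun x => -1 * u x) y| <= N.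
  by rewrite rlaplacianN// mulN1r opprK addrC distrC.
split=> [|i]; rewrite ler_norml; apply/andP; split.
- rewrite lerNl -mulN1r; apply: (resolvent_upper su') => // y.
  by rewrite (le_trans (ler_norm _))// H'.
- by apply: resolvent_upper => // y; rewrite (le_trans (ler_norm _)).
- rewrite lerNl -mulN1r.
  have := @resolvent_partial_upper _ _ i x su' vu' N0 H'.
  by rewrite rpartZ.
- exact: resolvent_partial_upper.
Qed.

End row_space.

(** * Real test functions and the weighted resolvent bound *)

Lemma leibniz2_arith (R : realType) (p pi pii q qi qii : R) :
  p * qii + qi * pi + (q * pii + pi * qi) = p * qii + (2 * (pi * qi) + q * pii).
Proof. by ring. Qed.

Section test_functions.
Context (R : realType) (n : nat).
Local Notation E := 'rV[R]_n.
Local Notation dir := (@dir R n).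
Implicit Types (u v : E -> R) (w : seq 'I_n).

Record rBdot u : Prop := RBdot {
  rBdot_smooth : rsmooth dir u ;
  rBdot_vanish : forall w, rvanishes (rpd dir w u) }.

(** Multipliers of the test functions; 1 and the cutoffs are among them. *)
Record rmult u : Prop := RMult {
  rmult_smooth : rsmooth dir u ;
  rmult_bound : forall w, exists C : R, forall x, `|rpd dir w u x| <= C }.

(** There are finitely many words of bounded length, so bounds found for each word
   can be made uniform. *)
Lemma words_bound (P : seq 'I_n -> R -> Prop) :
  (forall w a b, P w a -> a <= b -> P w b) -> (forall w, exists a, P w a) ->
  forall m, exists2 a, 0 <= a & forall w, (size w <= m)%N -> P w a.
Proof.
move=> mono ex m; elim: m P mono ex => [|m ih] P mono ex; have [a0 Pa0] := ex [::].
  exists (Num.max 0 a0); first by rewrite le_max lexx.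
  by case=> // _; apply: mono Pa0 _; rewrite le_max lexx orbT.
have /choice[a aP] i : exists a, 0 <= a /\ forall w, (size w <= m)%N -> P (i :: w) a.
  have [||a a0' aP] := ih (fun w => P (i :: w)); last by exists a.
    by move=> w a b; exact: mono.
  by move=> w; exact: ex.
exists (\big[Num.max/(Num.max 0 a0)]_i a i).
  by apply: (le_trans _ (bigmax_ge_id _ _ _ _)); rewrite le_max lexx.
case=> [_|i w sw]; apply: mono.
- exact: Pa0.
- by apply: (le_trans _ (bigmax_ge_id _ _ _ _)); rewrite le_max lexx orbT.
- exact: (aP i).2 sw.
- exact: le_bigmax.
Qed.

Lemma rvanishes_bounded u : continuous u -> rvanishes u ->
  exists C : R, forall x, `|u x| <= C.
Proof.
move=> cu vu; have [r rP] := vu 1 ltr01.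
have cu' : {within [set x : E | `|x| <= r], continuous u}.
  exact: continuous_subspaceT.
have [M [_ Mu]] := compact_bounded (continuous_compact cu' (@compact_cball R n r)).
exists (Num.max 1 (M + 1)) => x; rewrite le_max.
have [xr|/rP/ltW->//] := leP `|x| r; apply/orP; right.
by apply: (Mu (M + 1)); [rewrite ltrDl|exists x].
Qed.

Lemma rBdot_mult u : rBdot u -> rmult u.
Proof.
move=> [su vu]; split=> // w; apply: rvanishes_bounded => //.
exact: (rsmoothP su w).1.
Qed.

Lemma rmult_bound_size u m : rmult u ->
  exists2 C : R, 0 <= C & forall w, (size w <= m)%N -> forall x, `|rpd dir w u x| <= C.
Proof.
move=> [_ bu].
apply: (@words_bound (fun w C => forall x, `|rpd dir w u x| <= C)) => // w a b ua ab x.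
exact: le_trans ab.
Qed.

Lemma rBdot_vanish_size u m : rBdot u -> forall e : R, 0 < e ->
  exists2 r : R, 0 <= r & forall w, (size w <= m)%N -> forall x, r < `|x| -> `|rpd dir w u x| < e.
Proof.
move=> [_ vu] e e0.
apply: (@words_bound (fun w r => forall x, r < `|x| -> `|rpd dir w u x| < e)).
  by move=> w a b ua ab x /(le_lt_trans ab)/ua.
by move=> w; exact: vu.
Qed.

Lemma rBdotM u v : rmult u -> rBdot v -> rBdot (fun x => u x * v x).
Proof.
move=> mu [sv vv]; split; first exact: rsmoothM (rmult_smooth mu) sv.
move=> w e e0; have [C C0 uC] := rmult_bound_size (size w) mu.
have e'0 : 0 < e / (2 ^+ size w * C + 1) by rewrite divr_gt0// ltr_wpDl// mulr_ge0// exprn_ge0.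
have [r _ rP] := rBdot_vanish_size (size w) (RBdot sv vv) e'0.
exists r => x rx.
have := @rpdM_bound R E _ dir w u v C _ x (rmult_smooth mu) sv C0
  (fun w' sw' => uC w' sw' x) (fun w' sw' => ltW (rP w' sw' x rx)).
move=> /le_lt_trans; apply; rewrite mulrCA gtr_pMr// ltr_pdivrMr ?mul1r ?ltrDl//.
by rewrite ltr_wpDl// mulr_ge0// exprn_ge0.
Qed.

Lemma rBdotZ (a : R) u : rBdot u -> rBdot (fun x => a * u x).
Proof.
move=> [su vu]; split; first exact: rsmoothZ.
move=> w e e0; rewrite rpdZ//.
have a0 : 0 < `|a| + 1 by rewrite ltr_wpDl.
have [r rP] := vu w _ (divr_gt0 e0 a0).
exists r => x /rP; rewrite ltr_pdivlMr// normrM mulrC; apply: le_lt_trans.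
by rewrite ler_wpM2r// lerDl.
Qed.

Lemma rBdot_rpd w u : rBdot u -> rBdot (rpd dir w u).
Proof. by move=> [su vu]; split=> [|w']; [exact: rsmooth_rpd|rewrite -rpd_cat]. Qed.

(** The product psi * u satisfies the resolvent bound up to commutator terms, each
   carrying the small factor eta. The supremum A of the quantities to be bounded is
   finite, hence A <= N + A / 2. *)
Lemma weighted_resolvent_bound (psi u : E -> R) (eta N : R) : rBdot psi -> rBdot u ->
  (forall x, 0 <= psi x) ->
  (forall i x, `|rpart dir i psi x| <= eta * psi x) ->
  (forall i x, `|rpart dir i (rpart dir i psi) x| <= eta * psi x) ->
  0 <= eta -> (3 * n%:R + 1) * eta <= 1 / 2 ->
  (forall x, psi x * `|u x - rlaplacian u x| <= N) ->
  forall x, psi x * `|u x| <= 2 * N /\ forall i, psi x * `|rpart dir i u x| <= 2 * N.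
Proof.
move=> Bpsi Bu psi0 d1 d2 eta0 eta_small H.
have [spsi vpsi] := Bpsi; have [su vu] := Bu.
have Bpu : rBdot (fun x => psi x * u x) by apply: rBdotM => //; exact: rBdot_mult.
have [Cpsi Cpsi0 psiC] := rmult_bound_size 0 (rBdot_mult Bpsi).
have [Cu Cu0 uC] := rmult_bound_size 1 (rBdot_mult Bu).
pose S := [set a : R | exists x, a = psi x * `|u x| \/ exists i, a = psi x * `|rpart dir i u x|].
have Sub : has_ubound S.
  exists (Cpsi * Cu) => _ [x] [->|[i ->]]; apply: ler_pM => //.
  - by rewrite (le_trans (ler_norm _))//; exact: (psiC [::]).
  - exact: (uC [::]).
  - by rewrite (le_trans (ler_norm _))//; exact: (psiC [::]).
  - exact: (uC [:: i]).
have Sne : S !=set0 by exists (psi 0 * `|u 0|), 0; left.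
pose A := sup S.
have SA0 x : psi x * `|u x| <= A by apply: ub_le_sup => //; exists x; left.
have SA1 x i : psi x * `|rpart dir i u x| <= A.
  by apply: ub_le_sup => //; exists x; right; exists i.
have lapE x : rlaplacian (fun x => psi x * u x) x = psi x * rlaplacian u x +
    \sum_i (2 * (rpart dir i psi x * rpart dir i u x) + u x * rpart dir i (rpart dir i psi) x).
  rewrite /rlaplacian mulr_sumr -big_split; apply: eq_bigr => i _ /=.
  have si := rsmooth_rpd [:: i] spsi; have ui := rsmooth_rpd [:: i] su.
  rewrite rpartM// rpartD; [|exact: rsmoothM..].
  by rewrite !rpartM//=; exact: leibniz2_arith.
have comm x : `|psi x * u x - rlaplacian (fun x => psi x * u x) x| <= N + 3 * n%:R * eta * A.
  rewrite lapE opprD addrA -mulrBr (le_trans (ler_normB _ _))//.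
  rewrite lerD// ?normrM ?(ger0_norm (psi0 x))//.
  rewrite (le_trans (ler_norm_sum _ _ _))//.
  rewrite (@le_trans _ _ (\sum_(i < n) 3 * eta * A))//; last first.
    by rewrite sumr_const card_ord -(mulr_natl (3 * eta * A)) !mulrA (mulrC 3).
  apply: ler_sum => i _; rewrite (le_trans (ler_normD _ _))// !normrM (ger0_norm (ler0n _ 2)).
  have h1 : `|rpart dir i psi x| * `|rpart dir i u x| <= eta * A.
    apply: le_trans (ler_wpM2r (normr_ge0 _) (d1 i x)) _.
    by rewrite -mulrA ler_wpM2l.
  have h2 : `|u x| * `|rpart dir i (rpart dir i psi) x| <= eta * A.
    rewrite mulrC; apply: le_trans (ler_wpM2r (normr_ge0 _) (d2 i x)) _.
    by rewrite -mulrA ler_wpM2l.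
  lra.
have res := resolvent_bound (rBdot_smooth Bpu) (rBdot_vanish Bpu [::]) comm.
have AN : A <= 2 * N.
  suff : A <= N + 3 * n%:R * eta * A + eta * A.
    have A0 : 0 <= A by apply: le_trans (SA0 0); rewrite mulr_ge0.
    have := ler_wpM2r A0 eta_small; lra.
  apply: ge_sup => // _ [x] [->|[i ->]].
    have := (res x).1; rewrite normrM (ger0_norm (psi0 x)).
    have : 0 <= eta * A by rewrite mulr_ge0//; apply: le_trans (SA0 0); rewrite mulr_ge0.
    lra.
  rewrite -[X in X * _](ger0_norm (psi0 x)) -normrM.
  rewrite (_ : psi x * _ = rpart dir i (fun x => psi x * u x) x - u x * rpart dir i psi x); last first.
    by rewrite rpartM// addrK.
  rewrite (le_trans (ler_normB _ _))// lerD//; first exact: (res x).2.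
  rewrite normrM mulrC; apply: le_trans (ler_wpM2r (normr_ge0 _) (d1 i x)) _.
  by rewrite -mulrA ler_wpM2l.
by move=> x; split=> [|i]; [exact: le_trans AN|exact: le_trans AN].
Qed.

End test_functions.

(** * A smooth step function *)

Section smooth_step.
Context (R : realType).
Implicit Types (p : {poly R}) (t y : R).

(** The iterated derivatives of exp (- 1 / t), extended by 0 to t <= 0, have this
   form. *)
Definition flat p t : R := if 0 < t then p.[t^-1] * expR (- t^-1) else 0.

Let next p : {poly R} := 'X^2 * (p - p^`()).

Lemma horner_expN_bound p : exists2 C : R, 0 <= C &
  forall y, 1 <= y -> `|p.[y]| * y ^+ 2 * expR (- y) <= C.
Proof.
pose N := size p; pose c := \sum_(i < size p) `|p`_i|.
have c0 : 0 <= c by apply: sumr_ge0.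
exists (c * (N.+2)`!%:R) => [|y y1]; first by rewrite mulr_ge0.
have y0 : 0 <= y by exact: le_trans y1.
have py : `|p.[y]| <= c * y ^+ N.
  rewrite horner_coef (le_trans (ler_norm_sum _ _ _))// mulr_suml; apply: ler_sum => i _.
  rewrite normrM ler_wpM2l// normrX (ger0_norm y0) ler_weXn2l//.
  exact: ltnW.
have ey : y ^+ N.+2 * expR (- y) <= (N.+2)`!%:R.
  rewrite expRN ler_pdivrMr ?expR_gt0//.
  have f0 : (0 : R) < (N.+2)`!%:R by rewrite ltr0n fact_gt0.
  rewrite mulrC -ler_pdivrMr//.
  by apply: le_trans (expR_ge1Dxn N.+1 y0); rewrite lerDr.
apply: le_trans (_ : c * y ^+ N * y ^+ 2 * expR (- y) <= _).
  by rewrite ler_wpM2r ?expR_ge0// ler_wpM2r// exprn_ge0.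
rewrite (_ : _ * expR _ = c * (y ^+ N.+2 * expR (- y))); last first.
  have -> : y ^+ N.+2 = y ^+ N * y ^+ 2 by rewrite -exprD addn2.
  by rewrite !mulrA.
by rewrite ler_wpM2l.
Qed.

Lemma flat_near0 p : exists2 C : R, 0 <= C & forall t, `|t| <= 1 -> `|flat p t| <= C * t ^+ 2.
Proof.
have [C C0 pC] := horner_expN_bound p; exists C => // t t1.
rewrite /flat; case: ifPn => t0; last by rewrite normr0 mulr_ge0// sqr_ge0.
have t1' : 1 <= t^-1 by rewrite invf_ge1// -(gtr0_norm t0).
have := pC _ t1'; rewrite normrM (ger0_norm (expR_ge0 _)).
rewrite mulrAC exprVn ler_pdivrMr// exprn_gt0//.
Qed.

Lemma is_derive_flat p t : is_derive t 1 (flat p) (flat (next p) t).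
Proof.
have [t0|t0|->] := ltgtP t 0.
- have E : \near t, cst 0 t = flat p t.
    near=> s; rewrite /flat ifF//; apply/negbTE; rewrite -leNgt ltW//.
    by near: s; exact: lt_nbhsl.
  apply: near_eq_is_derive E _; rewrite /flat ltNge (ltW t0)/=.
  exact: is_derive_cst.
- have E : \near t, p.[t^-1] * expR (- t^-1) = flat p t.
    near=> s; rewrite /flat ifT//; near: s; exact: lt_nbhsr.
  apply: near_eq_is_derive E _; rewrite /flat t0 /next hornerM hornerXn hornerD hornerN.
  have Di : is_derive t 1 (fun s : R => s^-1) (- t^-1 ^+ 2).
    apply: DeriveDef; first by apply: derivableV; [rewrite gt_eqF|exact: derivable_id].
    rewrite (@deriveV _ _ id); [|by rewrite gt_eqF|exact: derivable_id].
    by rewrite derive_id exprVn /GRing.scale/= mulr1.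
  have Dp : is_derive t 1 (fun s : R => p.[s^-1]) (p^`().[t^-1] * - t^-1 ^+ 2).
    exact: (@is_derive1_comp R (horner p) (fun s => s^-1) t _ _ (is_derive_poly p _) Di).
  have De : is_derive t 1 (fun s : R => expR (- s^-1)) (expR (- t^-1) * - (- t^-1 ^+ 2)).
    exact: (@is_derive1_comp R expR (fun s => - s^-1) t _ _ (is_derive_expR _) (is_deriveN Di)).
  apply: is_derive_eq (is_deriveM Dp De) _.
  by rewrite /GRing.scale/=; ring.
- rewrite {2}/flat ltxx; apply/is_derive_real_epsP => e e0.
  have [C C0 CP] := flat_near0 p.
  have d0 : 0 < e / (C + 1) by rewrite divr_gt0// ltr_wpDl.
  exists (Num.min 1 (e / (C + 1))); first by rewrite lt_min ltr01.
  move=> h; rewrite lt_min => /andP[h1 he].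
  rewrite add0r mulr0 subr0 [X in _ - X]/flat ltxx subr0.
  apply: le_trans (CP _ (ltW h1)) _.
  rewrite -(real_normK (num_real h)) expr2 mulrA ler_wpM2r//.
  move: he; rewrite ltr_pdivlMr ?ltr_wpDl// => he.
  have := normr_ge0 h; nra.
Unshelve. all: by end_near.
Qed.

Let one_dir (_ : unit) : R := 1.
Let flatC p t := flat p (1 - t).
Let den t := flat 1 t + flatC 1 t.

Lemma flat1_gt0 t : 0 < t -> 0 < flat 1 t.
Proof. by move=> t0; rewrite /flat t0 hornerC mul1r expR_gt0. Qed.

Lemma flat1_ge0 t : 0 <= flat 1 t.
Proof. by rewrite /flat; case: ifP => // _; rewrite hornerC mul1r expR_ge0. Qed.

Lemma flat_le0 p t : t <= 0 -> flat p t = 0.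
Proof. by rewrite /flat ltNge => ->. Qed.

Let den_gt0 t : 0 < den t.
Proof.
have [t0|t0] := ltP 0 t; first by rewrite ltr_pwDl ?flat1_gt0// flat1_ge0.
by rewrite ltr_wpDl ?flat1_ge0// flat1_gt0// subr_gt0 (le_lt_trans t0).
Qed.

Let generators : set (R -> R) := [set u | (exists p, u = flat p) \/
  (exists p, u = flatC p) \/ u = (fun t => (den t)^-1)].

Let is_derive_flatC p t : is_derive t 1 (flatC p) (-1 * flatC (next p) t).
Proof.
have D : is_derive t 1 (fun s : R => 1 - s) (0 - 1).
  exact: (is_deriveB (is_derive_cst (1 : R) t 1) (is_derive_id t 1)).
have := @is_derive1_comp R (flat p) _ t _ _ (is_derive_flat p _) D.
by rewrite sub0r mulrC.
Qed.

Let generators_differential u : generators u -> differential_in one_dir (ralg generators) u.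
Proof.
have diff_cont (f f' : R -> R) : (forall t : R, is_derive t 1 f (f' t)) -> continuous f.
  by move=> D t; apply/differentiable_continuous/derivable1_diffP; have [] := D t.
have Gf p : ralg generators (flat p) by apply: ralg_gen; left; exists p.
have Gc p : ralg generators (flatC p) by apply: ralg_gen; right; left; exists p.
have Gd : ralg generators (fun t => (den t)^-1) by apply: ralg_gen; right; right.
case=> [[p ->]|[[p ->]|->]].
- split=> [|[]]; first exact: (diff_cont _ _ (is_derive_flat p)).
  exists (flat (next p)); first exact: Gf.
  exact: is_derive_flat.
- split=> [|[]]; first exact: (diff_cont _ _ (is_derive_flatC p)).
  exists (fun t => -1 * flatC (next p) t); first exact/ralg_scale/Gc.
  exact: is_derive_flatC.
pose den' t := flat (next 1) t + -1 * flatC (next 1) t.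
have Dd t : is_derive t 1 den (den' t).
  exact: (is_deriveD (is_derive_flat 1 t) (is_derive_flatC 1 t)).
have D t : is_derive t 1 (fun t => (den t)^-1) (-1 * (den' t * ((den t)^-1 * (den t)^-1))).
  have dn : den t != 0 by rewrite gt_eqF.
  have [Dd1 Dd2] := Dd t.
  apply: DeriveDef; first exact: derivableV.
  rewrite deriveV// Dd2 /GRing.scale/= mulN1r mulNr -exprVn expr2.
  by rewrite mulrC.
split=> [|[]]; first exact: (diff_cont _ _ D).
exists (fun t => -1 * (den' t * ((den t)^-1 * (den t)^-1))); last exact: D.
apply: ralg_scale; apply: ralg_mul; last exact: ralg_mul.
by apply: ralg_add; [exact: Gf|exact/ralg_scale/Gc].
Qed.

(** The function flat 1 t / (flat 1 t + flat 1 (1 - t)), whose denominator never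
   vanishes. *)
Lemma smooth_step : exists H : nat -> R -> R,
  [/\ forall k t, is_derive t 1 (H k) (H k.+1 t),
      forall t, t <= 0 -> H 0%N t = 0 & forall t, 1 <= t -> H 0%N t = 1].
Proof.
pose H t := flat 1 t * (den t)^-1.
have [sH _] := ralg_rsmooth generators_differential
  (ralg_mul (ralg_gen (or_introl (ex_intro _ 1 erefl)))
            (ralg_gen (or_intror (or_intror erefl)))) : rsmooth one_dir H /\ _.
exists (fun k => rpd one_dir (nseq k tt) H); split.
- by move=> k t; exact: (rsmooth_is_derive tt t (rsmooth_rpd _ sH)).
- by move=> t t0; rewrite /= /H flat_le0// mul0r.
- move=> t t1; rewrite /= /H /den /flatC (@flat_le0 _ (1 - t)) ?subr_le0// addr0.
  by rewrite divff// gt_eqF// flat1_gt0// (lt_le_trans ltr01).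
Qed.

Lemma jet_zero_left (f g : R -> R) (a : R) : (forall t, is_derive t 1 f (g t)) ->
  (forall t s, t <= a -> s <= a -> f t = f s) -> forall t, t <= a -> g t = 0.
Proof.
move=> D fc t ta; apply/eqP; rewrite -normr_le0; apply/ler_addgt0Pl => e e0; rewrite addr0.
have /is_derive_real_epsP/(_ e e0)[r r0 rP] := D t.
have := rP (- (r / 2)); rewrite normrN gtr0_norm ?divr_gt0//.
have rr : r / 2 < r by rewrite ltr_pdivrMr// ltr_pMr// ltr1n.
move=> /(_ rr); rewrite (fc (t - r / 2) t)//; last first.
  by rewrite (le_trans _ ta)// gerBl divr_ge0// ltW.
have r2 : 0 < r / 2 by rewrite divr_gt0.
by rewrite subrr sub0r mulNr opprK normrM (gtr0_norm r2) mulrC ler_pM2r.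
Qed.

Lemma jet_zero_right (f g : R -> R) (a : R) : (forall t, is_derive t 1 f (g t)) ->
  (forall t s, a <= t -> a <= s -> f t = f s) -> forall t, a <= t -> g t = 0.
Proof.
move=> D fc t ta; apply/eqP; rewrite -normr_le0; apply/ler_addgt0Pl => e e0; rewrite addr0.
have /is_derive_real_epsP/(_ e e0)[r r0 rP] := D t.
have := rP (r / 2); rewrite gtr0_norm ?divr_gt0//.
have rr : r / 2 < r by rewrite ltr_pdivrMr// ltr_pMr// ltr1n.
move=> /(_ rr); rewrite (fc (t + r / 2) t)//; last first.
  by rewrite (le_trans ta)// lerDl divr_ge0// ltW.
have r2 : 0 < r / 2 by rewrite divr_gt0.
by rewrite subrr sub0r normrN normrM (gtr0_norm r2) mulrC ler_pM2r.
Qed.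

(** A smooth step from 0 to 1 together with its derivatives. Those of positive order
   live on the unit interval, and H 1 has integral 1: the same step provides the
   cutoffs and the mollifying kernel. *)
Record step_jets (H : nat -> R -> R) : Prop := StepJets {
  step_derive : forall k t, is_derive t 1 (H k) (H k.+1 t) ;
  step_left : forall t, t <= 0 -> H 0%N t = 0 ;
  step_right : forall t, 1 <= t -> H 0%N t = 1 ;
  step_jet_left : forall k t, t <= 0 -> H k.+1 t = 0 ;
  step_jet_right : forall k t, 1 <= t -> H k.+1 t = 0 ;
  step_bound : forall k, exists C : R, forall t, `|H k t| <= C }.

Lemma step_jets_continuous (H : nat -> R -> R) k :
  (forall k t, is_derive t 1 (H k) (H k.+1 t)) -> continuous (H k).
Proof. by move=> D t; apply/differentiable_continuous/derivable1_diffP; have [] := D k t. Qed.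

Lemma step_jets_exist : exists H, step_jets H.
Proof.
have [H [D H0 H1]] := smooth_step; exists H.
have HL k t : t <= 0 -> H k.+1 t = 0.
  elim: k t => [|k ih]; apply: (jet_zero_left (D _)) => t s t0 s0; first by rewrite !H0.
  by rewrite !ih.
have HR k t : 1 <= t -> H k.+1 t = 0.
  elim: k t => [|k ih]; apply: (jet_zero_right (D _)) => t s t0 s0; first by rewrite !H1.
  by rewrite !ih.
split=> // k.
have ch : {within `[(0 : R), 1], continuous (H k)}.
  by apply: continuous_subspaceT; exact: step_jets_continuous.
have [M [_ Mu]] := compact_bounded (continuous_compact ch (@segment_compact R 0 1)).
exists (Num.max 1 (M + 1)) => t; rewrite le_max.
have [t0|t0] := leP t 0.
  by case: k ch Mu => [|k] _ _; rewrite ?H0 ?HL// normr0 ler01.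
have [t1|t1] := leP 1 t.
  by case: k ch Mu => [|k] _ _; rewrite ?H1 ?HR// ?normr1 ?normr0 ?lexx ?ler01.
apply/orP; right; apply: (Mu (M + 1)); first by rewrite ltrDl.
by exists t => //=; rewrite in_itv/= !ltW.
Qed.

End smooth_step.

(** * Differentiation under an average *)

(** Two averages are used: an integral over the unit interval for mollification, a
   geometric series for the weights. The interface keeps what is needed to
   differentiate an average of smooth functions. *)
Record averaging (R : realType) (J : Type) := Averaging {
  admissible : (J -> R) -> Prop ;
  average :> (J -> R) -> R ;
  admissible_add : forall u v, admissible u -> admissible v ->
    admissible (fun s => u s + v s) ;
  admissible_scale : forall (a : R) u, admissible u -> admissible (fun s => a * u s) ;
  average_add : forall u v, admissible u -> admissible v ->
    average (fun s => u s + v s) = average u + average v ;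
  average_scale : forall (a : R) u, admissible u ->
    average (fun s => a * u s) = a * average u ;
  average_bound : forall u (C : R), admissible u -> (forall s, `|u s| <= C) ->
    `|average u| <= C }.

Section superposition.
Context (R : realType) (n : nat) (J : Type) (L : averaging R J).
Local Notation E := 'rV[R]_n.
Local Notation dir := (@dir R n).
Context (F : J -> E -> R).
Context (Fs : forall s, rsmooth dir (F s)).
Context (Fadm : forall w x, admissible L (fun s => rpd dir w (F s) x)).
Context (Fbound : forall w, exists C : R, forall s x, `|rpd dir w (F s) x| <= C).

Let G w x := L (fun s => rpd dir w (F s) x).

Let G_sub w1 w2 w3 (x y z : E) (h : R) :
  G w1 x - G w2 y - h * G w3 z =
  L (fun s => rpd dir w1 (F s) x + -1 * rpd dir w2 (F s) y + - h * rpd dir w3 (F s) z).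
Proof.
rewrite !average_add ?average_scale//; first by rewrite mulN1r mulNr.
- exact: admissible_scale.
- by apply: admissible_add => //; exact: admissible_scale.
- exact: admissible_scale.
Qed.

Let G_derive w i x : is_derive x (dir i) (G w) (G (i :: w) x).
Proof.
apply/is_derive_epsP => e e0; have [C CP] := Fbound [:: i, i & w].
have C0 : 0 < `|C| + 1 by rewrite ltr_wpDl.
exists (e / (`|C| + 1)); first by rewrite divr_gt0.
move=> h; rewrite ltr_pdivlMr// => hr; rewrite G_sub.
apply: (@le_trans _ _ (`|C| * `|h| ^+ 2)); last first.
  by rewrite expr2 mulrA ler_wpM2r//; have := normr_ge0 h; nra.
apply: average_bound => [|s].
  by apply: admissible_add; [apply: admissible_add|]; rewrite ?mulN1r//; exact: admissible_scale.
rewrite mulN1r mulNr; apply: (@taylor2_line R E (rpd dir w (F s)) _ (rpd dir [:: i, i & w] (F s))).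
- by move=> y; exact: (rsmooth_is_derive i y (rsmooth_rpd w (Fs s))).
- by move=> y; exact: (rsmooth_is_derive i y (rsmooth_rpd (i :: w) (Fs s))).
- by move=> y; exact: le_trans (CP s y) (ler_norm _).
Qed.

Let G_bound w : exists C : R, forall x, `|G w x| <= C.
Proof. by have [C CP] := Fbound w; exists C => x; exact: average_bound. Qed.

Let G_continuous w : continuous (G w).
Proof.
have /choice[C CP] i := G_bound (i :: w).
apply: (@continuous_of_lipschitz R n _ (n%:R * \big[Num.max/0]_i C i)).
apply: (@lipschitz_of_partials R n _ (fun i => G (i :: w))) => [i x|i x]; first exact: G_derive.
exact: le_trans (CP i x) (le_bigmax _ _ _).
Qed.

(** The bound on second derivatives makes difference quotients converge uniformly in
   the parameter, and the average is a bounded operation. *)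
Lemma rpd_average w : rpd dir w (fun x => L (fun s => F s x)) =
  (fun x => L (fun s => rpd dir w (F s) x)).
Proof. by elim: w => //= i w ->; apply: is_derive_rpart => x; exact: G_derive. Qed.

Lemma rsmooth_average : rsmooth dir (fun x => L (fun s => F s x)).
Proof.
split=> w; rewrite rpd_average; split; first exact: G_continuous.
by move=> i x; have [] := G_derive w i x.
Qed.

End superposition.

Section unit_interval_average.
Context (R : realType).
Local Notation mu := (@lebesgue_measure R).

Let I01 (u : R -> R) : R := (\int[mu]_(t in `[0%R, 1%R]) u t)%R.

Let integrable01 u : continuous u -> mu.-integrable `[0%R, 1%R] (EFin \o u).
Proof.
move=> cu; apply: continuous_compact_integrable; first exact: segment_compact.
exact: continuous_subspaceT.
Qed.

Let I01_add (u v : R -> R) : continuous u -> continuous v ->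
  I01 (fun s => u s + v s) = I01 u + I01 v.
Proof. by move=> cu cv; rewrite /I01 RintegralD//; exact: integrable01. Qed.

Let I01_scale (a : R) u : continuous u -> I01 (fun s => a * u s) = a * I01 u.
Proof. by move=> cu; rewrite /I01 RintegralZl//; exact: integrable01. Qed.

Let I01_bound u (C : R) : continuous u -> (forall s, `|u s| <= C) -> `|I01 u| <= C.
Proof.
move=> cu uC; rewrite /I01.
have cn : continuous (fun s => `|u s|).
  by move=> s; exact: (@continuous_comp _ _ _ u (@Num.norm R R) s (cu s) (@norm_continuous R R (u s))).
apply: le_trans (le_normr_Rintegral _ _) _ => //; first exact: integrable01.
apply: le_trans (_ : (\int[mu]_(t in `[0%R, 1%R]) (cst C t))%R <= _).
  apply: le_Rintegral => //; first exact: integrable01.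
  by apply: integrable01 => s; exact: cvg_cst.
rewrite Rintegral_cst//= lebesgue_measure_itv/= lte_fin ltr01.
by rewrite oppr0 adde0/= mulr1.
Qed.

Definition unit_interval_average : averaging R R := @Averaging R R
  (fun u => continuous u) I01
  (fun u v cu cv => @continuous_fun_add R R R u v cu cv)
  (fun a u cu => @continuous_fun_mul R R (fun=> a) u (@continuous_fun_cst R R R a) cu)
  I01_add I01_scale I01_bound.

Lemma unit_interval_FTC (F f : R -> R) : (forall t : R, is_derive t 1 F (f t)) ->
  continuous f -> unit_interval_average f = F 1 - F 0.
Proof.
move=> D cf; rewrite /= /I01 /Rintegral.
have cF : continuous F.
  by move=> t; apply/differentiable_continuous/derivable1_diffP; have [] := D t.
rewrite (@continuous_FTC2 R f F 0 1)//=.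
- exact: continuous_subspaceT.
- split; first by move=> t _; have [] := D t.
  + exact/cvg_at_right_filter/cF.
  + exact/cvg_at_left_filter/cF.
- by move=> t _; rewrite derive1E derive_val.
Qed.

End unit_interval_average.

Section geometric_average.
Context (R : realType).

Let bounded_seq (u : nat -> R) := exists C : R, forall k, `|u k| <= C.
Let term (u : nat -> R) k := (1 / 2) ^+ k.+1 * u k.
Let S (u : nat -> R) : R := lim (series (term u) @ \oo).

Let geom_cvg : series (fun k => (1 / 2 : R) ^+ k.+1) @ \oo --> (1 : R).
Proof.
have := @cvg_geometric_series R (1 / 2) (1 / 2).
rewrite (_ : geometric (1 / 2) (1 / 2) = (fun k => (1 / 2 : R) ^+ k.+1)); last first.
  by apply/funext => k; rewrite /geometric/= exprS.
rewrite (_ : 1 / 2 / (1 - 1 / 2) = 1 :> R); last by field.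
by apply; rewrite ger0_norm; lra.
Qed.

Let scaled_geom_cvg (C : R) : series (fun k => C * (1 / 2) ^+ k.+1) @ \oo --> C.
Proof.
rewrite (_ : series _ = (fun N => C *: series (fun k => (1 / 2 : R) ^+ k.+1) N)); last first.
  by apply/funext => N; rewrite /series/= /GRing.scale/= mulr_sumr.
by rewrite -[X in _ --> X]mulr1; apply: cvgZr; exact: geom_cvg.
Qed.

Let term_cvg u : bounded_seq u -> cvgn (series (term u)).
Proof.
move=> [C CP]; apply: normed_cvg.
apply: (@series_le_cvg R _ (fun k => C * (1 / 2) ^+ k.+1)).
- by move=> k /=.
- move=> k; rewrite mulr_ge0// ?exprn_ge0 ?divr_ge0//.
  exact: le_trans (CP 0%N).
- move=> k /=; have h : 0 <= (1 / 2 : R) ^+ k.+1 by rewrite exprn_ge0// divr_ge0.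
  by rewrite /term normrM (ger0_norm h) mulrC ler_wpM2r.
- by apply/cvg_ex; exists C; exact: scaled_geom_cvg.
Qed.

Let bs_add u v : bounded_seq u -> bounded_seq v -> bounded_seq (fun s => u s + v s).
Proof.
move=> [C CP] [D DP]; exists (C + D) => k.
by rewrite (le_trans (ler_normD _ _))// lerD.
Qed.

Let bs_scale (a : R) u : bounded_seq u -> bounded_seq (fun s => a * u s).
Proof. by move=> [C CP]; exists (`|a| * C) => k; rewrite normrM ler_wpM2l. Qed.

Let S_add u v : bounded_seq u -> bounded_seq v -> S (fun s => u s + v s) = S u + S v.
Proof.
move=> bu bv; rewrite /S.
have -> : series (term (fun s => u s + v s)) = series (term u) + series (term v).
  apply/funext => N; rewrite /series/= fctE -big_split/=.
  by apply: eq_bigr => k _; rewrite /term mulrDr.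
by rewrite limD//; exact: term_cvg.
Qed.

Let S_scale (a : R) u : bounded_seq u -> S (fun s => a * u s) = a * S u.
Proof.
move=> bu; rewrite /S.
have -> : series (term (fun s => a * u s)) = a *: series (term u).
  apply/funext => N; rewrite /series/= fctE /GRing.scale/= mulr_sumr.
  by apply: eq_bigr => k _; rewrite /term mulrCA.
by rewrite limZr//; exact: term_cvg.
Qed.

Let S_le u v : bounded_seq u -> bounded_seq v -> (forall k, u k <= v k) -> S u <= S v.
Proof.
move=> bu bv uv; apply: ler_lim; [exact: term_cvg|exact: term_cvg|].
by apply: nearW => N; apply: ler_sum => k _; rewrite /term ler_wpM2l.
Qed.

Let S_cst (C : R) : S (fun=> C) = C.
Proof.
rewrite /S; apply/cvg_lim => //.
rewrite (_ : term _ = (fun k => C * (1 / 2) ^+ k.+1)); first exact: scaled_geom_cvg.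
by apply/funext => k; rewrite /term mulrC.
Qed.

Let bs_cst (C : R) : bounded_seq (fun=> C). Proof. by exists `|C|. Qed.

Let S_bound u (C : R) : bounded_seq u -> (forall s, `|u s| <= C) -> `|S u| <= C.
Proof.
move=> bu uC; rewrite ler_norml -{1}(S_cst C) -{2}(S_cst C); apply/andP; split.
  rewrite -mulN1r -(S_scale _ (bs_cst C)); apply: (S_le (bs_scale _ (bs_cst C)) bu).
  by move=> k; rewrite mulN1r; have := uC k; rewrite ler_norml => /andP[].
by apply: S_le => // k; rewrite (le_trans (ler_norm _)).
Qed.

Definition geometric_average : averaging R nat :=
  @Averaging R nat bounded_seq S bs_add bs_scale S_add S_scale S_bound.

Lemma geometric_average_le u v : admissible geometric_average u ->
  admissible geometric_average v -> (forall k, u k <= v k) ->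
  geometric_average u <= geometric_average v.
Proof. exact: S_le. Qed.

Let partial_sum_tail u (C e : R) m N : (forall k, `|u k| <= C) ->
  (forall k, (k < m)%N -> `|u k| <= e) -> 0 <= e -> 0 <= C ->
  `|series (term u) N| <= e + (1 / 2) ^+ m * C.
Proof.
move=> uC ue e0 C0.
have half_ge0 k : 0 <= (1 / 2 : R) ^+ k by rewrite exprn_ge0// divr_ge0.
have termE k (b : R) : `|u k| <= b -> `|term u k| <= ((1 / 2) ^+ k - (1 / 2) ^+ k.+1) * b.
  move=> ub; rewrite /term normrM ger0_norm// exprS.
  rewrite (_ : (1 / 2) ^+ k - 1 / 2 * (1 / 2) ^+ k = 1 / 2 * (1 / 2) ^+ k); last by lra.
  by rewrite ler_wpM2l// -exprS.
have low : (N <= m)%N -> `|series (term u) N| <= (1 - (1 / 2) ^+ N) * e.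
  elim: N => [|N ih] Nm; first by rewrite /series/= big_geq// normr0 expr0 subrr mul0r.
  rewrite seriesSr (le_trans (ler_normD _ _))//.
  have := ih (ltnW Nm); have := termE N e (ue _ Nm); lra.
have [/low h|mN] := leqP N m.
  have := half_ge0 N; have := half_ge0 m => h1 h2.
  have := mulr_ge0 h1 C0; have := mulr_ge0 h2 e0; lra.
have high : `|series (term u) N| <= (1 - (1 / 2) ^+ m) * e + ((1 / 2) ^+ m - (1 / 2) ^+ N) * C.
  have {low} : `|series (term u) m| <= (1 - (1 / 2) ^+ m) * e.
    elim: {N mN} m ue {low} => [|N ih] ue.
      by rewrite /series/= big_geq// normr0 expr0 subrr mul0r.
    rewrite seriesSr (le_trans (ler_normD _ _))//.
    have := ih (fun k km => ue k (ltnW km)); have := termE N e (ue _ (ltnSn _)); lra.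
  rewrite -(subnKC (ltnW mN)) => h.
  elim: (N - m)%N => [|j ih]; first by rewrite addn0 subrr mul0r addr0.
  rewrite addnS seriesSr (le_trans (ler_normD _ _))//.
  by have := termE (m + j)%N C (uC _); lra.
have := half_ge0 N; have := half_ge0 m => h1 h2.
have := mulr_ge0 h1 e0; have := mulr_ge0 h2 C0; lra.
Qed.

Lemma geometric_average_tail u (C e : R) m : (forall k, `|u k| <= C) ->
  (forall k, (k < m)%N -> `|u k| <= e) -> 0 <= e ->
  `|geometric_average u| <= e + (1 / 2) ^+ m * C.
Proof.
move=> uC ue e0; have C0 : 0 <= C by exact: le_trans (uC 0%N).
have bu : bounded_seq u by exists C.
have H N : `|series (term u) N| <= e + (1 / 2) ^+ m * C by exact: partial_sum_tail.
rewrite ler_norml; apply/andP; split.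
  apply: limr_ge; first exact: term_cvg.
  by apply: nearW => N; have := H N; rewrite ler_norml => /andP[].
apply: limr_le; first exact: term_cvg.
by apply: nearW => N; have := H N; rewrite ler_norml => /andP[].
Qed.

Lemma geometric_average_ge_term u m : admissible geometric_average u ->
  (forall k, 0 <= u k) -> (1 / 2) ^+ m.+1 * u m <= geometric_average u.
Proof.
move=> bu u0; apply: limr_ge; first exact: term_cvg.
exists m.+1 => // N /= mN; rewrite /series/= big_mkord (bigD1 (Ordinal mN))//=.
by rewrite lerDl sumr_ge0// => k _; rewrite mulr_ge0// exprn_ge0// divr_ge0.
Qed.

Lemma geometric_average_admissible u (C : R) : (forall k, `|u k| <= C) ->
  admissible geometric_average u.
Proof. by move=> uC; exists C. Qed.

End geometric_average.

(** * Weights and cutoff functions *)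

Section more_partials.
Context (R : realType) (V : normedModType R).

Lemma is_derive_at_line (u : V -> R) (x v : V) (d : R) :
  is_derive x v u d <-> is_derive (0 : R) 1 (fun t => u (x + t *: v)) d.
Proof.
split=> [D|/is_derive_real_epsP D].
  by apply: is_derive_line; rewrite scale0r addr0.
apply/is_derive_epsP => e /D[r r0 rP]; exists r => // h /rP.
by rewrite add0r scale0r addr0.
Qed.

Lemma is_derive_comp_real (f : R -> R) (u : V -> R) (x v : V) (a b : R) :
  is_derive (u x) 1 f a -> is_derive x v u b -> is_derive x v (fun y => f (u y)) (a * b).
Proof.
move=> Df /is_derive_at_line Du; apply/is_derive_at_line.
by apply: (is_derive1_comp _ Du); rewrite scale0r addr0.
Qed.

Context (I : eqType) (e : I -> V).

Lemma rpd_shift (a : V) (u : V -> R) w : rsmooth e u ->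
  rpd e w (fun x => u (x + a)) = (fun x => rpd e w u (x + a)).
Proof.
move=> su; elim: w => //= i w ->; apply: is_derive_rpart => x.
exact/is_derive_shiftl/(rsmooth_is_derive i (x + a) (rsmooth_rpd w su)).
Qed.

Lemma rsmooth_shift (a : V) (u : V -> R) : rsmooth e u -> rsmooth e (fun x => u (x + a)).
Proof.
move=> su; split=> w; rewrite rpd_shift//; split.
  have c := rsmooth_continuous (rsmooth_rpd w su).
  apply: (@continuous_fun_comp R V V _ (fun x => x + a)) => //.
  by apply: continuous_fun_add => x; [exact: cvg_id|exact: cvg_cst].
move=> i x.
by have [] := is_derive_shiftl (rsmooth_is_derive i (x + a) (rsmooth_rpd w su)).
Qed.

Lemma is_derive_dilate (c : R) (u : V -> R) x (v : V) (d : R) :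
  is_derive (c *: x) v u d -> is_derive x v (fun y => u (c *: y)) (c * d).
Proof.
move=> /is_derive_at_line D; apply/is_derive_at_line.
have Dc : is_derive (0 : R) 1 (fun t : R => c *: t) (c *: 1).
  exact: (is_deriveZ c (is_derive_id (0 : R) 1)).
have := @is_derive1_comp R (fun t => u (c *: x + t *: v)) (fun t => c *: t) 0 d (c *: 1).
rewrite /= /comp scaler0 => /(_ D Dc).
rewrite [c *: 1]mulr1 mulrC; congr (is_derive _ _ _ _).
by apply/funext => t; rewrite scalerDr scalerA.
Qed.

Lemma rpd_dilate (c : R) (u : V -> R) w : rsmooth e u ->
  rpd e w (fun x => u (c *: x)) = (fun x => c ^+ size w * rpd e w u (c *: x)).
Proof.
move=> su; elim: w => [|i w /= ->]; first by apply/funext => x; rewrite mul1r.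
apply: is_derive_rpart => x.
apply: is_derive_eq (is_deriveZ _ (is_derive_dilate (rsmooth_is_derive i (c *: x) (rsmooth_rpd w su)))) _.
by rewrite exprSr -mulrA.
Qed.

Lemma rsmooth_dilate (c : R) (u : V -> R) : rsmooth e u -> rsmooth e (fun x => u (c *: x)).
Proof.
move=> su; split=> w; rewrite rpd_dilate//; split.
  apply: continuous_fun_mul; first exact: (@continuous_fun_cst R V R).
  have cu := rsmooth_continuous (rsmooth_rpd w su).
  apply: (@continuous_fun_comp R V V _ (fun x => c *: x)) => //.
  by move=> x; apply: cvgZr; exact: cvg_id.
move=> i x.
by have [] := is_deriveZ (c ^+ size w) (is_derive_dilate (rsmooth_is_derive i (c *: x) (rsmooth_rpd w su))).
Qed.

End more_partials.

Section bump_and_weights.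
Context (R : realType) (n : nat).
Local Notation E := 'rV[R]_n.
Local Notation dir := (@dir R n).
Implicit Types (u v : E -> R) (w : seq 'I_n) (x : E) (i j : 'I_n).

Definition rbounded u := exists C : R, forall x, `|u x| <= C.

Lemma ralg_bounded (G : set (E -> R)) : (forall u, G u -> rbounded u) ->
  forall u, ralg G u -> rbounded u.
Proof.
move=> GP u; elim=> {u} [//|u v _ [C uC] _ [D vD]|u v _ [C uC] _ [D vD]|a u _ [C uC]].
- by exists (C + D) => x; rewrite (le_trans (ler_normD _ _))// lerD.
- by exists (C * D) => x; rewrite normrM ler_pM.
- by exists (`|a| * C) => x; rewrite normrM ler_wpM2l.
Qed.

Lemma rvanishesD u v : rvanishes u -> rvanishes v -> rvanishes (fun x => u x + v x).
Proof.
move=> vu vv e e0.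
have [r rP] := vu _ (divr_gt0 e0 (ltr0Sn _ 1)).
have [t tP] := vv _ (divr_gt0 e0 (ltr0Sn _ 1)).
exists (Num.max r t) => x; rewrite gt_max => /andP[/rP h1 /tP h2].
by rewrite (le_lt_trans (ler_normD _ _))// (splitr e) ltrD.
Qed.

Lemma rvanishesM u v : rbounded u -> rvanishes v -> rvanishes (fun x => u x * v x).
Proof.
move=> [C uC] vv e e0; have a0 : 0 < `|C| + 1 by rewrite ltr_wpDl.
have [r rP] := vv _ (divr_gt0 e0 a0).
exists r => x /rP; rewrite ltr_pdivlMr// normrM mulrC; apply: le_lt_trans.
by rewrite ler_wpM2r// (le_trans (uC x))// (le_trans (ler_norm _))// lerDl.
Qed.

Lemma ralg_vanishes (G : set (E -> R)) :
  (forall u, G u -> rbounded u) -> (forall u, G u -> rvanishes u) ->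
  forall u, ralg G u -> rvanishes u.
Proof.
move=> Gb GP u; elim=> {u} [//|u v _ uv _ vv|u v Gu _ _ vv|a u _ uv].
- exact: rvanishesD.
- by apply: rvanishesM => //; exact: ralg_bounded Gu.
- by apply: rvanishesM => //; exists `|a|.
Qed.

Let sq x := \sum_i x 0 i ^+ 2.
Definition bell x : R := (1 + sq x)^-1.
Let xbell i x := x 0 i * bell x.

Let sq_ge0 x : 0 <= sq x.
Proof. by apply: sumr_ge0 => i _; exact: sqr_ge0. Qed.

Let den_gt0 x : 0 < 1 + sq x.
Proof. by rewrite ltr_wpDr. Qed.

Lemma bell_gt0 x : 0 < bell x.
Proof. by rewrite invr_gt0. Qed.

Lemma bell_le1 x : bell x <= 1.
Proof. by rewrite invf_le1// lerDl. Qed.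

Let coord_le_sq x i : x 0 i ^+ 2 <= sq x.
Proof. by rewrite /sq (bigD1 i)//= lerDl sumr_ge0// => j _; exact: sqr_ge0. Qed.

Let norm_sq_le x : `|x| ^+ 2 <= sq x.
Proof.
rewrite -[leRHS](sqr_sqrtr (sq_ge0 x)) ler_sqr ?nnegrE ?sqrtr_ge0//.
apply: norm_le_coord; first exact: sqrtr_ge0.
by move=> i; rewrite -sqrtr_sqr ler_sqrt.
Qed.

Let sq_le_norm x : sq x <= n%:R * `|x| ^+ 2.
Proof.
rewrite (@le_trans _ _ (\sum_(i < n) `|x| ^+ 2))//.
  apply: ler_sum => i _; rewrite -[leLHS](real_normK (num_real _)).
  by rewrite ler_sqr ?nnegrE//; exact: coord_le_norm.
by rewrite sumr_const card_ord mulr_natl.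
Qed.

Lemma bell_ge x : `|x| <= 1 -> (1 + n%:R)^-1 <= bell x.
Proof.
move=> x1; rewrite lef_pV2 ?posrE ?ltr_wpDr// lerD2l (le_trans (sq_le_norm x))//.
by rewrite ler_piMr// expr_le1.
Qed.

Lemma bell_le x (c : R) : 0 <= c -> c <= `|x| ^+ 2 -> bell x <= (1 + c)^-1.
Proof.
by move=> c0 cx; rewrite lef_pV2 ?posrE ?ltr_wpDr// lerD2l (le_trans cx).
Qed.

Let xbell_bound i x : `|xbell i x| <= 1 / 2.
Proof.
rewrite /xbell /bell normrM normfV (gtr0_norm (den_gt0 x)) ler_pdivrMr//.
have := coord_le_sq x i; rewrite -(real_normK (num_real (x 0 i))).
have := sqr_ge0 (`|x 0 i| - 1); rewrite sqrrB1; lra.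
Qed.

Let is_derive_coord i j x : is_derive x (dir j) (fun y => y 0 i) ((i == j)%:R : R).
Proof.
apply/is_derive_epsP => e e0; exists 1 => // h _.
by rewrite !mxE eqxx/= (addrAC (x 0 i)) subrr add0r subrr normr0 mulr_ge0// ltW.
Qed.

Let is_derive_sq j x : is_derive x (dir j) sq (2 * x 0 j).
Proof.
have -> : sq = \sum_(i < n) (fun y : E => y 0 i ^+ 2).
  by apply/funext => y; rewrite fct_sumE.
have -> : 2 * x 0 j = \sum_(i < n) (2 * x 0 i) *: ((i == j)%:R : R).
  rewrite (bigD1 j)//= eqxx [_ *: _]mulr1 big1 ?addr0// => i /negbTE ->.
  by rewrite scaler0.
apply: is_derive_sum => i.
have := is_deriveX 2 (is_derive_coord i j x).
by rewrite expr1.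
Qed.

Let is_derive_bell j x : is_derive x (dir j) bell (-2 * (xbell j x * bell x)).
Proof.
have D : is_derive x (dir j) (fun y => 1 + sq y) (0 + 2 * x 0 j).
  exact: (is_deriveD (is_derive_cst (1 : R) x (dir j)) (is_derive_sq j x)).
have dn : 1 + sq x != 0 by rewrite gt_eqF.
have Di : is_derive (1 + sq x) 1 (fun s : R => s^-1) (- (1 + sq x) ^- 2).
  apply: DeriveDef; first by apply: derivableV => //; exact: derivable_id.
  by rewrite (@deriveV _ _ id)// derive_id [_ *: _]mulr1.
have D2 : is_derive x (dir j) bell (- (1 + sq x) ^- 2 * (0 + 2 * x 0 j)) :=
  @is_derive_comp_real R E (fun s => s^-1) (fun y => 1 + sq y) x (dir j) _ _ Di D.
apply: is_derive_eq D2 _.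
by rewrite add0r /xbell /bell -exprVn; ring.
Qed.

Let is_derive_xbell i j x : is_derive x (dir j) (xbell i)
  ((i == j)%:R * bell x + -2 * (xbell i x * xbell j x)).
Proof.
apply: is_derive_eq (is_deriveM (is_derive_coord i j x) (is_derive_bell j x)) _.
by rewrite /GRing.scale/= /xbell; ring.
Qed.

Let bell_gen : set (E -> R) := [set u | u = bell \/ exists i, u = xbell i].

Let bell_gen_bounded u : bell_gen u -> rbounded u.
Proof.
case=> [->|[i ->]]; first by exists 1 => x; rewrite gtr0_norm ?bell_gt0 ?bell_le1.
by exists (1 / 2).
Qed.

Let bell_gen_vanishes u : bell_gen u -> rvanishes u.
Proof.
move=> Gu e e0; exists (Num.max 1 e^-1) => x; rewrite gt_max => /andP[x1 xe].
have nx : 0 < `|x| by exact: lt_trans x1.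
have E1 : `|u x| <= `|x| * bell x.
  case: Gu => [->|[i ->]].
    by rewrite gtr0_norm ?bell_gt0// ler_peMl ?(ltW x1)// ltW// bell_gt0.
  rewrite /xbell normrM (gtr0_norm (bell_gt0 x)) ler_pM2r ?bell_gt0//.
  exact: coord_le_norm.
apply: le_lt_trans E1 _; rewrite /bell ltr_pdivrMr//.
have := norm_sq_le x => h.
have h2 : 1 < e * `|x| by rewrite mulrC -ltr_pdivrMr// div1r.
have h3 : `|x| < e * `|x| ^+ 2 by rewrite expr2 mulrA ltr_pMl.
apply: lt_le_trans h3 _; rewrite ler_pM2l//; lra.
Qed.

Let bell_gen_ralg (G : set (E -> R)) : bell_gen `<=` G ->
  forall j, ralg G (fun x => -2 * (xbell j x * bell x)).
Proof.
move=> GG j; apply: ralg_scale; apply: ralg_mul; apply/ralg_gen/GG; last by left.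
by right; exists j.
Qed.

Let bell_gen_differential (G : set (E -> R)) u : bell_gen `<=` G -> bell_gen u ->
  differential_in dir (ralg G) u.
Proof.
move=> GG Gu.
suff [du [Gdu Du]] : exists du : 'I_n -> E -> R, (forall j, ralg bell_gen (du j)) /\
    forall j x, is_derive x (dir j) u (du j x).
  split; last first.
    move=> j; exists (du j); last exact: Du.
    elim: (Gdu j) => [v|v1 v2 _ ? _ ?|v1 v2 _ ? _ ?|a v _ ?].
    - by move=> /GG; exact: ralg_gen.
    - exact: ralg_add.
    - exact: ralg_mul.
    - exact: ralg_scale.
  have /choice[C CP] j := ralg_bounded bell_gen_bounded (Gdu j).
  apply: (@continuous_of_lipschitz R n _ (n%:R * \big[Num.max/0]_i C i)).
  apply: (@lipschitz_of_partials R n _ du) => // i x.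
  exact: le_trans (CP i x) (le_bigmax _ _ _).
have Gb : ralg bell_gen bell by apply: ralg_gen; left.
have Gx i : ralg bell_gen (xbell i) by apply: ralg_gen; right; exists i.
case: Gu => [->|[i ->]].
  exists (fun j x => -2 * (xbell j x * bell x)); split=> [j|]; last exact: is_derive_bell.
  by apply: ralg_scale; exact: ralg_mul.
exists (fun j x => (i == j)%:R * bell x + -2 * (xbell i x * xbell j x)); split; last first.
  exact: is_derive_xbell.
by move=> j; apply: ralg_add; apply: ralg_scale => //; exact: ralg_mul.
Qed.

(** Each partial derivative of bell and of a coordinate times bell is a quadratic
   expression in these functions, all of which decay at infinity. *)
Lemma rBdot_bell : rBdot bell.
Proof.
have [s a] := @ralg_rsmooth R E _ dir bell_gen
  (fun u => @bell_gen_differential bell_gen u (fun _ => id))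
  bell (ralg_gen (or_introl erefl)).
by split=> // w; exact: (ralg_vanishes bell_gen_bounded bell_gen_vanishes (a w)).
Qed.

Lemma rpart_bell_le j x : `|rpart dir j bell x| <= bell x.
Proof.
rewrite (is_derive_rpart (is_derive_bell j)) normrM normrM normrN.
rewrite (ger0_norm (ler0n _ 2)) (gtr0_norm (bell_gt0 x)) mulrA ler_piMl ?(ltW (bell_gt0 x))//.
have := xbell_bound j x; lra.
Qed.

Lemma rpart2_bell_le j x : `|rpart dir j (rpart dir j bell) x| <= 4 * bell x.
Proof.
rewrite (is_derive_rpart (is_derive_bell j)).
rewrite (is_derive_rpart (fun y => is_deriveZ (-2) (is_deriveM (is_derive_xbell j j y) (is_derive_bell j y)))).
rewrite /GRing.scale/= eqxx mul1r.
have b0 := bell_gt0 x; have b1 := bell_le1 x; have := xbell_bound j x.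
move: (bell x) (xbell j x) b0 b1 => b y b0 b1.
rewrite ler_norml => /andP[y1 y2].
rewrite [X in `|X|](_ : _ = b * (8 * y ^+ 2 - 2 * b)); last by ring.
rewrite normrM (gtr0_norm b0) mulrC ler_pM2r// ler_norml.
have : 0 <= y ^+ 2 <= 1 / 4 by rewrite sqr_ge0/=; nra.
by move=> /andP[? ?]; apply/andP; split; lra.
Qed.

(** The weight is a geometric average of dilates of bell. Dilation by a small factor
   makes the logarithmic derivatives small; the k-th dilate, which has mass
   2 ^- k.+1, is chosen of order one on the ball of radius rho k. *)
Lemma weight_exists (eta : R) (rho : nat -> R) : 0 < eta -> exists psi : E -> R,
  [/\ rBdot psi, forall x, 0 <= psi x,
      forall i x, `|rpart dir i psi x| <= eta * psi x,
      forall i x, `|rpart dir i (rpart dir i psi) x| <= eta * psi x &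
      forall k x, `|x| <= rho k -> (1 / 2) ^+ k.+1 * (1 + n%:R)^-1 <= psi x].
Proof.
move=> eta0.
pose c k := Num.min (Num.min 1 (eta / 4)) (`|rho k| + 1)^-1.
have c0 k : 0 < c k by rewrite !lt_min ltr01 divr_gt0//= invr_gt0 ltr_wpDl.
have c1 k : c k <= 1 by rewrite !ge_min lexx.
have ceta k : 4 * c k <= eta.
  by rewrite mulrC -ler_pdivlMr// !ge_min lexx orbT.
have crho k x : `|x| <= rho k -> `|c k *: x| <= 1.
  move=> xr; rewrite normrZ (gtr0_norm (c0 k)).
  apply: le_trans (_ : (`|rho k| + 1)^-1 * `|x| <= _).
    by rewrite ler_wpM2r// ge_min lexx orbT.
  by rewrite mulrC ler_pdivrMr ?ltr_wpDl// mul1r; have := ler_norm (rho k); lra.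
pose F k x := bell (c k *: x).
have [sb vb] := rBdot_bell.
have Fs k : rsmooth dir (F k) by exact: rsmooth_dilate.
have ck1 k m : 0 <= c k ^+ m <= 1 by rewrite exprn_ge0 ?exprn_ile1 ?(ltW (c0 k)).
have FC w : exists C : R, forall k x, `|rpd dir w (F k) x| <= C.
  have [C CP] := rmult_bound (rBdot_mult rBdot_bell) w.
  exists C => k x; rewrite rpd_dilate// normrM; have /andP[a b] := ck1 k (size w).
  by rewrite (ger0_norm a) (le_trans _ (CP (c k *: x)))// ler_piMl.
have Fadm w x : admissible (geometric_average R) (fun k => rpd dir w (F k) x).
  by have [C CP] := FC w; apply: (@geometric_average_admissible R _ C).
pose psi x := geometric_average R (fun k => F k x).
have Fadm0 x : admissible (geometric_average R) (fun k => F k x) by exact: (Fadm [::]).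
have rel w (b : R) : (forall k x, `|rpd dir w (F k) x| <= b * F k x) ->
    forall x, `|rpd dir w psi x| <= b * psi x.
  move=> H x; rewrite rpd_average// ler_norml; apply/andP; split.
    rewrite -mulNr -average_scale//; apply: geometric_average_le => //.
      exact: admissible_scale.
    by move=> k; have := H k x; rewrite ler_norml mulNr => /andP[].
  rewrite -average_scale//; apply: geometric_average_le => //.
    exact: admissible_scale.
  by move=> k; have := H k x; rewrite ler_norml => /andP[].
exists psi; split.
- split; first exact: rsmooth_average.
  move=> w e e0; have [C CP] := FC w.
  have C0 : 0 < `|C| + 1 by rewrite ltr_wpDl.
  have e2 : 0 < e / 4 by rewrite divr_gt0.
  have [m mP] : exists m, (1 / 2 : R) ^+ m * C <= e / 4.
    have /cvgrPdist_lt/(_ (e / 4 / (`|C| + 1))) : (1 / 2 : R) ^+ k @[k --> \oo] --> (0 : R).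
      by apply: cvg_expr; rewrite ger0_norm; lra.
    rewrite divr_gt0// => /(_ isT) [m _ /(_ m (leqnn m))] /=.
    rewrite sub0r normrN ltr_pdivlMr// => h; exists m; rewrite (le_trans _ (ltW h))//.
    rewrite (le_trans (ler_norm _))// normrM ler_wpM2l// lerDl//.
  have vFk k : rvanishes (rpd dir w (F k)).
    move=> d /(vb w)[r rP]; exists (r / c k) => x; rewrite ltr_pdivrMr// => xr.
    rewrite rpd_dilate// normrM; have /andP[a b] := ck1 k (size w).
    rewrite (ger0_norm a) (le_lt_trans _ (rP (c k *: x) _))//; first by rewrite ler_piMl.
    by rewrite normrZ (gtr0_norm (c0 k)) mulrC.
  have /choice[r rP] k := vFk k _ e2.
  exists (\big[Num.max/0]_(k < m) r k) => x xr.
  rewrite rpd_average//; apply: (@le_lt_trans _ _ (e / 4 + (1 / 2) ^+ m * C)); last lra.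
  apply: geometric_average_tail => [k|k km|]; [exact: CP| |exact: ltW].
  apply/ltW/rP; apply: le_lt_trans xr.
  exact: (le_bigmax _ (fun k : 'I_m => r k) (Ordinal km)).
- move=> x; have := geometric_average_ge_term 0 (Fadm0 x) (fun k => ltW (bell_gt0 (c k *: x))).
  by apply: le_trans; rewrite mulr_ge0 ?exprn_ge0 ?divr_ge0// ltW// bell_gt0.
- move=> i; apply: (rel [:: i]) => k x; rewrite rpd_dilate// normrM expr1 gtr0_norm//.
  apply: ler_pM; [exact: ltW|by []| |exact: rpart_bell_le].
  by have := ceta k; have := c0 k; lra.
- move=> i; apply: (rel [:: i; i]) => k x; rewrite rpd_dilate// normrM.
  have /andP[a _] := ck1 k (size [:: i; i]); rewrite (ger0_norm a).
  have h := rpart2_bell_le i (c k *: x).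
  apply: le_trans (ler_wpM2l a h) _; rewrite mulrA ler_wpM2r ?(ltW (bell_gt0 _))//=.
  have := ceta k; have := c0 k; have := c1 k; rewrite expr2; nra.
- move=> k x xr; apply: le_trans (geometric_average_ge_term k _ _) => //.
    by rewrite ler_wpM2l ?exprn_ge0 ?divr_ge0// bell_ge// crho.
  by move=> j; rewrite ltW// bell_gt0.
Qed.

(** A smooth step of bell, between its values at distance 1 and at distance n + 1. *)
Lemma cutoff_exists : exists chi : E -> R, exists2 kappa : R, 1 <= kappa &
  [/\ rmult chi, forall x, `|x| <= 1 -> chi x = 1 & forall x, kappa <= `|x| -> chi x = 0].
Proof.
have [H SH] := @step_jets_exist R.
pose a : R := (2 + n%:R)^-1; pose b : R := (1 + n%:R)^-1.
have n0 : (0 : R) <= n%:R by exact: ler0n.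
have ab : a < b by rewrite ltf_pV2 ?posrE; lra.
pose g := (b - a)^-1; have g0 : 0 < g by rewrite invr_gt0 subr_gt0.
pose chik k x := H k (g * (bell x - a)).
pose G := [set u | (exists k, u = chik k) \/ bell_gen u].
have GG : bell_gen `<=` G by move=> u; right.
have Dchi k j x : is_derive x (dir j) (chik k)
    (chik k.+1 x * (g * (-2 * (xbell j x * bell x)))).
  have D : is_derive x (dir j) (fun y => g * (bell y - a)) (g * (-2 * (xbell j x * bell x) - 0)).
    exact: (is_deriveZ g (is_deriveB (is_derive_bell j x) (is_derive_cst a x (dir j)))).
  rewrite subr0 in D.
  exact: (@is_derive_comp_real R E (H k) _ x (dir j) _ _ (step_derive SH k _) D).
have Gdiff u : G u -> differential_in dir (ralg G) u.
  case=> [[k ->]|]; last exact: bell_gen_differential.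
  split.
    apply: (@continuous_fun_comp R E R _ (fun x => g * (bell x - a))).
      apply: (@continuous_fun_mul R E); first exact: (@continuous_fun_cst R E R).
      apply: (@continuous_fun_sub R E R); last exact: (@continuous_fun_cst R E R).
      exact: (rsmooth_continuous (rBdot_smooth rBdot_bell)).
    exact: step_jets_continuous (step_derive SH).
  move=> j; eexists; last exact: Dchi.
  apply: ralg_mul; first by apply: ralg_gen; left; exists k.+1.
  by apply: ralg_scale; exact: bell_gen_ralg.
have Gb u : G u -> rbounded u.
  case=> [[k ->]|]; last exact: bell_gen_bounded.
  by have [C CP] := step_bound SH k; exists C => x; exact: CP.
have [sc ac] := ralg_rsmooth Gdiff (ralg_gen (or_introl (ex_intro _ 0%N erefl)) : ralg G (chik 0%N)).
exists (chik 0%N), (n%:R + 1); first by rewrite lerDr.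
split.
- by split=> // w; exact: ralg_bounded (ac w).
- move=> x x1; apply: (step_right SH).
  rewrite /g mulrC ler_pdivlMr ?subr_gt0// mul1r lerD2r; exact: bell_ge.
- move=> x nx; apply: (step_left SH); rewrite pmulr_rle0// subr_le0.
  rewrite /a (_ : 2 + n%:R = 1 + (1 + n%:R)); last by ring.
  apply: bell_le; first lra.
  by move: nx; move: `|x| => y ny; rewrite expr2; nra.
Qed.

End bump_and_weights.

(** * Mollification *)

Lemma product_rule_arith (R : realType) (d a b c e : R) :
  a * (b * d) + c * e = d * (a * b) + e * c.
Proof. by ring. Qed.

Section mollifier.
Context (R : realType) (n : nat) (H : nat -> R -> R) (SH : step_jets H).
Local Notation E := 'rV[R]_n.
Local Notation dir := (@dir R n).
Local Notation I01 := (unit_interval_average R).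
Implicit Types (u v : E -> R) (w : seq 'I_n) (x : E) (i : 'I_n) (d : R).

(** One-dimensional convolution along dir i; the kernel is the k-th derivative of the
   bump H 1, at scale d. *)
Definition mollify1 i k d u : E -> R :=
  fun x => I01 (fun s => H k.+1 s * u (x + (d * s) *: dir i)).

Let kernel_out k s : ~~ (0 <= s <= 1) -> H k.+1 s = 0.
Proof.
rewrite negb_and -!ltNge => /orP[/ltW s0|/ltW s1].
  exact: (step_jet_left SH).
exact: (step_jet_right SH).
Qed.

Let Hc k : continuous (H k). Proof. exact: step_jets_continuous (step_derive SH). Qed.

Let line_continuous u x d i : continuous u -> continuous (fun s : R => u (x + (d * s) *: dir i)).
Proof.
move=> cu; apply: (@continuous_fun_comp R R E _ (fun s : R => x + (d * s) *: dir i)) => //.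
apply: (@continuous_fun_add R R E); first exact: (@continuous_fun_cst R R E).
apply: (@continuous_fun_scale R R E); last exact: (@continuous_fun_cst R R E).
apply: (@continuous_fun_mul R R); first exact: (@continuous_fun_cst R R R).
by move=> s; exact: cvg_id.
Qed.

Let integrand_continuous u x d i k : continuous u ->
  continuous (fun s : R => H k.+1 s * u (x + (d * s) *: dir i)).
Proof. by move=> cu; apply: continuous_fun_mul => //; exact: line_continuous. Qed.

Let family i k d u s x := H k.+1 s * u (x + (d * s) *: dir i).

Let family_smooth i k d u s : rsmooth dir u -> rsmooth dir (family i k d u s).
Proof. by move=> su; apply: rsmoothZ; exact: rsmooth_shift. Qed.

Let family_rpd i k d u s w : rsmooth dir u ->
  rpd dir w (family i k d u s) = family i k d (rpd dir w u) s.
Proof.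
move=> su; rewrite /family rpdZ; last exact: rsmooth_shift.
by rewrite rpd_shift.
Qed.

Let family_adm i k d u w x : rsmooth dir u ->
  admissible I01 (fun s => rpd dir w (family i k d u s) x).
Proof.
move=> su; rewrite (_ : (fun s => _) = (fun s => family i k d (rpd dir w u) s x)); last first.
  by apply/funext => s; rewrite family_rpd.
exact/integrand_continuous/rsmooth_continuous/rsmooth_rpd.
Qed.

Let family_bound i k d u : rmult u ->
  forall w, exists C : R, forall s x, `|rpd dir w (family i k d u s) x| <= C.
Proof.
move=> [su bu] w; have [C CP] := bu w; have [D DP] := step_bound SH k.+1.
exists (D * C) => s x; rewrite family_rpd// /family normrM ler_pM//.
Qed.

Lemma rpd_mollify1 i k d u w : rmult u ->
  rpd dir w (mollify1 i k d u) = mollify1 i k d (rpd dir w u).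
Proof.
move=> mu; have su := rmult_smooth mu.
have := @rpd_average R n R I01 (family i k d u) (fun s => @family_smooth i k d u s su)
  (fun w x => @family_adm i k d u w x su) (@family_bound i k d u mu) w.
rewrite /mollify1 => ->; apply/funext => x; congr (average _ _); apply/funext => s.
by rewrite family_rpd.
Qed.

Lemma rsmooth_mollify1 i k d u : rmult u -> rsmooth dir (mollify1 i k d u).
Proof.
move=> mu; have su := rmult_smooth mu.
exact: (@rsmooth_average R n R I01 (family i k d u) (fun s => @family_smooth i k d u s su)
  (fun w x => @family_adm i k d u w x su) (@family_bound i k d u mu)).
Qed.

(** Only the values of u on a segment of length d issued from x matter, as the kernel
   lives on the unit interval. *)
Lemma mollify1_local_bound k : exists2 C : R, 0 <= C & forall i d u x (B : R),
  continuous u -> 0 <= d ->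
  (forall y, `|x - y| <= d -> `|u y| <= B) -> `|mollify1 i k d u x| <= C * B.
Proof.
have [C CP] := step_bound SH k.+1; exists C; first exact: le_trans (CP 0).
move=> i d u x B cu d0 uB.
have B0 : 0 <= B by apply: le_trans (uB x _); rewrite ?subrr ?normr0.
apply: average_bound => [|s]; first exact: integrand_continuous.
have [/andP[s0 s1]|s01] := boolP (0 <= s <= 1); last first.
  rewrite kernel_out// mul0r normr0 mulr_ge0//; exact: le_trans (CP 0).
rewrite normrM ler_pM//; apply: uB.
rewrite opprD addrA subrr sub0r normrN normrZ normrM (ger0_norm d0) (ger0_norm s0).
by rewrite -mulrA ler_piMr// mulr_ile1// norm_dir_le1.
Qed.

Lemma mollify1_bound k : exists2 C : R, 0 <= C & forall i d u (B : R),
  continuous u -> 0 <= d -> (forall y, `|u y| <= B) ->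
  forall x, `|mollify1 i k d u x| <= C * B.
Proof.
have [C C0 CP] := mollify1_local_bound k; exists C => // i d u B cu d0 uB x.
by apply: CP d0 _.
Qed.

Lemma rBdot_mollify1 i k d u : 0 <= d <= 1 -> rBdot u -> rBdot (mollify1 i k d u).
Proof.
move=> /andP[d0 d1] Bu; have mu := rBdot_mult Bu.
split=> [|w e e0]; first exact: rsmooth_mollify1.
have [C C0 CP] := mollify1_local_bound k.
have C1 : 0 < C + 1 by rewrite ltr_wpDl.
have [r rP] := rBdot_vanish Bu w (divr_gt0 e0 C1).
exists (r + 1) => x xr; rewrite rpd_mollify1//.
apply: (@le_lt_trans _ _ (C * (e / (C + 1)))).
  apply: CP => //; first exact: (rsmooth_continuous (rsmooth_rpd w (rmult_smooth mu))).
  move=> y xy; apply/ltW/rP.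
  have := ler_normD (x - y) y; rewrite subrK; lra.
by rewrite mulrCA gtr_pMr// ltr_pdivrMr// mul1r ltrDl.
Qed.

(** Integration by parts: the boundary terms vanish with the kernel. *)
Lemma rpart_mollify1 i k d u : 0 < d -> rmult u ->
  rpart dir i (mollify1 i k d u) = (fun x => - d^-1 * mollify1 i k.+1 d u x).
Proof.
move=> d0 mu; have su := rmult_smooth mu.
have -> : rpart dir i (mollify1 i k d u) = mollify1 i k d (rpart dir i u).
  exact: (rpd_mollify1 i k d [:: i] mu).
apply/funext => x; rewrite /mollify1.
have cu := rsmooth_continuous su; have cu' := rsmooth_continuous (rsmooth_rpd [:: i] su).
pose F s := H k.+1 s * u (x + (d * s) *: dir i).
have D (s : R) : is_derive s 1 F (d * (H k.+1 s * rpart dir i u (x + (d * s) *: dir i)) +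
    H k.+2 s * u (x + (d * s) *: dir i)).
  have Ds : is_derive s 1 (fun t : R => d * t) (d * 1).
    exact: (@is_deriveZ R R R id d s 1 1 (is_derive_id s 1)).
  have Du := is_derive_line (rsmooth_is_derive i (x + (d * s) *: dir i) su).
  have Du' := @is_derive1_comp R (fun t => u (x + t *: dir i)) (fun t => d * t) s _ _ Du Ds.
  apply: is_derive_eq (is_deriveM (step_derive SH k.+1 s) Du') _.
  rewrite /GRing.scale/= mulr1; exact: product_rule_arith.
have F01 : F 1 - F 0 = 0.
  by rewrite /F (step_jet_right SH)// (step_jet_left SH)// !mul0r subrr.
have c1 := @integrand_continuous _ x d i k cu'.
have c2 := @integrand_continuous _ x d i k.+1 cu.
have := unit_interval_FTC D; rewrite F01 => /(_ _) E.
have {E} : I01 (fun s => d * (H k.+1 s * rpart dir i u (x + (d * s) *: dir i)) +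
    H k.+2 s * u (x + (d * s) *: dir i)) = 0.
  apply: E; apply: continuous_fun_add => //.
  by apply: continuous_fun_mul => //; exact: continuous_fun_cst.
rewrite average_add//; last exact: (@admissible_scale _ _ I01).
rewrite average_scale// => /eqP; rewrite addr_eq0 => /eqP E.
by apply: (@mulfI _ d); rewrite ?gt_eqF// E mulrA mulrN divff ?gt_eqF// mulN1r.
Qed.

Lemma mollify1_approx : exists2 C : R, 0 <= C & forall i d u (B : R),
  rsmooth dir u -> 0 <= d -> (forall y, `|rpart dir i u y| <= B) ->
  forall x, `|mollify1 i 0 d u x - u x| <= C * (d * B).
Proof.
have [C CP] := step_bound SH 1; exists C; first exact: le_trans (CP 0).
move=> i d u B su d0 uB x; have cu := rsmooth_continuous su.
have B0 : 0 <= B by exact: le_trans (uB x).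
have I1 : I01 (H 1) = 1.
  by rewrite (unit_interval_FTC (step_derive SH 0))// (step_right SH)// (step_left SH)// subr0.
have a1 : admissible I01 (fun s => H 1 s * u (x + (d * s) *: dir i)).
  exact: integrand_continuous.
have a2 : admissible I01 (fun s => - u x * H 1 s).
  by apply: (@admissible_scale _ _ I01); exact: Hc.
have -> : mollify1 i 0 d u x - u x =
    I01 (fun s => H 1 s * u (x + (d * s) *: dir i) + - u x * H 1 s).
  by rewrite (average_add a1 a2) (@average_scale _ _ I01 _ (H 1)) ?I1 ?mulr1.
apply: average_bound => [|s]; first exact: admissible_add a1 a2.
rewrite mulNr (mulrC (u x)) -mulrBr.
have [/andP[s0 s1]|s01] := boolP (0 <= s <= 1); last first.
  rewrite kernel_out// mul0r normr0 !mulr_ge0//; exact: le_trans (CP 0).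
rewrite normrM ler_pM//.
have [t _ ->] := mvt_line x (d * s) (fun y => rsmooth_is_derive i y su).
rewrite normrM ler_pM// normrM (ger0_norm d0) (ger0_norm s0) ler_piMr//.
Qed.

Definition mollify (l : seq 'I_n) d u : E -> R := foldr (fun i => mollify1 i 0 d) u l.

Lemma rBdot_mollify l d u : 0 <= d <= 1 -> rBdot u -> rBdot (mollify l d u).
Proof. by move=> d01 Bu; elim: l => //= i l; exact: rBdot_mollify1. Qed.

Lemma rpd_mollify l d u w : 0 <= d <= 1 -> rBdot u ->
  rpd dir w (mollify l d u) = mollify l d (rpd dir w u).
Proof.
move=> d01 Bu; elim: l => //= i l ih.
by rewrite rpd_mollify1 ?ih//; apply: rBdot_mult; exact: rBdot_mollify.
Qed.

Lemma mollify_bound l : exists2 C : R, 0 <= C & forall d u (B : R),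
  0 <= d <= 1 -> rBdot u -> (forall y, `|u y| <= B) ->
  forall x, `|mollify l d u x| <= C * B.
Proof.
elim: l => [|i l [C C0 CP]]; first by exists 1 => // d u B _ _ uB x; rewrite mul1r.
have [D D0 DP] := mollify1_bound 0; exists (D * C); first by rewrite mulr_ge0.
move=> d u B d01 Bu uB x; rewrite -mulrA; apply: DP.
- exact: (rsmooth_continuous (rBdot_smooth (rBdot_mollify l d01 Bu))).
- by case/andP: d01.
- by move=> y; exact: CP.
Qed.

Lemma mollify_approx l : exists2 C : R, 0 <= C & forall d u (B : R),
  0 <= d <= 1 -> rBdot u -> (forall i y, `|rpart dir i u y| <= B) -> 0 <= B ->
  forall x, `|mollify l d u x - u x| <= C * (d * B).
Proof.
elim: l => [|i l [C C0 CP]].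
  by exists 0 => // d u B _ _ _ _ x /=; rewrite subrr normr0 mul0r.
have [A A0 AP] := mollify_bound l; have [D D0 DP] := mollify1_approx.
exists (D * A + C); first by rewrite addr_ge0// mulr_ge0.
move=> d u B d01 Bu uB B0 x; have /andP[d0 d1] := d01.
have Bl := rBdot_mollify l d01 Bu.
rewrite -(subrKA (mollify l d u x)) (le_trans (ler_normD _ _))// mulrDl lerD//; last exact: CP.
rewrite (_ : D * A * (d * B) = D * (d * (A * B))); last by rewrite -!mulrA (mulrCA A).
apply: DP => // [|y]; first exact: rBdot_smooth.
rewrite -[rpart _ _ _]/(rpd dir [:: i] (mollify l d u)) rpd_mollify//.
by apply: AP => //; [exact: rBdot_rpd|exact: uB].
Qed.

Lemma rpd_nseq_mollify1 i k m d u : 0 < d -> rmult u ->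
  rpd dir (nseq m i) (mollify1 i k d u) = (fun x => (- d^-1) ^+ m * mollify1 i (k + m) d u x).
Proof.
move=> d0 mu; elim: m => [|m /= ->].
  by apply/funext => x; rewrite mul1r addn0.
rewrite rpartZ; last exact: rsmooth_mollify1.
by apply/funext => x; rewrite rpart_mollify1// exprSr mulrA addnS.
Qed.

(** Derivatives of any order in the directions of l fall on the kernels, at the price
   of a constant depending on d; for l exhausting all directions, the result is
   controlled by the supremum of u alone. *)
Lemma rpd_mollify_bound (l : seq 'I_n) w d : 0 < d <= 1 -> exists2 C : R, 0 <= C & forall u (B : R),
  rBdot u -> (forall y, `|rpd dir [seq j <- w | j \notin l] u y| <= B) ->
  forall x, `|rpd dir w (mollify l d u) x| <= C * B.
Proof.
move=> /andP[d0 d1]; have d01 : 0 <= d <= 1 by rewrite ltW.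
elim: l w => [|i l ih] w.
  exists 1 => // u B _ uB x; rewrite mul1r; move: (uB x).
  by rewrite (@eq_filter _ _ predT) ?filter_predT.
pose w' := seq.filter (predC (pred1 i)) w; have [C C0 CP] := ih w'.
pose m := count_mem i w.
have [D D0 DP] := mollify1_bound m.
exists (`|(- d^-1) ^+ m| * (D * C)); first by rewrite !mulr_ge0.
move=> u B Bu uB x /=.
have Bl := rBdot_mollify l d01 Bu.
have pw : perm_eq w (nseq m i ++ w').
  have /all_pred1P E := filter_all (pred1 i) w.
  by rewrite /m -size_filter -E perm_sym; exact: permEl (perm_filterC _ _).
rewrite (perm_rpd (rBdot_smooth (rBdot_mollify1 i 0 d01 Bl)) pw) rpd_cat.
rewrite rpd_mollify1; last exact: rBdot_mult.
rewrite rpd_nseq_mollify1//; last exact/rBdot_mult/rBdot_rpd.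
rewrite normrM -mulrA ler_wpM2l// add0n -mulrA; apply: DP.
- exact: (rsmooth_continuous (rsmooth_rpd w' (rBdot_smooth Bl))).
- exact: ltW.
move=> y; apply: CP => // z; move: (uB z); rewrite /w' -filter_predI.
congr (`|rpd _ _ _ _| <= _); apply: eq_filter => j /=.
by rewrite inE negb_or andbC.
Qed.

Lemma mollify_vanish l d u (r : R) : 0 <= d <= 1 -> rBdot u ->
  (forall y, `|y| < r -> u y = 0) ->
  forall x, `|x| < r - (size l)%:R -> mollify l d u x = 0.
Proof.
move=> d01 Bu u0; elim: l => [|i l ih] x /=; first by rewrite subr0; exact: u0.
move=> xr; have [C C0 CP] := mollify1_local_bound 0.
have Bl := rBdot_mollify l d01 Bu; have /andP[d0 d1] := d01.
apply/eqP; rewrite -normr_le0 -(mulr0 C); apply: CP => //.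
  exact: (rsmooth_continuous (rBdot_smooth Bl)).
move=> y xy; rewrite ih ?normr0//.
have := ler_normD x (y - x); rewrite addrC subrK (distrC y) => h.
move: xr; rewrite -natr1; lra.
Qed.

End mollifier.

(** * Complex-valued test functions *)

Local Open Scope complex_scope.

Section complex_valued.
Context (R : realType) (n : nat).
Local Notation E := 'rV[R]_n.
Local Notation C := R[i]^o.
Local Notation dir := (@dir R n).
Implicit Types (f g : E -> C) (w : seq 'I_n) (u v : E -> R).

Definition repart f : E -> R := fun x => complex.Re (f x).
Definition impart f : E -> R := fun x => complex.Im (f x).
Definition cplx u v : E -> C := fun x => (u x +i* v x)%C.

Lemma Re_le_normc (z : R[i]) : `|complex.Re z| <= normc z.
Proof.
case: z => a b /=; rewrite -[leLHS]sqrtr_sqr ler_wsqrtr// ?lerDl ?sqr_ge0//.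
Qed.

Lemma Im_le_normc (z : R[i]) : `|complex.Im z| <= normc z.
Proof.
case: z => a b /=; rewrite -[leLHS]sqrtr_sqr ler_wsqrtr// ?lerDr ?sqr_ge0//.
Qed.

Lemma normc_le_ReIm (z : R[i]) : normc z <= `|complex.Re z| + `|complex.Im z|.
Proof.
case: z => a b /=; rewrite -[leRHS]ger0_norm ?addr_ge0// -sqrtr_sqr ler_wsqrtr//.
have := sqr_ge0 a; rewrite sqrrD !real_normK ?num_real//.
have : 0 <= `|a| * `|b| by rewrite mulr_ge0.
lra.
Qed.

Lemma repart_pderiv w f : repart (pderiv w f) = rpd dir w (repart f).
Proof.
elim: w => //= i w ih; apply/funext => x; rewrite /repart/= /rpart.
by congr ('D__ _ _).
Qed.

Lemma impart_pderiv w f : impart (pderiv w f) = rpd dir w (impart f).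
Proof.
elim: w => //= i w ih; apply/funext => x; rewrite /impart/= /rpart.
by congr ('D__ _ _).
Qed.

Lemma continuous_normcP f : continuous f <->
  forall x (e : R), 0 < e -> \forall y \near x, normc (f x - f y) <= e.
Proof.
split=> [cf x e e0|H x].
  have := (@cvgrPdist_le R[i] C _ (nbhs x) (nbhs_filter x) f (f x)).1 (cf x) e%:C.
  by rewrite ltcR => /(_ e0); apply: (@filterS _ _ (nbhs_filter x)) => y;
    rewrite -[`|_|]/((normc _)%:C) lecR.
apply: (@cvgrPdist_le R[i] C _ (nbhs x) (nbhs_filter x) f (f x)).2 => e e0.
have eE : e = (complex.Re e)%:C by rewrite RRe_real// gtr0_real.
have e0' : 0 < complex.Re e by move: e0; rewrite {1}eE ltcR.
move: (H x _ e0'); apply: (@filterS _ _ (nbhs_filter x)) => y.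
by rewrite -[`|_|]/((normc _)%:C) {2}eE lecR.
Qed.

Lemma continuous_cplxP f : continuous f <-> continuous (repart f) /\ continuous (impart f).
Proof.
split=> [/continuous_normcP cf|[cr ci]].
  split=> x; apply/(@continuous_epsP R E) => e /(cf x);
    apply: (@filterS _ _ (nbhs_filter x)) => y; apply: le_trans.
    by have := Re_le_normc (f x - f y); rewrite raddfB.
  by have := Im_le_normc (f x - f y); rewrite raddfB.
apply/continuous_normcP => x e e0; have e2 : 0 < e / 2 by rewrite divr_gt0.
have /(@continuous_epsP R E)/(_ _ e2) := cr x; have /(@continuous_epsP R E)/(_ _ e2) := ci x.
apply: (@filterS2 _ _ (nbhs_filter x)) => y h1 h2.
rewrite (le_trans (normc_le_ReIm _))// !raddfB (splitr e) addrC lerD//.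
Qed.

Lemma smoothP f : smooth f <-> rsmooth dir (repart f) /\ rsmooth dir (impart f).
Proof.
split=> [sf|[sr si]].
  split; split=> w; rewrite -?repart_pderiv -?impart_pderiv; have [c d] := sf w;
    have [cr ci] := (continuous_cplxP _).1 c; split=> // i x; by have [] := d i x.
move=> w; split.
  apply/continuous_cplxP; rewrite repart_pderiv impart_pderiv.
  by split; [exact: (rsmoothP sr w).1|exact: (rsmoothP si w).1].
move=> i x; rewrite -/(repart (pderiv w f)) -/(impart (pderiv w f)) repart_pderiv impart_pderiv.
by split; [exact: (rsmoothP sr w).2|exact: (rsmoothP si w).2].
Qed.

Lemma vanishesP f : vanishes_at_infinity f <-> rvanishes (repart f) /\ rvanishes (impart f).
Proof.
split=> [vf|[vr vi] e e0].
  split=> e /vf[r rP]; exists r => x /rP; apply: le_lt_trans.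
    exact: Re_le_normc.
  exact: Im_le_normc.
have [r rP] := vr _ (divr_gt0 e0 (ltr0Sn _ 1)).
have [t tP] := vi _ (divr_gt0 e0 (ltr0Sn _ 1)).
exists (Num.max r t) => x; rewrite gt_max => /andP[/rP h1 /tP h2].
by rewrite (le_lt_trans (normc_le_ReIm _))// (splitr e) ltrD.
Qed.

(** Everything proved for real test functions carries over through the real and
   imaginary parts. *)
Lemma Bdot_predP f : f \in @Bdot_pred R n <-> rBdot (repart f) /\ rBdot (impart f).
Proof.
split=> [/asboolP[/smoothP[sr si] vf]|[[sr vr] [si vi]]].
  split; split=> // w; have /vanishesP[] := vf w;
    by rewrite repart_pderiv impart_pderiv.
apply/asboolP; split; first exact/smoothP.
by move=> w; apply/vanishesP; rewrite repart_pderiv impart_pderiv.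
Qed.

Lemma repart_Bdot (f : Bdot R n) : rBdot (repart f).
Proof. by have /Bdot_predP[] := Bdot_funP f. Qed.

Lemma impart_Bdot (f : Bdot R n) : rBdot (impart f).
Proof. by have /Bdot_predP[] := Bdot_funP f. Qed.

Definition Bdot_of u v (Bu : rBdot u) (Bv : rBdot v) : Bdot R n :=
  @BuildBdot R n (cplx u v) ((Bdot_predP (cplx u v)).2 (conj Bu Bv)).

Lemma perm_pderiv w1 w2 f : smooth f -> perm_eq w1 w2 -> pderiv w1 f = pderiv w2 f.
Proof.
move=> /smoothP[sr si] w12; apply/funext => x.
have h1 : repart (pderiv w1 f) x = repart (pderiv w2 f) x.
  by rewrite !repart_pderiv (perm_rpd sr w12).
have h2 : impart (pderiv w1 f) x = impart (pderiv w2 f) x.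
  by rewrite !impart_pderiv (perm_rpd si w12).
by apply/eqP; rewrite eq_complex; move: h1 h2; rewrite /repart /impart => -> ->; rewrite !eqxx.
Qed.

(** The predicate form of the norm of order m, ranging over words instead of
   multi-indices. *)
Definition pderiv_le m (M : R) f := forall w, (size w <= m)%N -> forall x, normc (pderiv w f x) <= M.

Lemma smooth_Bdot (f : Bdot R n) : smooth f.
Proof. by have /asboolP[] := Bdot_funP f. Qed.

Lemma bounded_pderiv w (f : Bdot R n) : Defs.bounded_fun (pderiv w f).
Proof. by apply: Bdot_bounded; apply: Bdot_pred_pderiv; exact: Bdot_funP. Qed.

(** Every word is a permutation of the word of its multi-index. *)
Lemma Bdot_norm_leP m (M : R) (f : Bdot R n) : 0 <= M ->
  Bdot_norm m f <= M <-> pderiv_le m M f.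
Proof.
move=> M0; split=> [fM w wm x|fM].
  have cw i : (count_mem i w < m.+1)%N by rewrite ltnS (leq_trans _ wm)// count_size.
  pose alpha : {ffun 'I_n -> 'I_m.+1} := [ffun i => Ordinal (cw i)].
  pose w' := flatten [seq nseq (alpha i) i | i <- enum 'I_n].
  have cw' j : count_mem j w' = count_mem j w.
    rewrite /w' count_flatten -map_comp sumnE big_map big_enum (bigD1 j)//=.
    rewrite big1 ?addn0 => [|i ij]; first by rewrite count_nseq/= eqxx mul1n ffunE.
    by rewrite count_nseq/= (negbTE ij) mul0n.
  have pw : perm_eq w w' by apply/allP => j _ /=; rewrite cw'.
  have sw : (\sum_i alpha i <= m)%N.
    apply: leq_trans wm; rewrite (perm_size pw) /w' size_flatten /shape -map_comp sumnE.
    by rewrite big_map big_enum/=; apply: leq_sum => i _; rewrite size_nseq.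
  rewrite (perm_pderiv (smooth_Bdot f) pw).
  apply: (@le_trans _ _ (supnorm (multi_pderiv (fun i => alpha i) f))).
    exact/supnorm_ge/bounded_pderiv.
  apply: le_trans fM; exact: (le_bigmax_cond _ _ sw).
apply: bigmax_le => // alpha am; apply: supnorm_le => x; apply: fM.
rewrite size_flatten /shape -map_comp sumnE big_map big_enum/=.
by apply: leq_trans am; apply: leq_sum => i _; rewrite size_nseq.
Qed.

Lemma Bdot_norm_ge0 m (f : Bdot R n) : 0 <= Bdot_norm m f.
Proof. exact: bigmax_ge_id. Qed.

Lemma pderiv_le_norm m (f : Bdot R n) : pderiv_le m (Bdot_norm m f) f.
Proof. by apply/Bdot_norm_leP => //; exact: Bdot_norm_ge0. Qed.

Lemma pderiv_leW m m' (M M' : R) f : (m <= m')%N -> M' <= M -> pderiv_le m' M' f -> pderiv_le m M f.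
Proof. by move=> mm MM H w wm x; apply: le_trans MM; apply: H; exact: leq_trans mm. Qed.

Lemma pderiv_le_parts m (M : R) f :
  (forall w, (size w <= m)%N -> forall x, `|rpd dir w (repart f) x| <= M) ->
  (forall w, (size w <= m)%N -> forall x, `|rpd dir w (impart f) x| <= M) ->
  pderiv_le m (2 * M) f.
Proof.
move=> hr hi w wm x; rewrite (le_trans (normc_le_ReIm _))//.
have := hr w wm x; have := hi w wm x; rewrite -repart_pderiv -impart_pderiv /repart /impart.
lra.
Qed.

Lemma pderiv_le_repart m (M : R) f w x : pderiv_le m M f -> (size w <= m)%N ->
  `|rpd dir w (repart f) x| <= M.
Proof. by move=> H wm; rewrite -repart_pderiv; apply: le_trans (Re_le_normc _) (H _ wm _). Qed.

Lemma pderiv_le_impart m (M : R) f w x : pderiv_le m M f -> (size w <= m)%N ->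
  `|rpd dir w (impart f) x| <= M.
Proof. by move=> H wm; rewrite -impart_pderiv; apply: le_trans (Im_le_normc _) (H _ wm _). Qed.

End complex_valued.

(** * Uniform convergence on a family of sets *)

Section uniform_convergence.
Context (R : realType) (S U : choiceType) (fam : set U -> Prop) (g : S -> (U -> R[i]^o)).
Local Notation W := (initial_topology (g : S -> {family fam, U -> R[i]^o})).

(** This lemma and the next are the only contact with the uniform structure of the
   strong dual and of kappa, which are both initial topologies of this kind. *)
Lemma nbhs_initial_family (s : W) (A : set U) (e : R) : fam A -> 0 < e ->
  nbhs s [set s' : W | forall a, A a -> normc (g s' a - g s a) <= e].
Proof.
move=> fA e0.
suff H : nbhs (g s : {family fam, U -> R[i]^o}) [set h | forall a, A a -> normc (h a - g s a) <= e].
  exact: (@initial_continuous _ _ (g : S -> {family fam, U -> R[i]^o}) s _ H).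
have /fam_cvgP/(_ A fA) : {family fam, nbhs (g s : {family fam, U -> R[i]^o}) --> g s} by [].
apply; apply/uniform_nbhs.
exists [set xy | ball xy.1 (e%:C : R[i]) xy.2]; split.
  by rewrite -entourage_ballE; exists e%:C => //=; rewrite ltcR.
move=> h H a /H /=; rewrite -ball_normE/= distrC -[`|_|]/((normc _)%:C) ltcR.
exact: ltW.
Qed.

Lemma cvg_initial_family (F : set_system W) (s : W) : Filter F ->
  (forall A e, fam A -> 0 < e -> F [set s' : W | forall a, A a -> normc (g s' a - g s a) <= e]) ->
  F --> s.
Proof.
move=> FF H P [_ [[B Bo <-] Bs BP]]; apply: filterS BP _.
have : {family fam, (g @ F) --> g s}.
  apply/fam_cvgP => A fA Q /uniform_nbhs[D [entD DQ]].
  move: entD; rewrite -entourage_ballE => -[d /= d0 dD].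
  have dE : d = (complex.Re d)%:C by rewrite RRe_real// gtr0_real.
  have d0' : 0 < complex.Re d by move: d0; rewrite {1}dE ltcR.
  have := H A _ fA (divr_gt0 d0' (ltr0Sn _ 1)).
  apply: filterS => s' H'; apply: DQ => a Aa; apply: dD => /=.
  rewrite -ball_normE/= distrC -[`|_|]/((normc _)%:C) dE ltcR.
  by apply: le_lt_trans (H' a Aa) _; rewrite ltr_pdivrMr// ltr_pMr// ltr1n.
by apply; exact: open_nbhs_nbhs.
Qed.

End uniform_convergence.

(** * Truncation of test functions *)

Section multipliers.
Context (R : realType) (n : nat).
Local Notation E := 'rV[R]_n.
Local Notation C := R[i]^o.
Local Notation dir := (@dir R n).
Implicit Types (f g : Bdot R n) (w : seq 'I_n) (chi : E -> R).

Definition mul_Bdot chi (mchi : rmult chi) f : Bdot R n :=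
  Bdot_of (rBdotM mchi (repart_Bdot f)) (rBdotM mchi (impart_Bdot f)).

Lemma mul_BdotE chi (mchi : rmult chi) f x : mul_Bdot mchi f x = (chi x)%:C * f x.
Proof.
rewrite /mul_Bdot/= /cplx /repart /impart; case: (f x) => a b.
by apply/eqP; rewrite eq_complex/= !mul0r subr0 addr0 !eqxx.
Qed.

Lemma pderiv_mul_Bdot chi (mchi : rmult chi) f m (A B : R) x : 0 <= A ->
  (forall w, (size w <= m)%N -> `|rpd dir w chi x| <= A) ->
  (forall w, (size w <= m)%N -> normc (pderiv w f x) <= B) ->
  forall w, (size w <= m)%N -> normc (pderiv w (mul_Bdot mchi f) x) <= 2 ^+ m.+1 * A * B.
Proof.
move=> A0 chiA fB w wm; have B0 : 0 <= B by apply: le_trans (normc_ge0 _) (fB [::] _).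
rewrite (le_trans (normc_le_ReIm _))//.
rewrite -/(repart (pderiv w _) x) -/(impart (pderiv w _) x) repart_pderiv impart_pderiv.
have key u : rBdot u -> (forall w, (size w <= m)%N -> `|rpd dir w u x| <= B) ->
    `|rpd dir w (fun y => chi y * u y) x| <= 2 ^+ m * A * B.
  move=> Bu uB; have := @rpdM_bound R E _ dir w chi u A B x (rmult_smooth mchi) (rBdot_smooth Bu) A0
    (fun w' ww => chiA w' (leq_trans ww wm)) (fun w' ww => uB w' (leq_trans ww wm)).
  move/le_trans; apply; rewrite -!mulrA ler_wpM2r ?mulr_ge0//.
  by rewrite ler_weXn2l// ler1n.
have h1 := key _ (repart_Bdot f).
have h2 := key _ (impart_Bdot f).
rewrite exprS -!mulrA mulr2n mulrDl !mul1r !mulrA lerD//.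
  apply: h1 => w' ww; rewrite -repart_pderiv; apply: le_trans (Re_le_normc _) (fB _ ww).
apply: h2 => w' ww; rewrite -impart_pderiv; apply: le_trans (Im_le_normc _) (fB _ ww).
Qed.

Lemma rpd_near0 w (u : E -> R) (x : E) : (\forall y \near x, u y = 0) -> rpd dir w u x = 0.
Proof.
move=> u0; have := @near_rpd_eq R E _ dir w u (cst 0) x u0.
by move/nbhs_singleton => ->; rewrite rpd_cst; case: w.
Qed.

Lemma pderiv_near0 w (f : E -> C) (x : E) : (\forall y \near x, f y = 0) -> pderiv w f x = 0.
Proof.
move=> f0; apply/eqP; rewrite eq_complex/=; apply/andP; split; apply/eqP.
  rewrite -/(repart (pderiv w f) x) repart_pderiv rpd_near0//.
  by move: f0; apply: (@filterS _ _ (nbhs_filter x)) => y; rewrite /repart => ->.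
rewrite -/(impart (pderiv w f) x) impart_pderiv rpd_near0//.
by move: f0; apply: (@filterS _ _ (nbhs_filter x)) => y; rewrite /impart => ->.
Qed.

Lemma near_norm_lt (x : E) (r : R) : `|x| < r -> \forall y \near x, `|y| < r.
Proof.
move=> xr; apply/nbhs_ballP; exists (r - `|x|); first by rewrite /= subr_gt0.
move=> y; rewrite -ball_normE/= => xy; have := ler_normD x (y - x).
by rewrite addrC subrK distrC; lra.
Qed.

Lemma near_norm_gt (x : E) (r : R) : r < `|x| -> \forall y \near x, r < `|y|.
Proof.
move=> xr; apply/nbhs_ballP; exists (`|x| - r); first by rewrite /= subr_gt0.
move=> y; rewrite -ball_normE/= => xy; have := ler_normD (x - y) y.
by rewrite subrK; lra.
Qed.

Lemma pderiv_in_ball0 w (f : E -> C) (r : R) : (forall x, `|x| < r -> f x = 0) ->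
  forall x, `|x| < r -> pderiv w f x = 0.
Proof.
move=> f0 x xr; apply: pderiv_near0.
by move: (near_norm_lt xr); apply: (@filterS _ _ (nbhs_filter x)); exact: f0.
Qed.

Lemma pderiv_out_ball0 w (f : E -> C) (r : R) : (forall x, r < `|x| -> f x = 0) ->
  forall x, r < `|x| -> pderiv w f x = 0.
Proof.
move=> f0 x xr; apply: pderiv_near0.
by move: (near_norm_gt xr); apply: (@filterS _ _ (nbhs_filter x)); exact: f0.
Qed.

(** Dilates of one cutoff, whose derivatives are bounded uniformly in the radius r. *)
Record cutoffs (chi : R -> E -> R) (kappa : R) (A : nat -> R) : Prop := Cutoffs {
  cutoff_kappa : 1 <= kappa ;
  cutoff_mult : forall r, rmult (chi r) ;
  cutoff_in : forall r x, 1 <= r -> `|x| <= r -> chi r x = 1 ;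
  cutoff_out : forall r x, 1 <= r -> kappa * r <= `|x| -> chi r x = 0 ;
  cutoff_A0 : forall m, 0 <= A m ;
  cutoff_bound : forall r m w x, 1 <= r -> (size w <= m)%N -> `|rpd dir w (chi r) x| <= A m }.

Lemma cutoffs_exist : exists (chi : R -> E -> R) (kappa : R) (A : nat -> R),
  cutoffs chi kappa A.
Proof.
have [chi [kappa kappa1 [mchi chi1 chi0]]] := @cutoff_exists R n.
have /choice[A AP] m : exists A : R, 0 <= A /\
    forall w, (size w <= m)%N -> forall x, `|rpd dir w chi x| <= A.
  by have [A A0 AP] := rmult_bound_size m mchi; exists A.
have sch := rmult_smooth mchi.
exists (fun r x => chi (r^-1 *: x)), kappa, A; split=> //.
- move=> r; split; first exact: rsmooth_dilate.
  move=> w; exists (`|r^-1 ^+ size w| * A (size w)) => x.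
  by rewrite rpd_dilate// normrM ler_wpM2l// (AP _).2.
- move=> r x r1 xr; apply: chi1; have r0 : 0 < r by exact: lt_le_trans r1.
  by rewrite normrZ normfV (gtr0_norm r0) mulrC ler_pdivrMr// mul1r.
- move=> r x r1 xr; apply: chi0; have r0 : 0 < r by exact: lt_le_trans r1.
  by rewrite normrZ normfV (gtr0_norm r0) mulrC ler_pdivlMr.
- by move=> m; exact: (AP m).1.
- move=> r m w x r1 wm; rewrite rpd_dilate// normrM.
  rewrite (le_trans _ ((AP m).2 w wm (r^-1 *: x)))// ler_piMl//.
  have r0 : 0 < r by exact: lt_le_trans r1.
  have ri0 : 0 <= r^-1 by rewrite invr_ge0 ltW.
  by rewrite (ger0_norm (exprn_ge0 _ ri0)) exprn_ile1// invf_le1.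
Qed.

End multipliers.

(** * The strong dual and its compact sets *)

Section dual_of_Bdot.
Context (R : realType) (n : nat).
Local Notation E := 'rV[R]_n.
Local Notation C := R[i]^o.
Local Notation B := (Bdot R n).
Local Notation D := (strong_dual (Bdot R n)).
Implicit Types (T : D) (f g : B).

Lemma dual_linear T : linear (T : B -> C).
Proof. by have /asboolP[] := dual_funP T. Qed.

Lemma dualD T f g : T (f + g) = T f + T g.
Proof. by have := dual_linear T 1 f g; rewrite !scale1r. Qed.

Lemma dual0 T : T 0 = 0.
Proof. by have := dual_linear T (-1) 0 0; rewrite !scaleN1r !addNr. Qed.

Lemma dualZ T (a : R[i]) f : T (a *: f) = a * T f.
Proof. by have := dual_linear T a f 0; rewrite dual0 !addr0. Qed.

Lemma dualB T f g : T (f - g) = T f - T g.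
Proof. by rewrite dualD -scaleN1r dualZ mulN1r. Qed.

Lemma normc_real (a : R) : normc (a%:C : R[i]) = `|a|.
Proof. by rewrite /= expr0n addr0 sqrtr_sqr. Qed.

Lemma pderivZ w (a : R[i]) f x : pderiv w (a *: f : B) x = a * pderiv w f x.
Proof.
have -> : Bdot_fun (a *: f) = a *: Bdot_fun f + (0 : E -> C) by rewrite addr0.
have s0 : smooth (0 : E -> C) by exact: (smooth_Bdot (0 : B)).
rewrite pderiv_lin//; last exact: smooth_Bdot.
have := @pderiv_lin R n w (-1) 0 0 s0 s0; rewrite scaler0 addr0 => e0.
have -> : pderiv w (0 : E -> C) = 0 by rewrite e0 scaleN1r addNr.
by rewrite addr0.
Qed.

Lemma pderivD w f g x : pderiv w (f + g : B) x = pderiv w f x + pderiv w g x.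
Proof.
have -> : Bdot_fun (f + g) = 1 *: Bdot_fun f + Bdot_fun g by rewrite scale1r.
by rewrite pderiv_lin ?scale1r//; exact: smooth_Bdot.
Qed.

Lemma pderiv_leZ m (a : R[i]) (M : R) f : pderiv_le m M f -> pderiv_le m (normc a * M) (a *: f : B).
Proof. by move=> H w wm x; rewrite pderivZ normcM ler_wpM2l ?normc_ge0// H. Qed.

Lemma pderiv_leD m (M N : R) f g : pderiv_le m M f -> pderiv_le m N g ->
  pderiv_le m (M + N) (f + g : B).
Proof.
by move=> H1 H2 w wm x; rewrite pderivD (le_trans (le_normcD _ _))// lerD ?H1 ?H2.
Qed.

Lemma pderivB w f g x : pderiv w (f - g : B) x = pderiv w f x - pderiv w g x.
Proof. by rewrite pderivD -scaleN1r pderivZ mulN1r. Qed.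

Definition dual_le T m (c : R) := forall (M : R) f, 0 < M -> pderiv_le m M f -> normc (T f) <= c * M.

Lemma dual_bound T : exists m, exists2 c : R, 0 <= c & dual_le T m c.
Proof.
have /asboolP[_ cT] := dual_funP T.
have : nbhs (0 : B) [set f | normc (T f) < 1].
  have := (@cvgrPdist_lt R[i] C _ (nbhs (0 : B)) (nbhs_filter _) T (T 0)).1 (cT 0) 1.
  rewrite ltr01 => /(_ isT); apply: (@filterS _ _ (nbhs_filter (0 : B))) => f.
  by rewrite dual0 sub0r normrN -[`|_|]/((normc _)%:C) ltcR.
move=> [s [e e0 sP]].
exists (\max_(i <- s) i)%N, (2 / e) => [|M f M0 fM]; first by rewrite divr_ge0// ltW.
pose a : R[i] := (e / (2 * M))%:C.
have na : normc a = e / (2 * M) by rewrite normc_real ger0_norm// divr_ge0 ?mulr_ge0 ?ltW.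
have a0 : 0 < e / (2 * M) by rewrite divr_gt0// mulr_gt0.
have : normc (T (a *: f)) < 1.
  apply: sP; rewrite /seminorm_ball/= subr0; apply/allP => i si.
  apply: (@le_lt_trans _ _ (e / 2)); last by rewrite ltr_pdivrMr// ltr_pMr// ltr1n.
  apply/Bdot_norm_leP; first by rewrite divr_ge0// ltW.
  have -> : e / 2 = normc a * M by rewrite na; field; rewrite gt_eqF.
  apply: pderiv_leZ; apply: pderiv_leW fM => //.
  exact: leq_bigmax_seq.
rewrite dualZ normcM na -ltr_pdivlMl// mulr1 invf_div => /ltW/le_trans; apply.
by rewrite mulrAC.
Qed.

Definition Bdot_bounded_set (A : set B) := forall m, exists2 M : R, 0 < M & forall f, A f -> pderiv_le m M f.

Lemma Bdot_bounded_set_tvs (A : set B) : Bdot_bounded_set A -> tvs_bounded A.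
Proof.
move=> bA U [s [e e0 sU]].
have [M M0 AM] := bA (\max_(i <- s) i)%N.
have r0 : 0 < 2 * M / e by rewrite divr_gt0// mulr_gt0.
exists (2 * M / e)%:C; first by rewrite ltcR.
move=> a; rewrite -[`|a|]/((normc a)%:C) lecR => ar f Af.
have na : 0 < normc a by exact: lt_le_trans ar.
have a0 : a != 0 by apply: contraTneq na => ->; rewrite normc0 ltxx.
exists (a^-1 *: f); last by rewrite scalerA divff// scale1r.
apply: sU; rewrite /seminorm_ball/= subr0; apply/allP => i si.
apply: (@le_lt_trans _ _ (e / 2)); last by rewrite ltr_pdivrMr// ltr_pMr// ltr1n.
apply/Bdot_norm_leP; first by rewrite divr_ge0// ltW.
apply: (@pderiv_leW _ _ _ (\max_(i <- s) i)%N _ (normc a^-1 * M)).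
- exact: leq_bigmax_seq.
- rewrite normcV ler_pdivrMl//.
  by move: ar; rewrite ler_pdivrMr//; lra.
- exact/pderiv_leZ/AM.
Qed.

Lemma tvs_bounded_Bdot_set (A : set B) : tvs_bounded A -> Bdot_bounded_set A.
Proof.
move=> bA m.
have [|r r0 rP] := bA [set f | Bdot_norm m f < 1].
  exists [:: m], 1 => // f; rewrite /seminorm_ball/= subr0 andbT.
  by [].
have rE : r = (complex.Re r)%:C by rewrite RRe_real// gtr0_real.
have r0' : 0 < complex.Re r by move: r0; rewrite {1}rE ltcR.
exists (complex.Re r) => // f Af.
have [|g g1 <-] := rP r _ f Af; first by rewrite gtr0_norm.
have -> : complex.Re r = normc r * 1 by rewrite mulr1 {2}rE normc_real gtr0_norm.
by apply: pderiv_leZ; apply/Bdot_norm_leP => //; exact: ltW.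
Qed.

Lemma strong_nbhs T (A : set B) (e : R) : Bdot_bounded_set A -> 0 < e ->
  nbhs T [set T' : D | forall f, A f -> normc (T' f - T f) <= e].
Proof.
move=> /Bdot_bounded_set_tvs bA e0.
exact: (@nbhs_initial_family R D B (@tvs_bounded _ B) (fun T : D => (T : B -> C)) T A e bA e0).
Qed.

Lemma strong_cvg (F : set_system D) T : Filter F ->
  (forall A e, Bdot_bounded_set A -> 0 < e -> F [set T' : D | forall f, A f -> normc (T' f - T f) <= e]) ->
  F --> T.
Proof.
move=> FF H.
apply: (@cvg_initial_family R D B (@tvs_bounded _ B) (fun T : D => (T : B -> C)) F T FF).
by move=> A e /tvs_bounded_Bdot_set bA e0; exact: H.
Qed.

Lemma compact_dual_bounded (K : set D) (A : set B) : compact K -> Bdot_bounded_set A ->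
  exists N : nat, forall T f, K T -> A f -> normc (T f) <= N%:R.
Proof.
move=> /compact_near_coveringP cK bA.
have := cK nat \oo (fun N T => forall f, A f -> normc (T f) <= N%:R) _.
case.
  move=> T KT; have [m [c c0 Tc]] := dual_bound T.
  have [M M0 AM] := bA m.
  exists ([set T' : D | forall f, A f -> normc (T' f - T f) <= 1], [set N | c * M + 1 <= N%:R]).
    split; first exact: strong_nbhs.
    exact: nbhs_infty_ger.
  move=> [T' N] /= [T'T NM] f Af; apply: le_trans NM.
  have -> : T' f = T f + (T' f - T f) by rewrite addrC subrK.
  by rewrite (le_trans (le_normcD _ _))// lerD ?T'T// Tc//; exact: AM.
move=> N _ /(_ N (leqnn N)) H; exists N => T f KT Af.
exact: H.
Qed.

(** If no order m worked, there would be functionals T_m in K and test functions f_m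
   with norm of order m at most 1 and T_m f_m larger than m; but the f_m form a
   bounded set, on which K is bounded. *)
Lemma compact_dual_equicontinuous (K : set D) : compact K ->
  exists m, exists2 c : R, 0 < c & forall T, K T -> dual_le T m c.
Proof.
move=> cK.
suff [m mP] : exists m : nat, forall T f, K T -> pderiv_le m 1 f -> normc (T f) <= m%:R.
  exists m, m.+1%:R => // T KT M f M0 fM.
  have := mP T ((M^-1)%:C *: f) KT; rewrite dualZ normcM normc_real gtr0_norm ?invr_gt0//.
  rewrite ler_pdivrMl// => H; rewrite mulrC; apply: le_trans (H _) _.
    rewrite -[1](mulVf (lt0r_neq0 M0)) -[M^-1 in X in pderiv_le _ X _]gtr0_norm ?invr_gt0//.
    by rewrite -normc_real; exact: pderiv_leZ.
  by rewrite ler_pM2l// ler_nat.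
apply: contrapT => no.
have /choice[h hP] (m : nat) : exists Tf : D * B,
    [/\ K Tf.1, pderiv_le m 1 Tf.2 & m%:R < normc (Tf.1 Tf.2)].
  apply: contrapT => H; apply: no; exists m => T f KT f1; rewrite leNgt; apply/negP => Tf.
  by apply: H; exists (T, f).
have bA : Bdot_bounded_set (range (fun m => (h m).2)).
  move=> k; exists (1 + \sum_(j < k) Bdot_norm k (h j).2).
    by rewrite ltr_pwDl// sumr_ge0// => j _; exact: Bdot_norm_ge0.
  move=> _ [m _ <-]; have [mk|km] := ltnP m k.
    apply: pderiv_leW (pderiv_le_norm (m := k) _) => //.
    rewrite (bigD1 (Ordinal mk))//= addrCA lerDl addr_ge0// sumr_ge0// => j _.
    exact: Bdot_norm_ge0.
  have [_ h1 _] := hP m; apply: pderiv_leW h1 => //.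
  by rewrite lerDl sumr_ge0// => j _; exact: Bdot_norm_ge0.
have [N NP] := compact_dual_bounded cK bA.
have [KT _] := hP N; rewrite ltNge => /negP; apply.
by apply: NP => //; exists N.
Qed.

End dual_of_Bdot.

(** * Tightness of compact sets of functionals *)

Section tightness.
Context (R : realType) (n : nat).
Local Notation E := 'rV[R]_n.
Local Notation C := R[i]^o.
Local Notation B := (Bdot R n).
Local Notation D := (strong_dual (Bdot R n)).
Local Notation dir := (@dir R n).
Implicit Types (T : D) (f g : B).

Lemma pderiv_le_mul chi kappa A (ch : @cutoffs R n chi kappa A) r m (M : R) f : 1 <= r ->
  pderiv_le m M f -> pderiv_le m (2 ^+ m.+1 * A m * M) (mul_Bdot (cutoff_mult ch r) f).
Proof.
move=> r1 fM w wm x; apply: (@pderiv_mul_Bdot R n _ _ f m) => //.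
- exact: (cutoff_A0 ch).
- by move=> w' w'm; exact: (cutoff_bound ch).
- by move=> w' w'm; exact: fM.
Qed.

Lemma mul_cutoff_in chi kappa A (ch : @cutoffs R n chi kappa A) r f x : 1 <= r ->
  `|x| <= r -> mul_Bdot (cutoff_mult ch r) f x = f x.
Proof. by move=> r1 xr; rewrite mul_BdotE (cutoff_in ch)// mul1r. Qed.

Lemma mul_cutoff_out chi kappa A (ch : @cutoffs R n chi kappa A) r f x : 1 <= r ->
  kappa * r <= `|x| -> mul_Bdot (cutoff_mult ch r) f x = 0.
Proof. by move=> r1 xr; rewrite mul_BdotE (cutoff_out ch)// mul0r. Qed.

Lemma sub_cutoff_in chi kappa A (ch : @cutoffs R n chi kappa A) r f x : 1 <= r ->
  `|x| < r -> (f - mul_Bdot (cutoff_mult ch r) f : B) x = 0.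
Proof.
move=> r1 xr; have := mul_cutoff_in ch f r1 (ltW xr) => E.
by rewrite -[LHS]/(f x - mul_Bdot (cutoff_mult ch r) f x) E subrr.
Qed.

Lemma pderiv_le_sub_cutoff chi kappa A (ch : @cutoffs R n chi kappa A) r m (d : R) f :
  1 <= r -> 0 <= d ->
  (forall w, (size w <= m)%N -> forall x, r <= `|x| -> normc (pderiv w f x) <= d) ->
  pderiv_le m ((1 + 2 ^+ m.+1 * A m) * d) (f - mul_Bdot (cutoff_mult ch r) f : B).
Proof.
move=> r1 d0 fd w wm x; have [xr|rx] := ltP `|x| r.
  rewrite (@pderiv_in_ball0 R n w _ r)// ?normc0; last by move=> y yr; exact: sub_cutoff_in.
  by rewrite mulr_ge0// addr_ge0// !mulr_ge0 ?exprn_ge0// (cutoff_A0 ch).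
rewrite pderivB (le_trans (le_normcD _ _))// normcN mulrDl mul1r lerD ?fd//.
apply: (@pderiv_mul_Bdot R n _ _ f m) => //.
- exact: (cutoff_A0 ch).
- by move=> w' w'm; exact: (cutoff_bound ch).
- by move=> w' w'm; exact: fd.
Qed.

Lemma Bdot_vanish_size f m (d : R) : 0 < d -> exists2 r : R, 1 <= r &
  forall w, (size w <= m)%N -> forall x, r <= `|x| -> normc (pderiv w f x) <= d.
Proof.
move=> d0; have d2 : 0 < d / 2 by rewrite divr_gt0.
have [r r0 rP] := rBdot_vanish_size m (repart_Bdot f) d2.
have [t t0 tP] := rBdot_vanish_size m (impart_Bdot f) d2.
exists (1 + r + t) => [|w wm x xr]; first lra.
rewrite (le_trans (normc_le_ReIm _))//.
have := rP w wm x; have := tP w wm x; rewrite -repart_pderiv -impart_pderiv /repart /impart.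
move=> h1 h2; have := h1; have := h2; lra.
Qed.

Lemma dual_le_truncation T m c chi kappa A (ch : @cutoffs R n chi kappa A) f (e : R) :
  0 <= c -> dual_le T m c -> 0 < e -> exists2 r : R, 1 <= r &
  forall t, r <= t -> normc (T (f - mul_Bdot (cutoff_mult ch t) f)) <= e.
Proof.
move=> c0 Tc e0; pose a := c * (1 + 2 ^+ m.+1 * A m) + 1.
have A0 := cutoff_A0 ch m.
have b0 : 0 <= 2 ^+ m.+1 * A m by rewrite mulr_ge0// exprn_ge0.
have a0 : 0 < a by rewrite ltr_wpDl// mulr_ge0// addr_ge0.
have d0 : 0 < e / a by rewrite divr_gt0.
have [r r1 rP] := Bdot_vanish_size f m d0.
exists r => // t rt; have t1 := le_trans r1 rt.
have H := @pderiv_le_sub_cutoff _ _ _ ch t m (e / a) f t1 (ltW d0)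
  (fun w wm x tx => rP w wm x (le_trans rt tx)).
apply: le_trans (Tc _ _ _ H) _; first by rewrite mulr_gt0// ltr_pwDl.
rewrite mulrA mulrCA ger_pMr// ler_pdivrMr// mul1r /a lerDl//.
Qed.

(** The phase aligns the second number with the first. *)
Lemma normc_rotation (a b : R[i]) : exists2 c : R[i], normc c = 1 &
  normc (a + c * b) = normc a + normc b.
Proof.
have [->|b0] := eqVneq b 0.
  by exists 1; rewrite ?normc1// mulr0 addr0 normc0 addr0.
have [->|a0] := eqVneq a 0.
  by exists 1; rewrite ?normc1// mul1r add0r normc0 add0r.
have na : normc a != 0 by apply: contra a0 => /eqP/eq0_normc ->.
have nb : normc b != 0 by apply: contra b0 => /eqP/eq0_normc ->.
exists ((normc b / normc a)%:C * (a / b)).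
  rewrite !normcM normc_real ger0_norm ?divr_ge0 ?normc_ge0// normcV.
  by field; rewrite na nb.
rewrite -mulrA mulfVK// -[X in normc (X + _)]mul1r -mulrDl normcM.
have -> : 1 + (normc b / normc a)%:C = (1 + normc b / normc a)%:C by rewrite rmorphD.
rewrite normc_real ger0_norm ?addr_ge0 ?divr_ge0 ?normc_ge0//.
by rewrite mulrDl mul1r divfK.
Qed.

(** Let f0, of compact support, nearly attain the supremum of |T| over such functions
   with norm at most 1. A function f supported away from f0 can be added to it, with
   any phase, without increasing the norm; choosing the phase so that the values of
   T add up, T f must be small. *)
Lemma dual_tight T m c (e : R) : 0 <= c -> dual_le T m c -> 0 < e ->
  exists R0 : R, forall f, pderiv_le m 1 f -> (forall x, `|x| < R0 -> f x = 0) ->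
    normc (T f) <= e.
Proof.
move=> c0 Tc e0; have [chi [kappa [A ch]]] := @cutoffs_exist R n.
pose b := 2 ^+ m.+1 * A m.
have b0 : 0 <= b by rewrite mulr_ge0 ?exprn_ge0// (cutoff_A0 ch).
pose S := [set a : R | exists2 f, a = normc (T f) &
  pderiv_le m 1 f /\ exists r : R, forall x, r < `|x| -> f x = 0].
have S0 : S 0.
  exists 0; first by rewrite dual0 normc0.
  split; last by exists 0.
  move=> w _ x; rewrite pderiv_near0 ?normc0//.
  exact: (@nearW _ (nbhs x) _ (nbhs_filter x)).
have Sub : has_ubound S.
  exists c => _ [f -> [f1 _]]; rewrite -[c]mulr1; exact: Tc.
pose d := e / (2 * (b + 1)).
have bd : 0 < 2 * (b + 1) by rewrite mulr_gt0// ltr_wpDl.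
have d0 : 0 < d by rewrite divr_gt0.
have [_ [f0 -> [f01 [r0 fr0]]] sf0] := @sup_adherent R S d d0 (conj (ex_intro _ 0 S0) Sub).
have cpt f : pderiv_le m 1 f -> (exists r : R, forall x, r < `|x| -> f x = 0) ->
    (forall x, `|x| < r0 + 1 -> f x = 0) -> normc (T f) <= d.
  move=> f1 [r fr] f0'.
  have [a a1 aP] := normc_rotation (T f0) (T f).
  have Sa : S (normc (T (f0 + a *: f))).
    exists (f0 + a *: f) => //; split.
      move=> w wm x; rewrite pderivD pderivZ; have [xr|xr] := ltP `|x| (r0 + 1).
        by rewrite (pderiv_in_ball0 w f0')// mulr0 addr0; exact: f01.
      rewrite (pderiv_out_ball0 w fr0) ?add0r ?normcM ?a1 ?mul1r; first exact: f1.
      by rewrite (lt_le_trans _ xr)// ltrDl.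
    exists (Num.max r0 r) => x; rewrite gt_max => /andP[h1 h2].
    by rewrite -[LHS]/(f0 x + a * f x) fr0// fr// mulr0 addr0.
  have := ub_le_sup Sub Sa; rewrite dualD dualZ aP; lra.
exists (Num.max (r0 + 1) 1) => f f1 fv.
have [r r1 rP] := dual_le_truncation ch f c0 Tc (divr_gt0 e0 (ltr0Sn _ 1)).
have -> : f = mul_Bdot (cutoff_mult ch r) f + (f - mul_Bdot (cutoff_mult ch r) f).
  by rewrite addrC subrK.
rewrite dualD (le_trans (le_normcD _ _))// (splitr e) lerD ?rP//.
pose g : B := ((b + 1)^-1)%:C *: mul_Bdot (cutoff_mult ch r) f.
have b1 : 0 < b + 1 by rewrite ltr_wpDl.
have : normc (T g) <= d.
  apply: cpt.
  - have -> : 1 = normc (((b + 1)^-1)%:C : R[i]) * (b + 1).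
      by rewrite normc_real gtr0_norm ?invr_gt0// mulVf// gt_eqF.
    apply: pderiv_leZ; apply: pderiv_leW (pderiv_le_mul ch r1 f1) => //.
    by rewrite mulr1 lerDl.
  - exists (kappa * r) => x xr; rewrite -[LHS]/(_ * mul_Bdot _ f x).
    by rewrite mul_cutoff_out ?mulr0// ltW.
  - move=> x xr; rewrite -[LHS]/(_ * mul_Bdot _ f x) mul_BdotE fv ?mulr0//.
    by rewrite (lt_le_trans xr)// le_max lexx.
rewrite dualZ normcM normc_real gtr0_norm ?invr_gt0// ler_pdivrMl//.
by rewrite /d => /le_trans; apply; rewrite le_eqVlt; apply/orP; left; apply/eqP; field; lra.
Qed.

Definition regularize H (SH : @step_jets R H) (d : R) (d01 : 0 <= d <= 1) f : B :=
  Bdot_of (rBdot_mollify SH (enum 'I_n) d01 (repart_Bdot f))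
          (rBdot_mollify SH (enum 'I_n) d01 (impart_Bdot f)).

Lemma regularize_approx H (SH : @step_jets R H) : exists2 c : R, 0 <= c &
  forall d (d01 : 0 <= d <= 1) m f, pderiv_le m.+1 1 f ->
    pderiv_le m (c * d) (f - regularize SH d01 f : B).
Proof.
have [c c0 cP] := mollify_approx SH (enum 'I_n).
exists (2 * c); first by rewrite mulr_ge0.
move=> d d01 m f f1; rewrite -mulrA.
have key u : rBdot u -> (forall w, (size w <= m.+1)%N -> forall x, `|rpd dir w u x| <= 1) ->
    forall w, (size w <= m)%N -> forall x,
    `|rpd dir w (fun y => u y + -1 * mollify H (enum 'I_n) d u y) x| <= c * d.
  move=> Bu u1 w wm x; have BM := rBdot_mollify SH (enum 'I_n) d01 Bu.
  rewrite rpdD; [|exact: rBdot_smooth|exact/rsmoothZ/rBdot_smooth].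
  rewrite rpdZ; last exact: rBdot_smooth.
  rewrite mulN1r rpd_mollify// distrC -[d in leRHS]mulr1; apply: cP => //.
    exact: rBdot_rpd.
  by move=> i y; exact: (u1 (i :: w)).
apply: pderiv_le_parts => w wm x.
  have -> : repart (f - regularize SH d01 f : B) =
      (fun y => repart f y + -1 * mollify H (enum 'I_n) d (repart f) y).
    apply/funext => y; rewrite mulN1r /repart -[Bdot_fun _ y]/(f y - regularize SH d01 f y).
    by rewrite raddfB.
  apply: (key _ (repart_Bdot f)) => // w' w'm y.
  exact: pderiv_le_repart f1 w'm.
have -> : impart (f - regularize SH d01 f : B) =
    (fun y => impart f y + -1 * mollify H (enum 'I_n) d (impart f) y).
  apply/funext => y; rewrite mulN1r /impart -[Bdot_fun _ y]/(f y - regularize SH d01 f y).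
  by rewrite raddfB.
apply: (key _ (impart_Bdot f)) => // w' w'm y.
exact: pderiv_le_impart f1 w'm.
Qed.

(** With regularize_approx this says that the unit ball of the norm of order m + 1
   lies, for any d, in the sum of a bounded set and a ball of radius of order d for the
   norm of order m: compactness, which only sees bounded sets, then acts on a ball. *)
Lemma regularize_bounded_set H (SH : @step_jets R H) (d : R) (d01 : 0 <= d <= 1) : 0 < d ->
  Bdot_bounded_set [set regularize SH d01 f | f in [set f : B | pderiv_le 0 1 f]].
Proof.
move=> d0 m; have d01' : 0 < d <= 1 by case/andP: d01 => _ ->; rewrite d0.
pose P w (a : R) := forall u, rBdot u -> (forall y, `|u y| <= 1) ->
  forall x, `|rpd dir w (mollify H (enum 'I_n) d u) x| <= a.
have [||a a0 aP] := @words_bound R n P _ _ m.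
- by move=> w a b H1 ab u Bu u1 x; apply: le_trans ab; exact: H1.
- move=> w; have [c c0 cP] := rpd_mollify_bound SH (enum 'I_n) w d01'.
  exists (c * 1) => u Bu u1 x; apply: cP => //.
  by rewrite (@eq_filter _ _ pred0) ?filter_pred0// => j; rewrite mem_enum.
exists (2 * (a + 1)); first by rewrite mulr_gt0// ltr_wpDl.
move=> _ [f f1 <-]; have a1 : a <= a + 1 by rewrite lerDl.
apply: pderiv_le_parts => w wm x; apply: le_trans a1; apply: aP => //.
- exact: repart_Bdot.
- by move=> y; exact: (pderiv_le_repart (w := [::]) y f1).
- exact: impart_Bdot.
- by move=> y; exact: (pderiv_le_impart (w := [::]) y f1).
Qed.

Lemma regularize_vanish H (SH : @step_jets R H) (d : R) (d01 : 0 <= d <= 1) f (r : R) :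
  (forall x, `|x| < r -> f x = 0) ->
  forall x, `|x| < r - n%:R -> regularize SH d01 f x = 0.
Proof.
move=> f0 x xr; apply/eqP; rewrite eq_complex/=.
rewrite !(mollify_vanish SH (r := r)) ?eqxx ?size_enum_ord//.
- exact: impart_Bdot.
- by move=> y /f0; rewrite /impart => ->.
- exact: repart_Bdot.
- by move=> y /f0; rewrite /repart => ->.
Qed.

(** Test functions far from the origin are split into a regularization and a
   remainder. The remainder is small in the norm for which K is equicontinuous; the
   regularizations lie in a bounded set and are still far from the origin. *)
Lemma compact_dual_tight (K : set D) : compact K -> exists m, exists2 c : R, 0 < c &
  (forall T, K T -> dual_le T m c) /\
  forall e : R, 0 < e -> exists R0 : R, forall T f, K T -> pderiv_le m 1 f ->
    (forall x, `|x| < R0 -> f x = 0) -> normc (T f) <= e.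
Proof.
move=> cK; have [m [c c0 Kc]] := compact_dual_equicontinuous cK.
exists m.+1, c => //; split.
  by move=> T KT M f M0 fM; apply: Kc => //; exact: pderiv_leW fM.
move=> e e0; have [H SH] := @step_jets_exist R.
have [a a0 aP] := regularize_approx SH.
pose b := c * (a + 1) + 1.
have b0 : 0 < b by rewrite ltr_wpDl// mulr_ge0 ?(ltW c0)// addr_ge0.
pose d := Num.min 1 (e / 3 / b).
have d0 : 0 < d by rewrite lt_min ltr01 !divr_gt0.
have d01 : 0 <= d <= 1 by rewrite ltW//= ge_min lexx.
have dca : c * (a * d + d) <= e / 3.
  have : d <= e / 3 / b by rewrite ge_min lexx orbT.
  by rewrite ler_pdivlMr// /b; move: (ltW d0) => ? ?; lra.
pose G := [set regularize SH d01 f | f in [set f : B | pderiv_le 0 1 f]].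
have bG : Bdot_bounded_set G by exact: regularize_bounded_set.
have e3 : 0 < e / 3 by rewrite divr_gt0.
move/compact_near_coveringP: cK => cK.
(* On the bounded set G, a neighbourhood of each T of K has a common radius. *)
have := cK R +oo (fun r T => forall g, G g -> (forall x, `|x| < r -> g x = 0) ->
  normc (T g) <= 2 * (e / 3)) _.
case.
  move=> T KT; have [M M0 GM] := bG m.
  have [r rP] := dual_tight (ltW c0) (Kc T KT) (divr_gt0 e3 M0).
  exists ([set T' : D | forall f, G f -> normc (T' f - T f) <= e / 3], [set t | r <= t]).
    split; first exact: strong_nbhs.
    by apply: nbhs_pinfty_ge; exact: num_real.
  move=> [T' t] /= [T'T rt] g Gg g0.
  have -> : T' g = (T' g - T g) + T g by rewrite subrK.
  rewrite (le_trans (le_normcD _ _))// mulr2n mulrDl mul1r lerD ?T'T//.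
  have := rP ((M^-1)%:C *: g).
  rewrite dualZ normcM normc_real gtr0_norm ?invr_gt0// ler_pdivrMl// mulrC divfK ?gt_eqF//.
  apply.
    have -> : 1 = normc (M^-1%:C : R[i]) * M.
      by rewrite normc_real gtr0_norm ?invr_gt0// mulVf// gt_eqF.
    exact/pderiv_leZ/GM.
  by move=> x xr; rewrite -[LHS]/(_ * g x) g0 ?mulr0// (lt_le_trans xr).
move=> r [_ rP].
exists (r + 1 + n%:R) => T f KT f1 f0.
have -> : f = (f - regularize SH d01 f) + regularize SH d01 f by rewrite subrK.
rewrite dualD (le_trans (le_normcD _ _))// (_ : e = e / 3 + 2 * (e / 3)); last by field.
apply: lerD.
  have H1 : pderiv_le m (a * d + d) (f - regularize SH d01 f : B).
    by apply: pderiv_leW (aP _ d01 _ _ f1) => //; rewrite lerDl ltW.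
  by apply: le_trans (Kc T KT _ _ _ H1) dca; rewrite ltr_wpDl// mulr_ge0// ltW.
apply: (rP (r + 1)) => //; first by rewrite ltrDl.
  by exists f => //; exact: pderiv_leW f1.
move=> x xr; apply: (regularize_vanish SH d01 f0); by rewrite addrK.
Qed.

End tightness.

(** * Domination by one weighted seminorm *)

Section weighted_domination.
Context (R : realType) (n : nat).
Local Notation E := 'rV[R]_n.
Local Notation C := R[i]^o.
Local Notation B := (Bdot R n).
Local Notation D := (strong_dual (Bdot R n)).
Local Notation dir := (@dir R n).
Implicit Types (T : D) (f : B).

Lemma repart_sub_laplacian (g : E -> C) :
  repart (g - laplacian g) = (fun x => repart g x + -1 * rlaplacian (repart g) x).
Proof.
apply/funext => x; rewrite mulN1r /repart -[(g - laplacian g) x]/(g x - laplacian g x) raddfB/=.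
congr (_ - _); rewrite /laplacian fct_sumE raddf_sum; apply: eq_bigr => i _.
exact: (congr1 (fun u => u x) (repart_pderiv [:: i; i] g)).
Qed.

Lemma impart_sub_laplacian (g : E -> C) :
  impart (g - laplacian g) = (fun x => impart g x + -1 * rlaplacian (impart g) x).
Proof.
apply/funext => x; rewrite mulN1r /impart -[(g - laplacian g) x]/(g x - laplacian g x) raddfB/=.
congr (_ - _); rewrite /laplacian fct_sumE raddf_sum; apply: eq_bigr => i _.
exact: (congr1 (fun u => u x) (impart_pderiv [:: i; i] g)).
Qed.

Lemma rlaplacian_rpd w (u : E -> R) : rsmooth dir u ->
  rpd dir w (fun x => u x + -1 * rlaplacian u x) =
  (fun x => rpd dir w u x - rlaplacian (rpd dir w u) x).
Proof.
move=> su.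
pose L (s : seq 'I_n) (v : E -> R) : E -> R := fun x => \sum_(i <- s) rpd dir [:: i; i] v x.
have L0 v : L [::] v = cst 0 by apply/funext => x; rewrite /L big_nil.
have LS i s v : L (i :: s) v = (fun x => rpd dir [:: i; i] v x + L s v x).
  by apply/funext => x; rewrite /L big_cons.
have sl (s : seq 'I_n) : rsmooth dir (L s u) /\ rpd dir w (L s u) = L s (rpd dir w u).
  elim: s => [|i s [ih1 ih2]].
    rewrite !L0; split; first exact: rsmooth_cst.
    by rewrite rpd_cst; case: (w).
  rewrite !LS; have si := rsmooth_rpd [:: i; i] su.
  split; first exact: rsmoothD si ih1.
  by rewrite (rpdD w si ih1) ih2 (rpd_rpdC w [:: i; i] su).
have [s1 s2] := sl (index_enum 'I_n).
rewrite rpdD//; last exact: rsmoothZ s1.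
rewrite (rpdZ w (-1) s1) s2; apply/funext => x.
by rewrite mulN1r.
Qed.

(** The last condition leaves room for absorbing the commutators in
   weighted_resolvent_bound. *)
Record weight (psi : E -> R) (eta : R) : Prop := Weight {
  weight_Bdot : rBdot psi ;
  weight_ge0 : forall x, 0 <= psi x ;
  weight_d1 : forall i x, `|rpart dir i psi x| <= eta * psi x ;
  weight_d2 : forall i x, `|rpart dir i (rpart dir i psi) x| <= eta * psi x ;
  weight_eta0 : 0 <= eta ;
  weight_eta : (3 * n%:R + 1) * eta <= 1 / 2 }.

(** Partial derivatives commute with 1 - Laplacian, so each application of it pays for
   one more derivative under the weight; the factor 4 accounts for the bound 2N and
   for real and imaginary parts. *)
Lemma weighted_chain psi eta (W : weight psi eta) j (g : E -> C) (N : R) : g \in @Bdot_pred R n ->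
  (forall x, psi x * normc (one_sub_laplacian j g x) <= N) ->
  forall w, (size w <= j)%N -> forall x, psi x * normc (pderiv w g x) <= 4 ^+ j * N.
Proof.
elim: j g => [|j ih] g Bg H w wj x; first by case: w wj => // _; rewrite mul1r; exact: H.
pose g1 : E -> C := g - laplacian g.
have Bg1 : g1 \in @Bdot_pred R n by rewrite rpredB// Bdot_pred_laplacian.
have H1 y : psi y * normc (one_sub_laplacian j g1 y) <= N.
  by have := H y; rewrite /one_sub_laplacian iterSr.
have /Bdot_predP[Br Bi] := Bg.
have key v : (size v <= j)%N -> (forall y, psi y * normc (pderiv v g y) <= 4 ^+ j.+1 * N) /\
    forall i y, psi y * normc (pderiv (i :: v) g y) <= 4 ^+ j.+1 * N.
  move=> vj; have {}ih := ih g1 Bg1 H1 v vj.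
  have hr y : psi y * `|rpd dir v (repart g) y - rlaplacian (rpd dir v (repart g)) y| <= 4 ^+ j * N.
    have := congr1 (fun u => u y) (rlaplacian_rpd v (rBdot_smooth Br)).
    rewrite -repart_sub_laplacian -repart_pderiv /= => <-.
    by apply: le_trans (ih y); rewrite ler_wpM2l ?(weight_ge0 W)// Re_le_normc.
  have hi y : psi y * `|rpd dir v (impart g) y - rlaplacian (rpd dir v (impart g)) y| <= 4 ^+ j * N.
    have := congr1 (fun u => u y) (rlaplacian_rpd v (rBdot_smooth Bi)).
    rewrite -impart_sub_laplacian -impart_pderiv /= => <-.
    by apply: le_trans (ih y); rewrite ler_wpM2l ?(weight_ge0 W)// Im_le_normc.
  have rr := weighted_resolvent_bound (weight_Bdot W) (rBdot_rpd v Br) (weight_ge0 W)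
    (weight_d1 W) (weight_d2 W) (weight_eta0 W) (weight_eta W) hr.
  have ri := weighted_resolvent_bound (weight_Bdot W) (rBdot_rpd v Bi) (weight_ge0 W)
    (weight_d1 W) (weight_d2 W) (weight_eta0 W) (weight_eta W) hi.
  have comb u y : psi y * `|rpd dir u (repart g) y| <= 2 * (4 ^+ j * N) ->
      psi y * `|rpd dir u (impart g) y| <= 2 * (4 ^+ j * N) ->
      psi y * normc (pderiv u g y) <= 4 ^+ j.+1 * N.
    move=> h1 h2; apply: le_trans (ler_wpM2l (weight_ge0 W y) (normc_le_ReIm _)) _.
    move: h1 h2; rewrite -repart_pderiv -impart_pderiv /repart /impart exprS; lra.
  by split=> [y|i y]; apply: comb; [exact: (rr y).1|exact: (ri y).1|exact: (rr y).2|exact: (ri y).2].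
case: w wj => [|i v] wj; first by have [h _] := key [::] isT; exact: h.
by have [_ h] := key v wj; exact: h.
Qed.

Definition real_Bdot psi (Bpsi : rBdot psi) : B := Bdot_of Bpsi (rBdotZ 0 Bpsi).

Lemma real_BdotE psi (Bpsi : rBdot psi) x : real_Bdot Bpsi x = (psi x)%:C.
Proof. by rewrite /real_Bdot/= /cplx mul0r. Qed.

Lemma weighted_norm_ge m (phi f : B) x :
  normc (phi x * one_sub_laplacian m f x) <= weighted_norm m phi f.
Proof.
apply: (@supnorm_ge R n (fun x => phi x * one_sub_laplacian m f x) x).
apply: bounded_funM; apply: Bdot_bounded; first exact: Bdot_funP.
by apply: Bdot_pred_one_sub_laplacian; exact: Bdot_funP.
Qed.

Lemma normc_one_sub_laplacian_le psi (Bpsi : rBdot psi) m f x : 0 <= psi x ->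
  psi x * normc (one_sub_laplacian m f x) <= weighted_norm m (real_Bdot Bpsi) f.
Proof.
move=> p0; have := weighted_norm_ge m (real_Bdot Bpsi) f x.
by rewrite real_BdotE normcM normc_real ger0_norm.
Qed.

(** A function f is decomposed along radii r k beyond which K is small by the factor
   4 ^- k, while the weight at r k is still of order 2 ^- k: the contributions of the
   pieces sum up. *)
Lemma compact_dual_dominated (K : set D) : compact K -> exists psi eta, exists m : nat,
  weight psi eta /\ exists2 Z : R, 0 <= Z & forall T f (S : R), K T -> 0 < S ->
  (forall w, (size w <= m)%N -> forall x, psi x * normc (pderiv w f x) <= S) ->
  normc (T f) <= Z * S.
Proof.
move=> cK; have [m [c c0 [Kc tight]]] := compact_dual_tight cK.
have [chi [kappa [A ch]]] := @cutoffs_exist R n.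
pose b := 2 ^+ m.+1 * A m + 1.
have A0 := cutoff_A0 ch m.
have b0 : 0 < b by rewrite ltr_wpDl// mulr_ge0 ?exprn_ge0.
have /choice[rad radP] k : exists R0 : R, forall T f, K T -> pderiv_le m 1 f ->
    (forall x, `|x| < R0 -> f x = 0) -> normc (T f) <= (1 / 4) ^+ k.
  by apply: tight; rewrite exprn_gt0// divr_gt0.
(* Nondecreasing, so that the truncations at r k and r k.+1 agree on the smaller
   ball, and unbounded, so that they exhaust f. *)
pose r k : R := 1 + k%:R + \sum_(j < k.+1) `|rad j|.
have sum0 k : 0 <= \sum_(j < k) `|rad j| by apply: sumr_ge0.
have r1 k : 1 <= r k by rewrite /r -addrA lerDl addr_ge0.
have rk k : k%:R <= r k.
  by rewrite /r; have := sum0 k.+1; lra.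
have rrad k : rad k <= r k.
  rewrite /r big_ord_recr/=; have := sum0 k; have := ler_norm (rad k).
  by have := ler0n R k; lra.
have rS k : r k <= r k.+1.
  rewrite /r (big_ord_recr k.+1)/= -natr1; have := normr_ge0 (rad k.+1); lra.
pose eta : R := (2 * (3 * n%:R + 1))^-1.
have n0 : (0 : R) <= n%:R by exact: ler0n.
have eta0 : 0 < eta by rewrite invr_gt0; lra.
have [psi [Bpsi psi0 d1 d2 psig]] := @weight_exists R n eta (fun k => kappa * r k) eta0.
pose q k : R := (1 / 2) ^+ k.+1 * (1 + n%:R)^-1.
have q0 k : 0 < q k by rewrite mulr_gt0 ?exprn_gt0 ?divr_gt0// invr_gt0; lra.
have W : weight psi eta.
  split=> //; first exact: ltW.
  by rewrite /eta invfM mulrCA divff ?mulr1 ?div1r// gt_eqF//; lra.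
exists psi, eta, m; split=> //.
exists (c * (b / q 0%N) + 2 * (4 * b / q 0%N)).
  have h : 0 <= b / q 0%N by rewrite divr_ge0 ?ltW.
  have h2 := mulr_ge0 (ltW c0) h; have := h; rewrite -mulrA; lra.
move=> T f S KT S0 fS.
pose F k := mul_Bdot (cutoff_mult ch (r k)) f.
(* The truncation lives where the weight is at least q k. *)
have FS k : pderiv_le m (b * (S / q k)) (F k).
  move=> w wm x; have Sq : 0 < S / q k by rewrite divr_gt0.
  have [xk|kx] := leP `|x| (kappa * r k).
    apply: (@le_trans _ _ (2 ^+ m.+1 * A m * (S / q k))).
      apply: (@pderiv_mul_Bdot R n _ _ f m) => //.
        by move=> w' w'm; exact: (cutoff_bound ch).
      move=> w' w'm; have qp := psig k x xk.
      rewrite ler_pdivlMr//; apply: le_trans (fS w' w'm x).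
      by rewrite mulrC ler_wpM2r ?normc_ge0.
    by rewrite ler_wpM2r ?(ltW Sq)// /b lerDl.
  rewrite (@pderiv_out_ball0 R n w _ (kappa * r k)) ?normc0//; first by rewrite mulr_ge0 ?ltW.
  by move=> y ky; apply: (mul_cutoff_out ch) => //; exact: ltW.
have bS k : 0 < b * (S / q k) by rewrite mulr_gt0// divr_gt0.
have qS k : q k.+1 = q k / 2.
  have h : (1 / 2 : R) ^+ k.+2 = 2^-1 * (1 / 2) ^+ k.+1 by rewrite exprS div1r.
  by rewrite /q h -mulrA mulrC.
(* Tightness gains 4 ^- k on a difference vanishing on the ball of radius r k, and
   dividing by the weight costs 2 ^ k. *)
have step k : normc (T (F k.+1 - F k)) <= (1 / 2) ^+ k * (4 * b / q 0%N * S).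
  pose M := 2 * (b * (S / q k.+1)).
  have M0 : 0 < M by rewrite mulr_gt0.
  have FM : pderiv_le m M (F k.+1 - F k : B).
    rewrite /M mulr2n mulrDl mul1r; apply: pderiv_leD; first exact: FS.
    rewrite -scaleN1r -[X in pderiv_le _ X]mul1r.
    rewrite -[X in X * (b * _)](_ : normc (-1 : R[i]) = 1); last by rewrite normcN normc1.
    apply: pderiv_leZ; apply: pderiv_leW (FS k) => //.
    rewrite ler_pM2l// ler_pM2l// lef_pV2 ?posrE// qS ler_pdivrMr// ler_peMr ?ltW//.
    by rewrite ltr1n.
  have := radP k T ((M^-1)%:C *: (F k.+1 - F k)) KT.
  rewrite dualZ normcM normc_real gtr0_norm ?invr_gt0// ler_pdivrMl// => H.
  apply: le_trans (H _ _) _.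
  - have -> : 1 = normc (M^-1%:C : R[i]) * M.
      by rewrite normc_real gtr0_norm ?invr_gt0// mulVf// gt_eqF.
    exact: pderiv_leZ.
  - move=> x xr; have xk : `|x| <= r k by rewrite ltW// (lt_le_trans xr).
    rewrite -[LHS]/(_ * (F k.+1 x - F k x)) /F !(mul_cutoff_in ch)// ?subrr ?mulr0//.
    exact: le_trans (rS k).
  rewrite /M le_eqVlt; apply/orP; left; apply/eqP.
  have -> : q k.+1 = (1 / 2) ^+ k.+1 * q 0%N by rewrite /q expr1 (exprSr _ k.+1) -mulrA.
  have -> : (1 / 4 : R) ^+ k = (1 / 2) ^+ k * (1 / 2) ^+ k.
    by rewrite -exprMn; congr (_ ^+ _); field.
  have h0 : (1 / 2 : R) ^+ k != 0 by rewrite expf_neq0// mulf_neq0// invr_neq0.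
  rewrite exprS; have := q0 0%N => /lt0r_neq0 qn.
  by field; rewrite qn h0.
have bound N : normc (T (F N)) <= (c * (b / q 0%N) + (2 - 2 * (1 / 2) ^+ N) * (4 * b / q 0%N)) * S.
  elim: N => [|N ih].
    rewrite expr0 mulr1 subrr mul0r addr0.
    by apply: le_trans (Kc T KT _ _ (bS 0%N) (FS 0%N)) _; rewrite !mulrA mulrAC.
  have -> : F N.+1 = (F N.+1 - F N) + F N by rewrite subrK.
  rewrite dualD (le_trans (le_normcD _ _))//.
  have := step N; have := ih; rewrite exprS; lra.
apply/ler_addgt0Pr => e e0.
have [t t1 tP] := dual_le_truncation ch f (ltW c0) (Kc T KT) e0.
have [N Nt] : exists N : nat, t <= N%:R.
  by exists (Num.bound t); apply: ltW; apply: archi_boundP; exact: le_trans t1.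
have -> : f = F N + (f - F N) by rewrite addrC subrK.
rewrite dualD (le_trans (le_normcD _ _))// lerD//; last first.
  by apply: tP; exact: le_trans (rk N).
apply: le_trans (bound N) _; rewrite ler_pM2r// lerD2l ler_pM2r; last first.
  by rewrite mulr_gt0 ?invr_gt0// mulr_gt0.
by rewrite gerBl mulr_ge0// exprn_ge0// divr_ge0.
Qed.

Lemma compact_dual_weighted (K : set D) : compact K -> exists m (phi : B),
  exists2 Z : R, 0 <= Z & forall T f, K T -> normc (T f) <= Z * weighted_norm m phi f.
Proof.
move=> cK; have [psi [eta [m [W [Z Z0 H]]]]] := compact_dual_dominated cK.
pose phi := real_Bdot (weight_Bdot W).
exists m, phi, (Z * 4 ^+ m); first by rewrite mulr_ge0// exprn_ge0.
move=> T f KT; apply/ler_addgt0Pr => e e0.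
have wn0 : 0 <= weighted_norm m phi f.
  by apply: le_trans (normc_ge0 _) (weighted_norm_ge m phi f 0).
have Z1 : 0 < Z + 1 by rewrite ltr_wpDl.
have d0 : 0 < e / (Z + 1) by rewrite divr_gt0.
apply: (@le_trans _ _ (Z * (4 ^+ m * weighted_norm m phi f + e / (Z + 1)))).
  apply: H => //; first by rewrite ltr_wpDl// mulr_ge0// exprn_ge0.
  move=> w wm x; apply: le_trans (_ : 4 ^+ m * weighted_norm m phi f <= _); last first.
    by rewrite lerDl ltW.
  apply: (weighted_chain W) wm x; first exact: Bdot_funP.
  by move=> x; exact: normc_one_sub_laplacian_le (weight_ge0 W x).
rewrite mulrDr mulrA lerD2l mulrCA ger_pMr// ler_pdivrMr// mul1r lerDl//.
Qed.

End weighted_domination.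

(** * Compactness of the polars *)

Section ultrafilter_limits.
Context (R : realType) (X : Type) (F : set_system X).

Lemma ultra_limit (UF : UltraFilter F) (v : X -> R) (M : R) : F [set x | `|v x| <= M] ->
  exists a : R, forall e : R, 0 < e -> F [set x | `|v x - a| <= e].
Proof.
move=> FM; have PF : ProperFilter F by exact: ultra_proper.
have PvF : ProperFilter (v @ F) by exact: fmap_proper_filter.
have [|a [_ va]] := @segment_compact R (- M) M (v @ F) PvF.
  by apply: (@filterS X F _ _ _ _ FM) => x h; rewrite /= in_itv/= -ler_norml.
exists a => e e0.
have [//|nP] := in_ultra_setVsetC [set x | `|v x - a| <= e] UF.
have [y [[x nx <-]]] : (v @` (~` [set x | `|v x - a| <= e]) `&` ball a e) !=set0.
  apply: va; last exact: nbhsx_ballx.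
  by apply: (@filterS X F _ _ _ _ nP) => x nx; exists x.
by rewrite -ball_normE/= distrC => /ltW xa; case: nx.
Qed.

Lemma ultra_limit_complex (UF : UltraFilter F) (v : X -> R[i]) (M : R) :
  F [set x | normc (v x) <= M] ->
  exists a : R[i], forall e : R, 0 < e -> F [set x | normc (v x - a) <= e].
Proof.
move=> FM.
have [a aP] : exists a : R, forall e : R, 0 < e -> F [set x | `|complex.Re (v x) - a| <= e].
  by apply: (ultra_limit UF (M := M)); apply: filterS FM => x; exact: le_trans (Re_le_normc _).
have [b bP] : exists a : R, forall e : R, 0 < e -> F [set x | `|complex.Im (v x) - a| <= e].
  by apply: (ultra_limit UF (M := M)); apply: filterS FM => x; exact: le_trans (Im_le_normc _).
exists (a +i* b)%C => e e0; have e2 : 0 < e / 2 by rewrite divr_gt0.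
apply: filterS2 (aP _ e2) (bP _ e2) => x h1 h2.
by apply: le_trans (normc_le_ReIm _) _; rewrite !raddfB (splitr e) lerD.
Qed.

End ultrafilter_limits.

Section polar_compactness.
Context (R : realType) (n : nat).
Local Notation E := 'rV[R]_n.
Local Notation C := R[i]^o.
Local Notation B := (Bdot R n).
Local Notation D := (strong_dual (Bdot R n)).
Local Notation dir := (@dir R n).
Implicit Types (T : D) (f g : B).

(** The operator costs two orders of differentiation at each application. *)
Lemma pderiv_le_one_sub_laplacian m j (M : R) (g : E -> C) : g \in @Bdot_pred R n ->
  pderiv_le (j + 2 * m) M g ->
  pderiv_le j ((2 * (1 + n%:R)) ^+ m * M) (one_sub_laplacian m g).
Proof.
elim: m g M => [|m ih] g M Bg H.
  by rewrite expr0 mul1r; move: H; rewrite muln0 addn0.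
rewrite /one_sub_laplacian iterSr -/(one_sub_laplacian m _) exprSr -mulrA.
apply: ih; first by rewrite rpredB// Bdot_pred_laplacian.
have /Bdot_predP[Br Bi] := Bg.
have key (u : E -> R) : rBdot u ->
    (forall w, (size w <= j + 2 * m.+1)%N -> forall x, `|rpd dir w u x| <= M) ->
    forall w, (size w <= j + 2 * m)%N -> forall x,
    `|rpd dir w (fun x => u x + -1 * rlaplacian u x) x| <= (1 + n%:R) * M.
  move=> Bu uM w wm x; rewrite rlaplacian_rpd; last exact: rBdot_smooth.
  rewrite (le_trans (ler_normB _ _))// mulrDl mul1r lerD//.
    by apply: uM; rewrite (leq_trans wm)// leq_add2l leq_mul2l leqnSn orbT.
  rewrite (le_trans (ler_norm_sum _ _ _))//.
  rewrite (@le_trans _ _ (\sum_(i < n) M))//; last by rewrite sumr_const card_ord mulr_natl.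
  apply: ler_sum => i _; rewrite -[rpart _ _ _]/(rpd dir [:: i, i & w] u).
  by apply: uM; rewrite /= mulnS addnCA addnC addn2 !ltnS.
rewrite -mulrA; apply: pderiv_le_parts => w wm x.
  rewrite repart_sub_laplacian; apply: key => // w' w'm y.
  exact: pderiv_le_repart H w'm.
rewrite impart_sub_laplacian; apply: key => // w' w'm y.
exact: pderiv_le_impart H w'm.
Qed.

Lemma Bdot_sup f : exists2 c : R, 0 <= c & forall x, normc (f x) <= c.
Proof.
exists (Bdot_norm 0 f); first exact: Bdot_norm_ge0.
by move=> x; exact: (pderiv_le_norm (m := 0) f (w := [::])).
Qed.

Lemma weighted_norm_le m (phi f : B) (M : R) :
  (forall x, normc (phi x * one_sub_laplacian m f x) <= M) -> weighted_norm m phi f <= M.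
Proof. exact: supnorm_le. Qed.

Lemma weighted_norm_continuous m (phi : B) : exists2 c : R, 0 <= c &
  forall f, weighted_norm m phi f <= c * Bdot_norm (2 * m) f.
Proof.
have [c c0 phic] := Bdot_sup phi.
exists (c * (2 * (1 + n%:R)) ^+ m) => [|f].
  by rewrite mulr_ge0// exprn_ge0// mulr_ge0// addr_ge0.
apply: weighted_norm_le => x; rewrite normcM -mulrA ler_pM ?normc_ge0//.
have := @pderiv_le_one_sub_laplacian m 0 _ f (Bdot_funP f) (pderiv_le_norm (m := 2 * m) f).
by move=> /(_ [::] isT x).
Qed.

Lemma one_sub_laplacianB m f g x :
  one_sub_laplacian m (f - g : B) x = one_sub_laplacian m f x - one_sub_laplacian m g x.
Proof.
have -> : Bdot_fun (f - g) = (-1) *: Bdot_fun g + Bdot_fun f.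
  by rewrite scaleN1r addrC.
rewrite one_sub_laplacian_lin ?Bdot_funP// scaleN1r addrC.
by [].
Qed.

Lemma linear_le_continuous (t : B -> C) k (c : R) : linear t ->
  (forall f, normc (t f) <= c * Bdot_norm k f) -> continuous t.
Proof.
move=> tl tc f; apply: (@cvgrPdist_le R[i] C _ (nbhs f) (nbhs_filter f) t (t f)).2 => e e0.
have eE : e = (complex.Re e)%:C by rewrite RRe_real// gtr0_real.
have e0' : 0 < complex.Re e by move: e0; rewrite {1}eE ltcR.
have c0 : 0 < `|c| + 1 by rewrite ltr_wpDl.
exists [:: k], (complex.Re e / (`|c| + 1)); first by rewrite divr_gt0.
move=> g; rewrite /seminorm_ball/= andbT ltr_pdivlMr// => gf.
rewrite -normrN opprB -[`|_|]/((normc _)%:C) eE lecR.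
have -> : t g - t f = t (g - f).
  have -> : g - f = (-1) *: f + g by rewrite scaleN1r addrC.
  by rewrite tl scaleN1r addrC.
apply: le_trans (tc _) _; apply: le_trans (ltW gf).
rewrite mulrC ler_wpM2l ?Bdot_norm_ge0// (le_trans (ler_norm c))// lerDl//.
Qed.

Definition dual_of (t : B -> C) (tl : linear t) (tc : continuous t) : D :=
  @StrongDual _ _ t (asboolT (conj tl tc)).

Definition polar m (phi : B) : set D :=
  [set T | forall f, normc (T f) <= weighted_norm m phi f].

Lemma weighted_norm_ge0 m (phi f : B) : 0 <= weighted_norm m phi f.
Proof. exact: le_trans (normc_ge0 _) (weighted_norm_ge m phi f 0). Qed.

Lemma polar_abs_convex m phi : absolutely_convex (polar m phi).
Proof.
move=> S T AS AT a b ab f.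
rewrite -[X in normc X]/(a * S f + b * T f).
apply: le_trans (le_normcD _ _) _; rewrite !normcM.
have ab' : normc a + normc b <= 1.
  by move: ab; rewrite -[`|a|]/((normc a)%:C) -[`|b|]/((normc b)%:C) -rmorphD/= -[1]/(1%:C) lecR.
have p0 := weighted_norm_ge0 m phi f.
apply: (@le_trans _ _ ((normc a + normc b) * weighted_norm m phi f)).
  by rewrite mulrDl lerD// ler_wpM2l ?normc_ge0.
by rewrite ler_piMl.
Qed.

(** Arzela-Ascoli along an ultrafilter: after applying (1 - Laplacian)^m the functions
   of G are equi-Lipschitz, so their pointwise convergence is uniform on a ball;
   outside of it phi makes them small. *)
Lemma ultra_weighted_cauchy (X : Type) (F : set_system X) (UF : UltraFilter F)
    (h : X -> B) (G : set B) m (phi : B) (e : R) :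
  Bdot_bounded_set G -> F [set x | G (h x)] -> 0 < e ->
  exists2 Q, F Q & forall x y, Q x -> Q y -> weighted_norm m phi (h x - h y) <= e.
Proof.
move=> bG FG e0; have [c c0 phic] := Bdot_sup phi.
have [M0 M00 GM0] := bG (1 + 2 * m)%N.
pose M := (2 * (1 + n%:R)) ^+ m * M0.
have n1 : (0 : R) < 2 * (1 + n%:R) by rewrite mulr_gt0// ltr_pwDl.
have M_gt0 : 0 < M by rewrite mulr_gt0// exprn_gt0.
have zM f : G f -> pderiv_le 1 M (one_sub_laplacian m f).
  by move=> Gf; apply: pderiv_le_one_sub_laplacian; [exact: Bdot_funP|exact: GM0].
have zL f : G f -> forall x y, normc (one_sub_laplacian m f x - one_sub_laplacian m f y) <=
    2 * (n%:R * M) * `|x - y|.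
  move=> Gf x y; have /Bdot_predP[Br Bi] := Bdot_pred_one_sub_laplacian m (Bdot_funP f).
  apply: le_trans (normc_le_ReIm _) _; rewrite !raddfB mulr2n mulrDl mul1r mulrDl.
  have := zM f Gf => H; apply: lerD.
    apply: (@lipschitz_of_partials R n (repart (one_sub_laplacian m f))
      (fun i => rpart dir i (repart (one_sub_laplacian m f)))) => [i z|i z].
      exact: rsmooth_is_derive (rBdot_smooth Br).
    exact: (pderiv_le_repart (w := [:: i]) z H).
  apply: (@lipschitz_of_partials R n (impart (one_sub_laplacian m f))
      (fun i => rpart dir i (impart (one_sub_laplacian m f)))) => [i z|i z].
    exact: rsmooth_is_derive (rBdot_smooth Bi).
  exact: (pderiv_le_impart (w := [:: i]) z H).
pose z x := one_sub_laplacian m (h x).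
pose e' := e / (c + 1).
have c1 : 0 < c + 1 by rewrite ltr_wpDl.
have e'0 : 0 < e' by rewrite divr_gt0.
have [r r1 rP] := Bdot_vanish_size phi 0 (divr_gt0 e0 (mulr_gt0 (ltr0Sn R 1) M_gt0)).
have /compact_near_coveringP nc := @compact_cball R n r.
have := nc (X * X)%type (filter_prod F F)
  (fun xy a => G (h xy.1) -> G (h xy.2) -> normc (z xy.1 a - z xy.2 a) <= e') _.
case.
  move=> a _; have [l lP] : exists l : R[i], forall d : R, 0 < d -> F [set x | normc (z x a - l) <= d].
    apply: (ultra_limit_complex UF (M := M)); apply: filterS FG => x Gx.
    exact: (zM _ Gx [::]).
  have e6 : 0 < e' / 6 by rewrite divr_gt0.
  have L1 : 0 < 2 * (n%:R * M) + 1 by rewrite ltr_wpDl// !mulr_ge0// ltW.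
  exists (ball a (e' / 6 / (2 * (n%:R * M) + 1)),
      [set x | normc (z x.1 a - l) <= e' / 6] `&` [set x | normc (z x.2 a - l) <= e' / 6]).
    split; first by apply: nbhsx_ballx; rewrite divr_gt0.
    exists ([set x | normc (z x a - l) <= e' / 6], [set x | normc (z x a - l) <= e' / 6]).
      by split; exact: lP.
    by move=> [x y] /= [].
  move=> [b [x y]] /= [ab [xl yl]] Gx Gy.
  have ab' : 2 * (n%:R * M) * `|b - a| <= e' / 6.
    move: ab; rewrite -ball_normE/= ltr_pdivlMr// distrC mulrC => /ltW; apply: le_trans.
    by rewrite ler_wpM2r// lerDl.
  have zx := le_trans (zL _ Gx b a) ab'; have zy := le_trans (zL _ Gy b a) ab'.
  have -> : z x b - z y b = (z x b - z x a) + (z x a - l) + (- (z y a - l) + - (z y b - z y a)).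
    by ring.
  apply: le_trans (le_normcD _ _) _.
  have := le_normcD (z x b - z x a) (z x a - l).
  have := le_normcD (- (z y a - l)) (- (z y b - z y a)).
  by rewrite !normcN; move: xl yl zx zy; rewrite /z; lra.
move=> [Q1 Q2] /= [FQ1 FQ2] QP.
exists (Q1 `&` Q2 `&` [set x | G (h x)]); first by apply: filterI => //; exact: filterI.
move=> x y [[Q1x Q2x] Gx] [[Q1y Q2y] Gy]; apply: weighted_norm_le => a.
rewrite normcM one_sub_laplacianB.
have [ar|ra] := leP `|a| r.
  have H : normc (z x a - z y a) <= e' by apply: (QP (x, y)).
  apply: (@le_trans _ _ (c * e')); first by rewrite ler_pM ?normc_ge0.
  by rewrite mulrCA ger_pMr// ler_pdivrMr// mul1r lerDl.
apply: (@le_trans _ _ (e / (2 * M) * (2 * M))); last by rewrite divfK// gt_eqF// mulr_gt0.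
rewrite ler_pM ?normc_ge0//; first exact: (rP [::] isT a (ltW ra)).
apply: le_trans (le_normcD _ _) _; rewrite normcN mulr2n mulrDl mul1r lerD//.
  exact: (zM _ Gx [::]).
exact: (zM _ Gy [::]).
Qed.

(** Alaoglu and Arzela-Ascoli: along an ultrafilter the functionals converge
   pointwise, to a functional of the polar; on a bounded set G the convergence is
   uniform because G is totally bounded for the seminorm that dominates them. *)
Lemma polar_compact m phi : compact (polar m phi).
Proof.
rewrite compact_ultra => F UF FA; set p := weighted_norm m phi.
have PF : ProperFilter F by exact: ultra_proper.
have /choice[t tP] f : exists a : R[i], forall e : R, 0 < e -> F [set T : D | normc (T f - a) <= e].
  by apply: (ultra_limit_complex UF (M := p f)); apply: filterS FA => T; exact.
have small (z : R[i]) (c : R) : 0 < c -> (forall e : R, 0 < e -> normc z <= c * e) -> z = 0.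
  move=> c0 H; apply: eq0_normc; apply/eqP; rewrite eq_le normc_ge0 andbT.
  apply/ler_addgt0Pr => e e0; rewrite add0r.
  by apply: le_trans (H _ (divr_gt0 e0 c0)) _; rewrite mulrC divfK// gt_eqF.
have tl : linear (t : B -> C).
  move=> a f g; apply/eqP; rewrite -subr_eq0; apply/eqP.
  apply: (small _ (2 + normc a)) => [|e e0]; first by rewrite ltr_pwDl// normc_ge0.
  have [T [[H1 H2] H3]] := filter_ex (filterI (filterI (tP (a *: f + g) e e0) (tP f e e0)) (tP g e e0)).
  have TE : T (a *: f + g) = a * T f + T g by rewrite dualD dualZ.
  rewrite -[a *: t f]/(a * t f).
  have -> : t (a *: f + g) - (a * t f + t g) =
      - (T (a *: f + g) - t (a *: f + g)) + (a * (T f - t f) + (T g - t g)).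
    by rewrite TE; ring.
  apply: le_trans (le_normcD _ _) _; rewrite normcN.
  have := le_normcD (a * (T f - t f)) (T g - t g); rewrite normcM.
  have := ler_wpM2l (normc_ge0 a) H2; move: H1 H3; rewrite /=; lra.
have tp f : normc (t f) <= p f.
  apply/ler_addgt0Pr => e e0; have [T [H1 H2]] := filter_ex (filterI (tP f e e0) FA).
  have -> : t f = T f - (T f - t f) by rewrite subKr.
  by apply: le_trans (le_normcD _ _) _; rewrite normcN lerD//; exact: H2.
have [c c0 pc] := weighted_norm_continuous m phi.
have tc : continuous (t : B -> C).
  by apply: (linear_le_continuous tl) => f; exact: le_trans (tp f) (pc f).
exists (dual_of tl tc); split; first exact: tp.
apply: strong_cvg => G e bG e0.
set P := [set T' : D | _].
have [//|nP] := in_ultra_setVsetC P UF.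
have /choice[h hP] (T : D) : exists f, ~ P T -> G f /\ e < normc (T f - t f).
  have [PT|nPT] := pselect (P T); first by exists 0.
  apply: contrapT => H; apply: nPT => f Gf; rewrite leNgt; apply/negP => ef.
  by apply: H; exists f.
(* If the convergence were not uniform on G, each T of a set of the ultrafilter
   would have a witness h T in G; but the witnesses cluster. *)
have FG : F [set T | G (h T)] by apply: filterS nP => T /hP[].
have e4 : 0 < e / 4 by rewrite divr_gt0.
have [Q FQ Qh] := @ultra_weighted_cauchy D F UF h G m phi (e / 4) bG FG e4.
have [T0 Q0] := filter_ex FQ.
have [T [[QT AT] [nPT HT]]] :=
  filter_ex (filterI (filterI FQ FA) (filterI nP (tP (h T0) _ e4))); have [_ eT] := hP T nPT.
move: eT; rewrite ltNge => /negP; case.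
pose T1 := dual_of tl tc.
have t0 : t (h T0) - t (h T) = t (h T0 - h T) by exact: (esym (dualB T1 (h T0) (h T))).
have -> : T (h T) - t (h T) = T (h T - h T0) + (T (h T0) - t (h T0)) + t (h T0 - h T).
  by rewrite -t0 dualB; ring.
apply: le_trans (le_normcD _ _) _.
have := le_normcD (T (h T - h T0)) (T (h T0) - t (h T0)).
have := AT (h T - h T0); have := tp (h T0 - h T).
have := Qh T T0 QT Q0; have := Qh T0 T Q0 QT; move: HT; rewrite /= /p; lra.
Qed.

(** The point evaluations of phi * (1 - Laplacian)^m f belong to the polar. *)
Lemma polar_bound m phi f (e : R) : (forall T, polar m phi T -> normc (T f) <= e) ->
  weighted_norm m phi f <= e.
Proof.
move=> H; apply: weighted_norm_le => x.
pose t g : C := phi x * one_sub_laplacian m g x.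
have tl : linear (t : B -> C).
  move=> a g k; rewrite /t one_sub_laplacian_lin ?Bdot_funP// mulrDr; congr (_ + _).
  by rewrite -[(a *: _) x]/(a * one_sub_laplacian m g x) mulrCA.
have tp g : normc (t g) <= weighted_norm m phi g by exact: weighted_norm_ge.
have [c c0 pc] := weighted_norm_continuous m phi.
have tc : continuous (t : B -> C).
  by apply: (linear_le_continuous tl) => g; exact: le_trans (tp g) (pc g).
exact: (H (dual_of tl tc)).
Qed.

End polar_compactness.

(** * Equality of the topologies *)

Lemma kappa_nbhs (R : realType) (n : nat) (x : kappa (Bdot R n)) m (phi : Bdot R n) (e : R) :
  0 < e -> nbhs x [set y : kappa (Bdot R n) | weighted_norm m phi (y - x : Bdot R n) < e].
Proof.
move=> e0.
have fA : @abs_convex_compact _ (Bdot R n) (polar m phi).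
  by split; [exact: polar_abs_convex|exact: polar_compact].
have e2 : 0 < e / 2 by rewrite divr_gt0.
have := @nbhs_initial_family R (kappa (Bdot R n)) (strong_dual (Bdot R n))
  (@abs_convex_compact _ (Bdot R n)) (fun v T => T v) x (polar m phi) (e / 2) fA e2.
apply: filterS => y H; apply: le_lt_trans (_ : e / 2 < e); last first.
  by rewrite ltr_pdivrMr// ltr_pMr// ltr1n.
by apply: polar_bound => T AT; rewrite dualB; exact: H.
Qed.

Theorem proposition4p16 (R : realType) (n : nat) (n_gt0 : (0 < n)%N)
    (U : set (Bdot R n)) :
  @open (kappa (Bdot R n)) U <-> @open (seminormed (@weighted_seminorm R n)) U.
Proof.
split=> oU; rewrite openE => x Ux.
  have nU : nbhs (x : kappa (Bdot R n)) U by exact: open_nbhs_nbhs.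
  suff : nbhs (x : seminormed (@weighted_seminorm R n)) --> (x : kappa (Bdot R n)) by exact.
  apply: (@cvg_initial_family R (kappa (Bdot R n)) (strong_dual (Bdot R n))
    (@abs_convex_compact _ (Bdot R n)) (fun v T => T v)) => A e [_ cA] e0.
  have [m [phi [Z Z0 H]]] := compact_dual_weighted cA.
  have Z1 : 0 < Z + 1 by rewrite ltr_wpDl.
  exists [:: (m, phi)], (e / (Z + 1)); first by rewrite divr_gt0.
  move=> y; rewrite /seminorm_ball/= andbT ltr_pdivlMr// => yx T AT.
  rewrite -dualB; apply: le_trans (H T _ AT) _; apply: le_trans (ltW yx).
  by rewrite mulrC ler_wpM2l ?weighted_norm_ge0// lerDl.
have : nbhs (x : seminormed (@weighted_seminorm R n)) U by exact: open_nbhs_nbhs.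
move=> [s [e e0 sU]]; apply: (@filterS _ (nbhs (x : kappa (Bdot R n))) _ _ _ sU).
rewrite /seminorm_ball; elim: s {sU} => [|[m phi] s ih].
  exact: filterS (@filterT _ (nbhs (x : kappa (Bdot R n))) _).
apply: filterS2 (kappa_nbhs x m phi e0) ih => y h1 h2 /=.
by apply/andP; split.
Qed.
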